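(* Let $\alpha\in(0,1)$, $\beta\in(0,1]$, $p\ge2$, and let $G:[0,T]\to L^p(\Omega,H)$ be measurable with $\sup_{t\in[0,T]}\|G(t)\|_{L^p(\Omega,H)}<\infty$. For $t\in[0,T]$ let $$\Upsilon_G(t)=\int_0^t\mathcal S_0(t-u)G(u)\,\mathrm du=\Phi(t)+\Psi(t),\quad\Phi(t)=\int_0^t\mathcal S_0(t-u)G(0)\,\mathrm du,\quad\Psi(t)=\int_0^t\mathcal S_0(t-u)\big(G(u)-G(0)\big)\,\mathrm du.$$ Then: (1) There is a constant $C>0$ such that for all $0<s<t\le T$, $\|\Phi(t)-\Phi(s)\|_{L^p(\Omega,H)}\le C(t^\alpha-s^\alpha)$. (2) If there exist constants $K>0$, $\mu<1$ and $\nu\in(-\alpha,1)$ such that for all $0<u_1<u_2\le T$, $$\|G(u_2)-G(u_1)\|_{L^p(\Omega,H)}\le K\,u_1^{-\mu}(u_2-u_1)^\nu,$$ then, for every sufficiently small $\varepsilon>0$, there is a constant $C>0$ such that for all $0<s<t\le T$, $$\|\Psi(t)-\Psi(s)\|_{L^p(\Omega,H)}\le C(t^\alpha-s^\alpha)+C\,s^{-\mu}(t-s)^{\min\{\alpha+\nu-\varepsilon,\,1\}}.$$ As a result, for all $0<s<t\le T$, $$\|\Upsilon_G(t)-\Upsilon_G(s)\|_{L^p(\Omega,H)}\le C(t^\alpha-s^\alpha)+C\,s^{-\mu}(t-s)^{\min\{\alpha+\nu-\varepsilon,\,1\}}.$$ All constants $C>0$ are independent of $t$ and $s$.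
   Context: $T>0$; $(\Omega,\mathscr F,\mathbb P)$ is a complete probability space. $\mathbb D\subset\mathbb R^d$, $d\in\{1,2,3\}$, is a convex polygonal domain; $H=L^2(\mathbb D)$ with inner product $\langle\cdot,\cdot\rangle$; $A=-\Delta$ is the negative Dirichlet Laplacian on $\mathbb D$ with eigenpairs $\{(\lambda_k,\phi_k)\}_{k\ge1}$, $0<\lambda_1\le\lambda_2\le\cdots$, $\{\phi_k\}$ an orthonormal basis of $H$. For $t>0$, $\mathcal S_0(t)\psi=t^{\alpha-1}\sum_kE_{\alpha,\alpha}(-\lambda_k^\beta t^\alpha)\langle\psi,\phi_k\rangle\phi_k$ for $\psi\in H$, where $E_{a,b}(z)=\sum_{k\ge0}z^k/\Gamma(ak+b)$ is the Mittag--Leffler function. *)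

(* Defs.v *)
From HB Require Import structures.
From mathcomp Require Import all_boot all_order all_algebra.
From mathcomp Require Import all_classical all_reals all_analysis.

Set Implicit Arguments.
Unset Strict Implicit.
Unset Printing Implicit Defensive.

Import Order.TTheory GRing.Theory Num.Theory.
Import numFieldNormedType.Exports.

Local Open Scope classical_set_scope.
Local Open Scope ring_scope.

Definition row_display : measure_display.
Proof. exact: default_measure_display. Qed.

(* The sigma-algebra on R^n generated by the coordinates, i.e. the Borel one. *)
Section measurable_row.
Context {R : realType} (n : nat).

Let coor (i : 'I_n) (x : 'rV[R]_n) : R := x ord0 i.

Let row_set0 : g_sigma_preimage coor set0.
Proof. exact: sigma_algebra0. Qed.

Let row_setC A : g_sigma_preimage coor A -> g_sigma_preimage coor (~` A).
Proof. exact: sigma_algebraC. Qed.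

Let row_bigcup (F : (set 'rV[R]_n)^nat) :
  (forall i, g_sigma_preimage coor (F i)) ->
  g_sigma_preimage coor (\bigcup_i (F i)).
Proof. exact: sigma_algebra_bigcup. Qed.

HB.instance Definition _ :=
  @isMeasurable.Build row_display 'rV[R]_n (g_sigma_preimage coor)
    row_set0 row_setC row_bigcup.

End measurable_row.

Section measurable_row_lemmas.
Context {R : realType} (n : nat).

Lemma measurable_coor (i : 'I_n) :
  measurable_fun setT (fun x : 'rV[R]_n => x ord0 i).
Proof.
move=> _ Y mY; rewrite setTI; apply: sub_sigma_algebra => /=.
rewrite -bigcup_seq/=; exists i => /=; first by rewrite mem_index_enum.
by exists Y => //; rewrite setTI.
Qed.

Lemma measurable_fun_row d (T : measurableType d) (f : T -> 'rV[R]_n) :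
  (forall i, measurable_fun setT (fun t => f t ord0 i)) -> measurable_fun setT f.
Proof.
move=> mf; suff : g_sigma_preimage (fun i t => f t ord0 i) `<=` measurable.
  have -> : (fun i t => f t ord0 i) =
      (fun i => (fun x : 'rV[R]_n => x ord0 i) \o f) by [].
  rewrite g_sigma_preimage_comp => fS _ A mA; rewrite setTI; apply: fS.
  by exists A => //; rewrite setTI.
apply: smallest_sub; first exact: sigma_algebra_measurable.
case: n => [|m] in f mf *; first by rewrite big_ord0.
rewrite -bigcup_mkord_ord; apply: bigcup_sub => i Ii.
by move=> A [B mB <-]; exact: mf.
Qed.

End measurable_row_lemmas.

(* Lebesgue measure on R^(n+1) is the image of the product of the Lebesgue
   measures on R and R^n; the sigma-finite structure is carried along because
   the product measure needs it. *)
Section lebesgue_row.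
Context {R : realType} (n : nat).

Definition cons_row (p : measurableTypeR R * 'rV[R]_n) : 'rV[R]_n.+1 :=
  row_mx (p.1 : R)%:M p.2 : 'rV_(1 + n).

Definition uncons_row (x : 'rV[R]_n.+1) : measurableTypeR R * 'rV[R]_n :=
  (x ord0 ord0, rsubmx (x : 'rV_(1 + n))).

Lemma cons_rowK : cancel cons_row uncons_row.
Proof.
case=> a v; rewrite /uncons_row /cons_row /=; congr pair; last exact: row_mxKr.
have <- : lshift n (ord0 : 'I_1) = ord0 :> 'I_n.+1 by apply/val_inj.
by apply: (etrans (row_mxEl _ _ _ _)); rewrite mxE eqxx.
Qed.

Lemma measurable_cons_row : measurable_fun setT cons_row.
Proof.
apply: measurable_fun_row => i; case: (@split_ordP 1 n i) => j ->.
- rewrite (_ : (fun _ => _) = fst); first exact: measurable_fst.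
  apply/funext => p; apply: (etrans (row_mxEl _ _ _ _)).
  by rewrite mxE !ord1 eqxx.
- rewrite (_ : (fun _ => _) = (fun x : 'rV[R]_n => x ord0 j) \o snd).
    by apply: measurableT_comp; [exact: measurable_coor|exact: measurable_snd].
  by apply/funext => p; apply: (etrans (row_mxEr _ _ _ _)).
Qed.

Lemma measurable_uncons_row : measurable_fun setT uncons_row.
Proof.
apply/measurable_fun_pairP; split; first exact: measurable_coor.
apply: measurable_fun_row => i /=.
rewrite (_ : (fun _ => _) = fun x : 'rV[R]_n.+1 => x ord0 (rshift 1 i)).
  exact: measurable_coor.
by apply/funext => x; rewrite mxE.
Qed.

Variable mu : {sigma_finite_measure set 'rV[R]_n -> \bar R}.

Definition cons_measure : set 'rV[R]_n.+1 -> \bar R :=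
  pushforward (lebesgue_measure \x mu)%E cons_row.

Let cons_measure0 : cons_measure set0 = 0%E.
Proof. by rewrite /cons_measure /pushforward preimage_set0 measure0. Qed.

Let cons_measure_ge0 A : (0 <= cons_measure A)%E.
Proof. by rewrite /cons_measure /pushforward measure_ge0. Qed.

Let cons_measure_sigma_additive : semi_sigma_additive cons_measure.
Proof.
move=> F mF tF mUF; rewrite /cons_measure /pushforward preimage_bigcup.
apply: measure_semi_sigma_additive.
- by move=> k; rewrite -[X in measurable X]setTI; exact: measurable_cons_row.
- apply/trivIsetP => /= i j _ _ ij; rewrite -preimage_setI.
  by move/trivIsetP : tF => /(_ _ _ _ _ ij) -> //; rewrite preimage_set0.
- rewrite -preimage_bigcup -[X in measurable X]setTI.
  exact: measurable_cons_row.
Qed.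

HB.instance Definition _ := isMeasure.Build _ _ _ cons_measure
  cons_measure0 cons_measure_ge0 cons_measure_sigma_additive.

Let cons_measure_sigma_finite : sigma_finite setT cons_measure.
Proof.
have /sigma_finiteP[F [FT ndF Foo]] := sigma_finiteT (@lebesgue_measure R).
have /sigma_finiteP[G [GT ndG Goo]] := sigma_finiteT mu.
exists (fun k => uncons_row @^-1` (F k `*` G k)) => [|k].
  rewrite -preimage_bigcup; apply/esym; rewrite -subTset => x _ /=.
  have [k _ Fk] : (\bigcup_k F k) (uncons_row x).1 by rewrite -FT.
  have [l _ Gl] : (\bigcup_k G k) (uncons_row x).2 by rewrite -GT.
  exists (maxn k l) => //; split.
  - by move: Fk; exact/subsetPset/ndF/leq_maxl.
  - by move: Gl; exact/subsetPset/ndG/leq_maxr.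
have [[mF Fk] [mG Gk]] := (Foo k, Goo k); split.
  rewrite -[X in measurable X]setTI; apply: measurable_uncons_row => //.
  exact: measurableX.
rewrite /cons_measure /pushforward -comp_preimage.
rewrite (_ : uncons_row \o cons_row = id).
  by rewrite preimage_id product_measure1E// lte_mul_pinfty// ge0_fin_numE.
by apply/funext => p; exact: cons_rowK.
Qed.

HB.instance Definition _ := @Measure_isSigmaFinite.Build _ _ _ cons_measure
  cons_measure_sigma_finite.

End lebesgue_row.

Fixpoint lebesgue_row {R : realType} (n : nat) :
    {sigma_finite_measure set 'rV[R]_n -> \bar R} :=
  if n is m.+1 then cons_measure (@lebesgue_row R m) else \d_(0 : 'rV[R]_0).

(* Integration of functions with values in a seminormed space, given by a set V
   of an ambient vector space E and a [0, +oo]-valued seminorm N on E that is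
   finite on V.  Vectors at N-distance 0 are identified: this is how classes of
   almost everywhere equal functions are dealt with below. *)
Section bochner.
Context d (T : measurableType d) (R : realType).
Variables (mu : {measure set T -> \bar R}) (E : lmodType R).
Variables (V : set E) (N : E -> \bar R) (D : set T).

Record step := Step {
  step_size : nat ;
  step_set : 'I_step_size -> set T ;
  step_val : 'I_step_size -> E }.

Definition step_fun (s : step) (t : T) : E :=
  \sum_(i < step_size s) (\1_(step_set i) t : R) *: step_val i.

Definition simple_step (s : step) :=
  forall i : 'I_(step_size s), measurable (step_set i) /\ V (step_val i).

Definition strongly_measurable (f : T -> E) :=
  (forall t, D t -> V (f t)) /\
  exists s : nat -> step, (forall n, simple_step (s n)) /\
    {ae mu, forall t, D t -> N (f t - step_fun (s n) t) @[n --> \oo] --> 0%E}.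

Definition step_integral (s : step) : E :=
  \sum_(i < step_size s) fine (mu (step_set i `&` D)) *: step_val i.

Definition is_bochner_integral (f : T -> E) (v : E) :=
  [/\ strongly_measurable f, V v &
    exists s : nat -> step,
      [/\ forall n, simple_step (s n),
          forall n (i : 'I_(step_size (s n))), (mu (step_set i `&` D) < +oo)%E,
          (\int[mu]_(t in D) N (f t - step_fun (s n) t))%E @[n --> \oo] --> 0%E
        & N (v - step_integral (s n)) @[n --> \oo] --> 0%E]].

(* The value, unique up to N, is 0 when f is not Bochner integrable on D. *)
Definition bochner_integral (f : T -> E) : E := xget 0 (is_bochner_integral f).

End bochner.

Section L2.
Context {R : realType} (d : nat) (D : set 'rV[R]_d).
Implicit Types f g u : 'rV[R]_d -> R.

(* L^2(D); since 'f \_ D' vanishes outside D, only the values on D matter. *)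
Definition L2_norm f : \bar R := Lnorm (lebesgue_row d) 2%:E (EFin \o (f \_ D)).

Definition L2 : set ('rV[R]_d -> R) :=
  [set f | f \_ D \in Lfun (lebesgue_row d) 2%:E].

Definition inner f g : R := \int[lebesgue_row d]_(x in D) (f x * g x).

Definition L2_cvg (u_ : nat -> 'rV[R]_d -> R) u :=
  L2_norm (u_ n - u) @[n --> \oo] --> 0%E.

Definition orthonormal_basis (phi : nat -> 'rV[R]_d -> R) :=
  [/\ forall k, L2 (phi k),
      forall j k, inner (phi j) (phi k) = (j == k)%:R
    & forall f, L2 f ->
        L2_cvg (fun n => \sum_(k < n) inner f (phi k) *: phi k) f].

(* The sum of a series of functions, in the sense of L^2(D). *)
Definition L2_series (u_ : nat -> 'rV[R]_d -> R) : 'rV[R]_d -> R :=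
  xget 0 [set v | L2 v /\ L2_cvg (fun n => \sum_(k < n) u_ k) v].

End L2.

Section dirichlet_laplacian.
Context {R : realType} (d : nat) (D : set 'rV[R]_d).
Implicit Types f u v : 'rV[R]_d -> R.

(* A bounded nonempty finite intersection of open half-spaces. *)
Definition convex_polygonal_domain :=
  [/\ D !=set0, bounded_set D &
    exists m (a : 'I_m -> 'rV[R]_d) (b : 'I_m -> R),
      D = [set x | forall i, \sum_j a i ord0 j * x ord0 j < b i]].

Definition partial (i : 'I_d) f : 'rV[R]_d -> R := 'D_(delta_mx ord0 i) f.

Definition laplacian f : 'rV[R]_d -> R := \sum_i partial i (partial i f).

Definition smooth f := forall s : seq 'I_d,
  continuous (foldr partial f s) /\
  forall i x, derivable (foldr partial f s) x (delta_mx ord0 i).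

Definition test_function f :=
  smooth f /\ exists2 K, compact K /\ K `<=` D & forall x, ~ K x -> f x = 0.

(* The Sobolev space H^1_0(D): the closure of the test functions for the norm
   of H^1(D). *)
Definition H10 u := L2 D u /\
  exists u_ : nat -> 'rV[R]_d -> R,
    [/\ forall n, test_function (u_ n), L2_cvg D u_ u &
        forall i, exists2 g, L2 D g & L2_cvg D (fun n => partial i (u_ n)) g].

(* A u = f for A = -Delta with homogeneous Dirichlet boundary conditions, that
   is, with domain the u in H^1_0(D) whose distributional Laplacian is in
   L^2(D). *)
Definition dirichlet_laplacian u f :=
  [/\ H10 u, L2 D f &
      forall v, test_function v -> - inner D u (laplacian v) = inner D f v].

(* lam k and phi k are the (k+1)-st eigenvalue and eigenfunction. *)
Definition dirichlet_eigenbasis (lam : nat -> R) (phi : nat -> 'rV[R]_d -> R) :=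
  [/\ 0 < lam 0%N, nondecreasing_seq lam, orthonormal_basis D phi &
      forall k, dirichlet_laplacian (phi k) (lam k *: phi k)].

End dirichlet_laplacian.

Definition Gamma {R : realType} (a : R) : R :=
  \int[lebesgue_measure]_(x in `]0, +oo[) (x `^ (a - 1) * expR (- x)).

Definition mittag_leffler {R : realType} (a b z : R) : R :=
  limn (series (fun k => z ^+ k / Gamma (a * k%:R + b))).

Section convolution.
Context {R : realType} (d : nat) (D : set 'rV[R]_d).
Context dO (Omega : measurableType dO) (P : probability Omega R).
Variables (lam : nat -> R) (phi : nat -> 'rV[R]_d -> R) (alpha beta p : R).

Definition S0 (t : R) (psi : 'rV[R]_d -> R) : 'rV[R]_d -> R :=
  t `^ (alpha - 1) *: L2_series D (fun k =>
    (mittag_leffler alpha alpha (- (lam k `^ beta * t `^ alpha))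
     * inner D psi (phi k)) *: phi k).

(* The norm and the elements of L^p(Omega, L^2(D)). *)
Definition LpH_norm (X : Omega -> 'rV[R]_d -> R) : \bar R :=
  Lnorm P p%:E (fun w => L2_norm D (X w)).

Definition LpH : set (Omega -> 'rV[R]_d -> R) :=
  [set X | strongly_measurable P (L2 D) (L2_norm D) setT X /\
           (LpH_norm X < +oo)%E].

(* S0 only makes sense at positive times, hence the open interval. *)
Definition S0_convolution (G : R -> Omega -> 'rV[R]_d -> R) (t : R) :
    Omega -> 'rV[R]_d -> R :=
  bochner_integral lebesgue_measure LpH LpH_norm `]0, t[
    (fun u w => S0 (t - u) (G u w)).

End convolution.

(* Main.v *)
Require Import Defs.
From HB Require Import structures.
From mathcomp Require Import all_boot all_order all_algebra.
From mathcomp Require Import all_classical all_reals all_analysis.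
From mathcomp Require Import measurable_realfun ring lra.

Set Implicit Arguments.
Unset Strict Implicit.
Unset Printing Implicit Defensive.

Import Order.TTheory GRing.Theory Num.Theory.
Import numFieldNormedType.Exports.

Local Open Scope classical_set_scope.
Local Open Scope ring_scope.

(** In the basis phi the operator S_0(r) is diagonal, with multipliers
    e_l(r) = r^(alpha-1) E_{alpha,alpha}(-l r^alpha), where l = lam_k^beta.
    The theorem follows from two estimates that are uniform in l > 0:
      |e_l(r)| <= C r^(alpha-1),
      |e_l(r2) - e_l(r1)| <= C (r2-r1)^th r1^(alpha-1-th)  (r1 < r2, 0 <= th <= 1),
    which are [relax_le] and [relax_holder].  Parseval turns them into operator
    bounds on L^2(D), and these hold pointwise in omega, hence on
    L^p(Omega, L^2(D)).  A family of operators with such bounds is called a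
    [singular_kernel]; convolution with one is studied over an arbitrary complete
    seminormed space.

    Regularity of the convolution.  For a constant G(0) the substitution
    u -> t - u makes Phi(t) - Phi(s) the integral of S_0(u) G(0) over ]s,t[, hence
    the term t^alpha - s^alpha.  A general H (either G or G - G(0)) is split as
    (H(u) - H(s)) + H(s), where s is the smaller time.  The constant H(s) is treated
    like G(0).  For X(u) = H(u) - H(s) the hypothesis gives a factor |s-u|^nu that
    compensates the singularity of the kernel at u = s.  On ]0,s[ the increment of
    the kernel, with th = min(alpha+nu-eps, 1), leads to (t-s)^th times the Beta
    type integral of u^(-mu) (s-u)^(alpha+nu-th-1), which converges because mu < 1
    and th < alpha + nu; on ]s,t[ the size of the kernel leads to a multiple of
    s^(-mu) (t-s)^(alpha+nu).  See [convolution_increment_centered] and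
    [convolution_increment_holder].

    Bounds on E = E_{a,a}.  For c > 0 let f be the sequence of coefficients of
    1 / ((1-z)^a + c), the sum of the (-c)^j (1-z)^(-a(j+1)).  When c = x n^(-a),
    n^(1-a) f_n tends to E(-x): termwise because the coefficients of (1-z)^(-b) are
    asymptotic to n^(b-1) / Gamma(b), which comes from Wendel's inequality for Gamma,
    and then by dominated convergence of series.  The nonconstant coefficients of
    (1-z)^a are nonpositive, so f >= 0 by induction, and f is at most the coefficient
    sequence of (1-z)^(-a); in the limit, 0 <= E(-x) <= 1 / Gamma(a)
    ([mittag_leffler_bounded]).  For two parameters c < c' the resolvent identity
    f - f' = (c' - c) f * f' and the bound c (f_0 + ... + f_n) <= 1 give
    |E(-x) - E(-y)| <= C (y-x) / x ([mittag_leffler_log_lipschitz]); this Lipschitz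
    estimate in log x is what makes the bounds on e_l independent of l.

    Integration.  Bochner integrals are constructed for a seminorm N on a set V, with
    the estimate N (integral of f) <= integral of N f; the spaces L^2(D) and
    L^p(Omega, L^2(D)) are complete by one Riesz-Fischer argument, [Lp_complete]. *)

(** * Measure-theoretic preliminaries *)
Lemma measurable_fun_if_mem d d' (T : measurableType d) (T' : measurableType d')
    (A : set T) (f g : T -> T') : measurable A ->
  measurable_fun setT f -> measurable_fun setT g ->
  measurable_fun setT (fun t => if t \in A then f t else g t).
Proof.
move=> mA mf mg; apply: measurable_fun_ifT => //.
apply: (measurable_fun_bool true); rewrite setTI (_ : _ @^-1` _ = A)//.
by apply/seteqP; split => t /=; [move/set_mem|move/mem_set].
Qed.

Section lower_integral.
Context d (T : measurableType d) (R : realType).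
Variable mu : {measure set T -> \bar R}.
Import HBNNSimple.
Local Open Scope ereal_scope.

(** The integral of f is the supremum of the integrals of the simple functions below
    f, and each of these is below g almost everywhere.  The norm of a strongly
    measurable function is only almost everywhere equal to a measurable function;
    this is how it is integrated below. *)
Lemma ae_le_lower_integral (D : set T) (f g : T -> \bar R) :
  measurable D -> measurable_fun D g ->
  (forall x, D x -> 0 <= f x) -> (forall x, D x -> 0 <= g x) ->
  {ae mu, forall x, D x -> f x <= g x} ->
  \int[mu]_(x in D) f x <= \int[mu]_(x in D) g x.
Proof.
move=> mD mg f0 g0 fg; rewrite [leLHS]ge0_integralE//.
apply: ge_ereal_sup => _ [h /= hf <-]; rewrite -integralT_nnsfun.
have -> : \int[mu]_x (h x)%:E = \int[mu]_(x in D) (h x)%:E.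
  rewrite [RHS]integral_mkcond; apply: eq_integral => x _.
  rewrite patchE; case: ifPn => // xD; apply/eqP; rewrite eq_le.
  by have := hf x; rewrite patchE (negbTE xD) => ->; rewrite lee_fin /=.
apply: ae_ge0_le_integral => //.
- by move=> x _; rewrite lee_fin.
- by apply/measurable_EFinP; exact: measurable_funTS.
- apply: filterS fg => x fg Dx; apply: le_trans (fg Dx).
  by have := hf x; rewrite patchE mem_set.
Qed.

(** Off a measurable null set both sides are suprema over the same simple
    functions. *)
Lemma ae_eq_lower_integral (D : set T) (f g : T -> \bar R) :
  measurable D -> measurable_fun D g ->
  (forall x, D x -> 0 <= f x) -> (forall x, D x -> 0 <= g x) ->
  {ae mu, forall x, D x -> f x = g x} ->
  \int[mu]_(x in D) f x = \int[mu]_(x in D) g x.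
Proof.
move=> mD mg f0 g0 fg; apply/eqP; rewrite eq_le; apply/andP; split.
  by apply: ae_le_lower_integral => //; apply: filterS fg => x h /h ->.
have [Z [mZ Z0 fgZ]] := fg.
rewrite (ge0_negligible_integral mZ)//.
rewrite (eq_integral f) => [|x]; last first.
  rewrite inE => -[Dx nZx]; apply/esym; apply: contrapT => fgx; apply: nZx.
  by apply: fgZ => /= /(_ Dx).
have DZ x : (D `\` Z) x -> 0 <= f x by move=> [/f0].
rewrite !ge0_integralE//; apply: le_ereal_sup => _ [h /= hf <-]; exists h => // x.
apply: le_trans (hf x) _; rewrite !patchE in_setD.
by case: ifPn => [/andP[-> _]//|_]; case: ifPn => // /set_mem/f0.
Qed.

End lower_integral.

Section cvge0.
Context {R : realType}.
Local Open Scope ereal_scope.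

Lemma cvge0P (u : nat -> \bar R) : (forall n, 0 <= u n) ->
  (u @ \oo --> 0) <-> (forall e : R, (0 < e)%R -> \forall n \near \oo, u n <= e%:E).
Proof.
move=> u0; split=> [/fine_cvgP[ufin ucvg] e e0|h].
  move/cvgr0Pnorm_le : ucvg => /(_ e e0) ucvg.
  near=> n; have un : u n \is a fin_num by near: n.
  rewrite -(fineK un) lee_fin.
  apply: (le_trans (ler_norm _)); by near: n.
apply/fine_cvgP; split.
  have := h _ (@ltr01 R); apply: filterS => n un.
  by rewrite ge0_fin_numE// (le_lt_trans un)// ltry.
apply/cvgr0Pnorm_le => e e0; have := h _ e0; apply: filterS => n un /=.
have fn : u n \is a fin_num by rewrite ge0_fin_numE// (le_lt_trans un)// ltry.
by rewrite ger0_norm ?fine_ge0// -lee_fin fineK.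
Unshelve. all: by end_near. Qed.

Lemma cvge0_le (u v : nat -> \bar R) : (forall n, 0 <= u n) ->
  (forall n, u n <= v n) -> v @ \oo --> 0 -> u @ \oo --> 0.
Proof.
move=> u0 uv v0; apply: (@squeeze_cvge _ _ _ _ (cst 0) u v) => //.
- by apply: nearW => n; rewrite u0 uv.
- exact: cvg_cst.
Qed.

End cvge0.

(** * Seminormed spaces and step functions *)

(** A seminormed space is a set V of an ambient module, outside which N may be
    infinite.  Vectors at distance 0 are not identified, so that identities between
    vectors take the form N (x - y) = 0. *)
Record seminormed (R : realType) (E : lmodType R) (V : set E) (N : E -> \bar R)
  : Prop := Seminormed {
  sn0 : V 0 ;
  snD : forall x y, V x -> V y -> V (x + y) ;
  snZ : forall a x, V x -> V (a *: x) ;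
  snN_ge0 : forall x, (0 <= N x)%E ;
  snN_lty : forall x, V x -> (N x < +oo)%E ;
  snN_D : forall x y, V x -> V y -> (N (x + y)%R <= N x + N y)%E ;
  snN_Z : forall a x, V x -> (N (a *: x)%R = `|a|%:E * N x)%E }.

Definition seminorm_complete (R : realType) (E : lmodType R) (V : set E)
    (N : E -> \bar R) :=
  forall u : nat -> E, (forall n, V (u n)) ->
    (forall e : R, 0 < e -> exists n0, forall m n, (n0 <= m)%N -> (n0 <= n)%N ->
      (N (u m - u n)%R <= e%:E)%E) ->
    exists2 v, V v & N (v - u n)%R @[n --> \oo] --> 0%E.

Section seminormed_theory.
Context {R : realType} {E : lmodType R} {V : set E} {N : E -> \bar R}.
Hypothesis SN : seminormed V N.

Lemma snN0 : N 0 = 0%E.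
Proof. by rewrite -(scale0r 0) (snN_Z SN 0 (sn0 SN)) normr0 mul0e. Qed.

Lemma snV x : V x -> V (- x).
Proof. by rewrite -scaleN1r; exact: snZ SN (-1) x. Qed.

Lemma snB x y : V x -> V y -> V (x - y).
Proof. by move=> Vx /snV; exact: (snD SN). Qed.

Lemma snN_N x : V x -> N (- x)%R = N x.
Proof. by move=> Vx; rewrite -scaleN1r (snN_Z SN)// normrN1 mul1e. Qed.

Lemma snN_fin x : V x -> N x \is a fin_num.
Proof. by move=> Vx; rewrite ge0_fin_numE ?(snN_ge0 SN)// (snN_lty SN). Qed.

Lemma snN_B x y : V x -> V y -> (N (x - y)%R <= N x + N y)%E.
Proof. by move=> Vx Vy; rewrite -(snN_N Vy); apply: (snN_D SN) => //; exact: snV. Qed.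

Lemma snN_subC x y : V x -> V y -> N (x - y)%R = N (y - x)%R.
Proof. by move=> Vx Vy; rewrite -opprB snN_N//; exact: snB. Qed.

Lemma snN_tri x y z : V x -> V y -> V z -> (N (x - z)%R <= N (x - y)%R + N (y - z)%R)%E.
Proof.
move=> Vx Vy Vz; rewrite -(subrKA y x).
by apply: (snN_D SN); exact: snB.
Qed.

Lemma snN_le x y : V x -> V y -> (N x <= N y + N (x - y)%R)%E.
Proof.
move=> Vx Vy; rewrite -{1}(subrK y x) addeC.
by apply: (snN_D SN) => //; exact: snB.
Qed.

Lemma sn_sum I (r : seq I) (P : pred I) (F : I -> E) :
  (forall i, P i -> V (F i)) -> V (\sum_(i <- r | P i) F i).
Proof. by move=> VF; apply: big_ind => //; [exact: (sn0 SN)|exact: (snD SN)]. Qed.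

End seminormed_theory.

Section steps.
Context d (T : measurableType d) (R : realType) (E : lmodType R).
Implicit Types s : step T E.

Definition step_add s1 s2 : step T E :=
  @Step _ T R E (step_size s1 + step_size s2)
    (fun i => match fintype.split i with inl j => step_set j | inr j => step_set j end)
    (fun i => match fintype.split i with inl j => step_val j | inr j => step_val j end).

Definition step_restr (A : set T) s : step T E :=
  @Step _ T R E (step_size s) (fun i => step_set i `&` A) (@step_val _ _ _ _ s).

Definition step_map (L : E -> E) s : step T E :=
  @Step _ T R E (step_size s) (@step_set _ _ _ _ s) (fun i => L (step_val i)).

Definition step0 : step T E :=
  @Step _ T R E 0 (fun=> set0) (fun=> 0).

Definition step_cst (A : set T) (x : E) : step T E :=
  @Step _ T R E 1 (fun=> A) (fun=> x).

Definition step_preimage d' (T' : measurableType d') (g : T' -> T) s : step T' E :=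
  @Step _ T' R E (step_size s) (fun i => g @^-1` step_set i) (@step_val _ _ _ _ s).

Lemma step_fun_add s1 s2 t :
  step_fun (step_add s1 s2) t = step_fun s1 t + step_fun s2 t.
Proof.
rewrite /step_fun big_split_ord/=; congr (_ + _); apply: eq_bigr => i _.
  by rewrite (unsplitK (inl i)).
by rewrite (unsplitK (inr i)).
Qed.

Lemma step_fun_restr A s t :
  step_fun (step_restr A s) t = (\1_A t : R) *: step_fun s t.
Proof.
rewrite /step_fun scaler_sumr; apply: eq_bigr => i _ /=.
by rewrite indicI scalerA mulrC.
Qed.

Lemma step_fun0 t : step_fun step0 t = 0.
Proof. by rewrite /step_fun big_ord0. Qed.

Lemma step_fun_cst A x t : step_fun (step_cst A x) t = (\1_A t : R) *: x.
Proof. by rewrite /step_fun big_ord1. Qed.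

Lemma simple_step_add (V : set E) s1 s2 :
  simple_step V s1 -> simple_step V s2 -> simple_step V (step_add s1 s2).
Proof. by move=> h1 h2 i /=; case: fintype.split => j; [exact: h1|exact: h2]. Qed.

Lemma simple_step_restr (V : set E) A s :
  measurable A -> simple_step V s -> simple_step V (step_restr A s).
Proof. by move=> mA h i /=; have [mi Vi] := h i; split => //; exact: measurableI. Qed.

Lemma simple_step_map (V : set E) L s :
  (forall x, V x -> V (L x)) -> simple_step V s -> simple_step V (step_map L s).
Proof. by move=> VL h i /=; have [mi Vi] := h i; split => //; exact: VL. Qed.

Lemma simple_step_preimage (V : set E) d' (T' : measurableType d') (g : T' -> T) s :
  measurable_fun setT g -> simple_step V s -> simple_step V (step_preimage g s).
Proof.
move=> mg h i /=; have [mi Vi] := h i; split => //.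
by rewrite -[X in measurable X]setTI; exact: mg.
Qed.

(** The value is constant on each atom generated by the sets of s.  The induction
    peels off one set and translates phi by its vector, hence the arbitrary phi. *)
Lemma measurable_step_fun (phi : E -> \bar R) s :
  (forall i : 'I_(step_size s), measurable (step_set i)) ->
  measurable_fun setT (fun t => phi (step_fun s t)).
Proof.
case: s => n A x; rewrite /step_fun /= => mA.
elim: n => [|n IH] in A x phi mA *.
  rewrite (_ : (fun _ => _) = cst (phi 0)); first exact: measurable_cst.
  by apply/funext => t; rewrite big_ord0.
pose S t := \sum_(i < n) (\1_(A (lift ord0 i)) t : R) *: x (lift ord0 i).
rewrite (_ : (fun _ => _) = (fun t => if t \in A ord0 then phi (x ord0 + S t)
    else phi (S t))).
  apply: measurable_fun_if_mem => //.
  - by apply: (IH (fun i => A (lift ord0 i)) (fun i => x (lift ord0 i))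
      (fun y => phi (x ord0 + y))) => i; exact: mA.
  - by apply: (IH (fun i => A (lift ord0 i)) (fun i => x (lift ord0 i)) phi) => i; exact: mA.
apply/funext => t; rewrite big_ord_recl indicE.
by case: (t \in A ord0); rewrite ?scale1r// scale0r add0r.
Qed.

Variables (mu : {measure set T -> \bar R}).

Lemma step_integral_add D s1 s2 :
  step_integral mu D (step_add s1 s2) = step_integral mu D s1 + step_integral mu D s2.
Proof.
rewrite /step_integral big_split_ord/=; congr (_ + _); apply: eq_bigr => i _.
  by rewrite (unsplitK (inl i)).
by rewrite (unsplitK (inr i)).
Qed.

Lemma step_fun_scale a s t : step_fun (step_map ( *:%R a) s) t = a *: step_fun s t.
Proof.
by rewrite /step_fun scaler_sumr; apply: eq_bigr => i _; rewrite !scalerA mulrC.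
Qed.

Lemma step_integral_scale D a s :
  step_integral mu D (step_map ( *:%R a) s) = a *: step_integral mu D s.
Proof.
by rewrite /step_integral scaler_sumr; apply: eq_bigr => i _; rewrite !scalerA mulrC.
Qed.

Context {V : set E} {N : E -> \bar R}.
Hypothesis SN : seminormed V N.

Lemma step_fun_in s t : simple_step V s -> V (step_fun s t).
Proof.
by move=> h; apply: (sn_sum SN) => i _; apply: (snZ SN); have [] := h i.
Qed.

Lemma step_integral_in D s : simple_step V s -> V (step_integral mu D s).
Proof.
by move=> h; apply: (sn_sum SN) => i _; apply: (snZ SN); have [] := h i.
Qed.

(** The sets A i may overlap.  Cutting B along the first of them replaces the
    constant vector y by y + x ord0 on the inner part and leaves it unchanged on the
    outer one; this is why y and B are part of the induction. *)
Lemma le_step_integral_aux n (A : 'I_n -> set T) (x : 'I_n -> E) (y : E) (B : set T) :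
  measurable B -> (mu B < +oo)%E -> (forall i, measurable (A i)) ->
  (forall i, V (x i)) -> V y ->
  (N (fine (mu B) *: y + \sum_(i < n) fine (mu (A i `&` B)) *: x i)%R <=
   \int[mu]_(t in B) N (y + \sum_(i < n) (\1_(A i) t : R) *: x i)%R)%E.
Proof.
move=> mB Boo mA Vx Vy; elim: n => [|n IH] in A x y B mB Boo mA Vx Vy *.
  rewrite big_ord0 addr0 (snN_Z SN)//.
  under eq_integral do rewrite big_ord0 addr0.
  rewrite integral_cst// muleC ger0_norm ?fine_ge0// fineK//.
  by rewrite ge0_fin_numE.
set B1 := A ord0 `&` B; set B2 := B `\` A ord0.
have mB1 : measurable B1 by exact: measurableI.
have mB2 : measurable B2 by exact: measurableD.
have B1oo : (mu B1 < +oo)%E.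
  by apply: le_lt_trans Boo; apply: le_measure; rewrite ?inE//; exact: subIsetr.
have B2oo : (mu B2 < +oo)%E.
  by apply: le_lt_trans Boo; apply: le_measure; rewrite ?inE//; exact: subDsetl.
have BE : B = B1 `|` B2.
  by rewrite /B1 /B2 setIC setUIDK.
have dB : [disjoint B1 & B2].
  by apply/disj_setPS => t [[At _] [_ nAt]].
pose A' i := A (lift ord0 i); pose x' i := x (lift ord0 i).
have fineU (C : set T) : measurable C ->
    fine (mu (C `&` B)) = fine (mu (C `&` B1)) + fine (mu (C `&` B2)).
  move=> mC; have -> : C `&` B = (C `&` B1) `|` (C `&` B2) by rewrite -setIUr -BE.
  rewrite measureU//; last 3 first.
  - exact: measurableI.
  - exact: measurableI.
  - by apply/seteqP; split => // t [[_ [At _]] [_ [_ nAt]]].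
  have lefin (X Y : set T) : measurable X -> measurable Y -> (mu Y < +oo)%E ->
      mu (X `&` Y) \is a fin_num.
    move=> mX mY Yoo; rewrite ge0_fin_numE//; apply: le_lt_trans Yoo.
    by apply: le_measure; rewrite ?inE//; exact: measurableI.
  by rewrite fineD//; exact: lefin.
have mS y' : measurable_fun setT (fun t : T => N (y' + \sum_(i < n) (\1_(A' i) t : R) *: x' i)%R).
  by apply: (@measurable_step_fun (fun z => N (y' + z)%R) (@Step _ T R E n A' x')) => i; exact: mA.
have SE t : \sum_(i < n.+1) (\1_(A i) t : R) *: x i =
    (\1_(A ord0) t : R) *: x ord0 + \sum_(i < n) (\1_(A' i) t : R) *: x' i.
  by rewrite big_ord_recl.
rewrite [X in (_ <= \int[mu]_(t in X) _)%E]BE ge0_integral_setU//; last 2 first.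
- rewrite -BE; apply: measurable_funTS.
  exact: (@measurable_step_fun (fun z => N (y + z)%R) (@Step _ T R E n.+1 A x)).
- by move=> t _; exact: (snN_ge0 SN).
rewrite (@eq_integral _ _ _ mu B1 (fun t =>
    N ((y + x ord0) + \sum_(i < n) (\1_(A' i) t : R) *: x' i)%R)); last first.
  move=> t; rewrite inE => -[At Bt]; rewrite SE addrA indicE mem_set// scale1r//.
rewrite (@eq_integral _ _ _ mu B2 (fun t =>
    N (y + \sum_(i < n) (\1_(A' i) t : R) *: x' i)%R)); last first.
  by move=> t; rewrite inE => -[Bt nAt]; rewrite SE indicE memNset// scale0r add0r.
have V1 : V (y + x ord0) by apply: (snD SN).
have h1 := IH A' x' _ _ mB1 B1oo (fun i => mA _) (fun i => Vx _) V1.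
have h2 := IH A' x' _ _ mB2 B2oo (fun i => mA _) (fun i => Vx _) Vy.
apply: le_trans (leeD h1 h2).
rewrite [X in N X](_ : _ = (fine (mu B1) *: (y + x ord0) +
    \sum_(i < n) fine (mu (A' i `&` B1)) *: x' i) +
   (fine (mu B2) *: y + \sum_(i < n) fine (mu (A' i `&` B2)) *: x' i)).
  have VS C : V (\sum_(i < n) fine (mu (A' i `&` C)) *: x' i).
    by apply: (sn_sum SN) => i _; apply: (snZ SN); exact: Vx.
  by apply: (snN_D SN); apply: (snD SN) => //; apply: (snZ SN).
have hS : \sum_(i < n) fine (mu (A (lift ord0 i) `&` B)) *: x (lift ord0 i) =
    \sum_(i < n) fine (mu (A' i `&` B1)) *: x' i +
    \sum_(i < n) fine (mu (A' i `&` B2)) *: x' i.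
  by rewrite -big_split; apply: eq_bigr => i _; rewrite /= -scalerDl -fineU//; exact: mA.
have -> : fine (mu B) = fine (mu B1) + fine (mu B2).
  by have := fineU setT measurableT; rewrite !setTI.
rewrite big_ord_recl hS scalerDr scalerDl -!addrA; congr (_ + _).
by rewrite -/B1 [LHS]addrCA [X in _ + X = _]addrCA.
Qed.

Lemma le_step_integral D s : measurable D -> (mu D < +oo)%E -> simple_step V s ->
  (N (step_integral mu D s)%R <= \int[mu]_(t in D) N (step_fun s t)%R)%E.
Proof.
move=> mD Doo; case: s => n A x h.
have := @le_step_integral_aux n A x 0 D mD Doo (fun i => (h i).1) (fun i => (h i).2) (sn0 SN).
rewrite scaler0 add0r => /le_trans; apply.
by under eq_integral do rewrite add0r.
Qed.

End steps.

(** * Strong measurability and the Bochner integral *)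
Section bochner_theory.
Context d (T : measurableType d) (R : realType) (E : lmodType R).
Variable mu : {measure set T -> \bar R}.
Context {V : set E} {N : E -> \bar R}.
Hypothesis SN : seminormed V N.

Lemma cvg_snN (x : E) (y : nat -> E) : V x -> (forall n, V (y n)) ->
  N (x - y n)%R @[n --> \oo] --> 0%E -> N (y n)%R @[n --> \oo] --> N x.
Proof.
move=> Vx Vy xy0.
apply: (@squeeze_cvge _ _ _ _ (fun n => N x - N (x - y n)%R)%E _
   (fun n => N x + N (x - y n)%R)%E).
- apply: nearW => n; apply/andP; split.
    rewrite leeBlDr ?(snN_fin SN)//; last exact: (snB SN).
    exact: (snN_le SN).
  by rewrite (snN_subC SN)//; exact: (snN_le SN).
- rewrite -[X in _ --> X]sube0; apply: cvgeB => //; last exact: cvg_cst.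
  by rewrite oppe0 fin_num_adde_defl.
- rewrite -[X in _ --> X]adde0; apply: cvgeD => //; last exact: cvg_cst.
  by rewrite fin_num_adde_defl.
Qed.

Lemma snN_eq0_eq x y : V x -> V y -> N (x - y)%R = 0%E -> N x = N y.
Proof.
move=> Vx Vy xy0; apply/eqP; rewrite eq_le; apply/andP; split.
  by apply: (le_trans (snN_le SN Vx Vy)); rewrite xy0 adde0.
by apply: (le_trans (snN_le SN Vy Vx)); rewrite (snN_subC SN)// xy0 adde0.
Qed.

Section strong_measurability.
Variable D : set T.
Implicit Types f g : T -> E.
Local Notation SM := (strongly_measurable mu V N D).

Lemma strongly_measurableD f g : SM f -> SM g -> SM (fun t => f t + g t).
Proof.
move=> [Vf [s [Vs sf]]] [Vg [r [Vr rg]]]; split => [t Dt|].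
  by apply: (snD SN); [exact: Vf|exact: Vg].
exists (fun n => step_add (s n) (r n)); split => [n|].
  exact: simple_step_add.
apply: filterS2 sf rg => t sf rg Dt.
apply: (@cvge0_le _ _ (fun n => N (f t - step_fun (s n) t)%R +
    N (g t - step_fun (r n) t)%R)%E) => [n|n|].
- exact: (snN_ge0 SN).
- rewrite step_fun_add opprD addrACA; apply: (snN_D SN); apply: (snB SN);
    by [exact: Vf|exact: Vg|exact: (step_fun_in SN)].
- by rewrite -[X in _ --> X]adde0; apply: cvgeD => //; [exact: sf|exact: rg].
Qed.

Lemma strongly_measurableZ a f : SM f -> SM (fun t => a *: f t).
Proof.
move=> [Vf [s [Vs sf]]]; split => [t Dt|].
  by apply: (snZ SN); exact: Vf.
exists (fun n => step_map ( *:%R a) (s n)); split => [n|].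
  by apply: simple_step_map => // x; exact: (snZ SN).
apply: filterS sf => t sf Dt.
rewrite (_ : (fun n => _) = (fun n => `|a|%:E * N (f t - step_fun (s n) t)%R)%E).
  by rewrite -[X in _ --> X](mule0 `|a|%:E); apply: cvgeZl => //; exact: sf.
apply/funext => n; rewrite step_fun_scale -scalerBr (snN_Z SN)//.
by apply: (snB SN); [exact: Vf|exact: (step_fun_in SN)].
Qed.

Lemma strongly_measurableB f g : SM f -> SM g -> SM (fun t => f t - g t).
Proof.
move=> SMf SMg; have := strongly_measurableD SMf (strongly_measurableZ (-1) SMg).
by congr SM; apply/funext => t; rewrite scaleN1r.
Qed.

Lemma strongly_measurable_step s : simple_step V s -> SM (step_fun s).
Proof.
move=> Vs; split => [t _|]; first exact: (step_fun_in SN).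
exists (fun=> s); split => //; apply: aeW => t _.
rewrite (_ : (fun _ => _) = cst 0%E); first exact: cvg_cst.
by apply/funext => n; rewrite subrr (snN0 SN).
Qed.

Lemma strongly_measurable_cst x : V x -> SM (fun=> x).
Proof.
move=> Vx.
have -> : (fun=> x) = step_fun (@step_cst _ T R E setT x).
  by apply/funext => t; rewrite step_fun_cst indicT scale1r.
by apply: strongly_measurable_step => i; split => //=; exact: measurableT.
Qed.

Lemma strongly_measurable_congr f g : SM f -> (forall t, D t -> V (g t)) ->
  (forall t, D t -> N (f t - g t)%R = 0%E) -> SM g.
Proof.
move=> [Vf [s [Vs sf]]] Vg fg; split => //; exists s; split => //.
apply: filterS sf => t sf Dt; move: (sf Dt); apply: cvg_trans.
rewrite (_ : (fun n => N (f t - _)%R) = (fun n => N (g t - step_fun (s n) t)%R))//.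
apply/funext => n; apply: snN_eq0_eq.
- by apply: (snB SN); [exact: Vf|exact: (step_fun_in SN)].
- by apply: (snB SN); [exact: Vg|exact: (step_fun_in SN)].
- by rewrite opprB addrA subrK fg.
Qed.

(** The limit superior of the norms of the approximating step functions is
    measurable, and it is the norm wherever they converge. *)
Lemma strongly_measurable_norm f : SM f ->
  exists h : T -> \bar R, [/\ measurable_fun setT h, (forall t, 0 <= h t)%E &
    {ae mu, forall t, D t -> N (f t)%R = h t}].
Proof.
move=> [Vf [s [Vs sf]]].
exists (fun t => limn_esup (fun n => N (step_fun (s n) t)%R)); split.
- apply: measurable_fun_limn_esup => n.
  by apply: measurable_step_fun => i; have [] := Vs n i.
- move=> t; apply: limf_esup_ge0 => [|n]; last exact: (snN_ge0 SN).
  exact: filter_not_empty.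
- apply: filterS sf => t sf Dt; apply/esym.
  have := @cvg_snN (f t) (fun n => step_fun (s n) t) (Vf t Dt)
    (fun n => step_fun_in SN t (Vs n)) (sf Dt).
  by move/cvg_limn_einf_sup => [].
Qed.

Lemma strongly_measurable_step_norm f s : SM f -> simple_step V s ->
  exists h : T -> \bar R, [/\ measurable_fun setT h, (forall t, 0 <= h t)%E &
    {ae mu, forall t, D t -> N (f t - step_fun s t)%R = h t}].
Proof.
move=> SMf Vs; apply: strongly_measurable_norm.
by apply: strongly_measurableB => //; exact: strongly_measurable_step.
Qed.

End strong_measurability.

Lemma strongly_measurable_subset D D' f : D' `<=` D ->
  strongly_measurable mu V N D f -> strongly_measurable mu V N D' f.
Proof.
move=> D'D [Vf [s [Vs sf]]]; split => [t /D'D|]; first exact: Vf.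
by exists s; split => //; apply: filterS sf => t + /D'D.
Qed.

Section bochner.
Variable D : set T.
Hypotheses (mD : measurable D) (Doo : (mu D < +oo)%E).
Implicit Types f g : T -> E.
Local Notation SM := (strongly_measurable mu V N D).
Local Notation IB := (is_bochner_integral mu V N D).

Let finD (A : set T) : measurable A -> (mu (A `&` D) < +oo)%E.
Proof.
move=> mA; apply: le_lt_trans Doo; apply: le_measure; rewrite ?inE//.
exact: measurableI.
Qed.

Lemma ae_le_bochner_step f s (h : T -> \bar R) : simple_step V s ->
  measurable_fun setT h -> (forall t, 0 <= h t)%E ->
  {ae mu, forall t, D t -> (N (step_fun s t)%R <= h t)%E} ->
  (N (step_integral mu D s)%R <= \int[mu]_(t in D) h t)%E.
Proof.
move=> Vs mh h0 sh; apply: le_trans (le_step_integral SN mD Doo Vs) _.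
apply: ae_le_lower_integral => //; first exact: measurable_funTS.
by move=> t _; exact: (snN_ge0 SN).
Qed.

(** The approximating step functions are cut off where their norm exceeds g + 1.
    Their distance to f is then dominated by g + (g + 1), so its integral tends to 0,
    and the integrals of the step functions form a Cauchy sequence. *)
Lemma bochner_exists f (g : T -> \bar R) : seminorm_complete V N -> SM f ->
  measurable_fun setT g -> (forall t, 0 <= g t)%E ->
  (\int[mu]_(t in D) g t < +oo)%E ->
  {ae mu, forall t, D t -> (N (f t)%R <= g t)%E} -> exists v, IB f v.
Proof.
move=> VC SMf mg g0 goo fg; have [Vf [s [Vs sf]]] := SMf.
pose A n := [set t | (N (step_fun (s n) t)%R <= g t + 1)%E].
have mg1 : measurable_fun setT (fun t => g t + 1)%E.
  by apply: emeasurable_funD => //; exact: measurable_cst.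
have mA n : measurable (A n).
  rewrite -[A n]setTI; apply: measurable_lee => //.
  by apply: measurable_step_fun => i; have [] := Vs n i.
pose r n := step_restr (A n) (s n).
have Vr n : simple_step V (r n) by exact: simple_step_restr.
have rle n t : (N (step_fun (r n) t)%R <= g t + 1)%E.
  rewrite step_fun_restr indicE; have [|_] := boolP (t \in A n).
    by rewrite inE scale1r.
  by rewrite scale0r (snN0 SN) adde_ge0.
have rf : {ae mu, forall t, D t -> N (f t - step_fun (r n) t)%R @[n --> \oo] --> 0%E}.
  apply: filterS2 sf fg => t sf fg Dt; move: (sf Dt).
  have nn n : (0 <= N (f t - step_fun (s n) t)%R)%E by exact: (snN_ge0 SN).
  move=> /(cvge0P nn) sf0.
  apply/cvge0P => [n|e e0]; first exact: (snN_ge0 SN).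
  have s1 := sf0 _ (@ltr01 R).
  apply: filterS2 s1 (sf0 _ e0) => n s1 se.
  rewrite step_fun_restr indicE mem_set ?scale1r//=.
  have Vst := step_fun_in SN t (Vs n).
  apply: le_trans (snN_le SN Vst (Vf _ Dt)) _.
  apply: leeD; first exact: fg.
  by rewrite (snN_subC SN)//; exact: Vf.
have /choice[h hP] := fun n => strongly_measurable_step_norm SMf (Vr n).
have hae : {ae mu, forall t n, D t -> N (f t - step_fun (r n) t)%R = h n t}.
  by apply: ae_foralln => n; have [] := hP n.
have int_h : (\int[mu]_(t in D) h n t)%E @[n --> \oo] --> 0%E.
  have mh n : measurable_fun D (h n).
    by have [mh _ _] := hP n; exact: measurable_funTS.
  have hcvg : {ae mu, forall t, D t -> h^~ t @ \oo --> cst 0%E t}.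
    apply: filterS2 rf hae => t rf hae Dt; move: (rf Dt).
    by under eq_fun do rewrite hae//.
  have hint : mu.-integrable D (fun t => g t + (g t + 1))%E.
    apply/integrableP; split.
      by apply: measurable_funTS; apply: emeasurable_funD.
    under eq_integral do rewrite gee0_abs ?adde_ge0//.
    rewrite ge0_integralD//; last 3 first.
    - exact: measurable_funTS.
    - by move=> t _; rewrite adde_ge0.
    - exact: measurable_funTS.
    rewrite ge0_integralD//; last 1 first.
    - exact: measurable_funTS.
    by rewrite lte_add_pinfty// lte_add_pinfty// integral_cst// mul1e.
  have hdom : {ae mu, forall t n, D t -> (`|h n t| <= g t + (g t + 1))%E}.
    apply: filterS2 hae fg => t hae fg n Dt.
    have [_ h0 _] := hP n; rewrite gee0_abs// -hae//.
    have Vrt := step_fun_in SN t (Vr n).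
    apply: le_trans (snN_B SN (Vf _ Dt) Vrt) _.
    by apply: leeD => //; exact: fg.
  have [_ _] := dominated_convergence mD mh (measurable_cst _) hcvg hint hdom.
  by rewrite integral0.
have intE n : (\int[mu]_(t in D) N (f t - step_fun (r n) t)%R =
    \int[mu]_(t in D) h n t)%E.
  have [mh h0 hn] := hP n.
  apply: ae_eq_lower_integral => //; first exact: measurable_funTS.
  by move=> t _; exact: (snN_ge0 SN).
have hint0 n : (0 <= \int[mu]_(t in D) h n t)%E.
  by apply: integral_ge0 => t _; have [] := hP n.
have [|e e0|v Vv vP] := VC (fun n => step_integral mu D (r n)).
- by move=> n; exact: (step_integral_in mu SN).
- move/(cvge0P hint0) : int_h => /(_ (e / 2)); rewrite divr_gt0// => /(_ isT).
  move=> [n0 _ hn0]; exists n0 => m n n0m n0n.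
  have Vmn : simple_step V (step_add (r m) (step_map ( *:%R (-1)) (r n))).
    apply: simple_step_add => //; apply: simple_step_map => // x.
    exact: (snZ SN).
  have := @ae_le_bochner_step f _ (fun t => h m t + h n t)%E Vmn.
  rewrite step_integral_add step_integral_scale scaleN1r => le_h.
  apply: (le_trans (le_h _ _ _)).
  + have [mhm _ _] := hP m; have [mhn _ _] := hP n.
    exact: emeasurable_funD.
  + by move=> t; have [_ hm _] := hP m; have [_ hn _] := hP n; rewrite adde_ge0.
  + apply: filterS hae => t hae Dt.
    rewrite step_fun_add step_fun_scale scaleN1r -!hae//.
    have Vrm := step_fun_in SN t (Vr m); have Vrn := step_fun_in SN t (Vr n).
    rewrite [X in (_ <= X + _)%E](snN_subC SN)//; last exact: Vf.
    by apply: (snN_tri SN) => //; exact: Vf.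
  + rewrite ge0_integralD//; last 4 first.
    - by move=> t _; have [] := hP m.
    - by have [mh _ _] := hP m; exact: measurable_funTS.
    - by move=> t _; have [] := hP n.
    - by have [mh _ _] := hP n; exact: measurable_funTS.
    rewrite (splitr e) EFinD; apply: leeD; exact: hn0.
- exists v; split => //; exists r; split => //.
  + by move=> n i; apply: finD; have [] := Vr n i.
  + by under eq_fun do rewrite intE.
Qed.

(** The estimate holds for step functions up to the integral of N (f - s n), which
    vanishes in the limit. *)
Lemma bochner_le f v (g : T -> \bar R) : IB f v ->
  measurable_fun setT g -> (forall t, 0 <= g t)%E ->
  {ae mu, forall t, D t -> (N (f t)%R <= g t)%E} ->
  (N v <= \int[mu]_(t in D) g t)%E.
Proof.
move=> [SMf Vv [s [Vs soo sf sv]]] mg g0 fg; have [Vf _] := SMf.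
have /choice[h hP] := fun n => strongly_measurable_step_norm SMf (Vs n).
have intE n : (\int[mu]_(t in D) N (f t - step_fun (s n) t)%R =
    \int[mu]_(t in D) h n t)%E.
  have [mh h0 hn] := hP n.
  apply: ae_eq_lower_integral => //; first exact: measurable_funTS.
  by move=> t _; exact: (snN_ge0 SN).
have le_n n : (N v <= (\int[mu]_(t in D) g t + \int[mu]_(t in D) N (f t - step_fun (s n) t)%R)
    + N (v - step_integral mu D (s n))%R)%E.
  have Vsi := step_integral_in mu SN D (Vs n).
  apply: (le_trans (snN_le SN Vv Vsi)); rewrite leeD2r//.
  have [mh h0 hn] := hP n.
  rewrite intE -ge0_integralD//; try exact: measurable_funTS.
  apply: (ae_le_bochner_step f (Vs n)).
  - exact: emeasurable_funD.
  - by move=> t; rewrite adde_ge0.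
  - apply: filterS2 hn fg => t hn fg Dt; rewrite -hn//.
    have Vst := step_fun_in SN t (Vs n).
    apply: (le_trans (snN_le SN Vst (Vf _ Dt))).
    by rewrite [X in (_ + X)%E](snN_subC SN) ?leeD2r//; [exact: fg|exact: Vf].
have : (\int[mu]_(t in D) g t + \int[mu]_(t in D) N (f t - step_fun (s n) t)%R
    + N (v - step_integral mu D (s n))%R)%E @[n --> \oo] --> (\int[mu]_(t in D) g t + 0 + 0)%E.
  have int0 : (0 <= \int[mu]_(t in D) g t)%E by exact: integral_ge0.
  apply: cvgeD => //; last first.
    apply: cvgeD => //; last exact: cvg_cst.
    by rewrite fin_num_adde_defl.
  by rewrite fin_num_adde_defl.
rewrite !adde0 => cv; rewrite -(cvg_lim _ cv)//.
by apply: lime_ge; [apply/cvg_ex; eexists; exact: cv|exact: nearW].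
Qed.

End bochner.
End bochner_theory.

Section bochner_operations.
Context d (T : measurableType d) (R : realType) (E : lmodType R).
Variable mu : {measure set T -> \bar R}.
Context {V : set E} {N : E -> \bar R}.
Hypothesis SN : seminormed V N.
Implicit Types (D : set T) (f g : T -> E).

Lemma bochner_integralP D f : (exists v, is_bochner_integral mu V N D f v) ->
  is_bochner_integral mu V N D f (bochner_integral mu V N D f).
Proof. by move=> ?; exact: xgetPex. Qed.

Lemma is_bochner_integralD D f g v w : measurable D ->
  is_bochner_integral mu V N D f v -> is_bochner_integral mu V N D g w ->
  is_bochner_integral mu V N D (fun t => f t + g t) (v + w).
Proof.
move=> mD [SMf Vv [s [Vs soo sf sv]]] [SMg Vw [r [Vr roo rg rw]]].
have [[Vf _] [Vg _]] := (SMf, SMg).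
split; [exact: strongly_measurableD|exact: (snD SN)|].
exists (fun n => step_add (s n) (r n)); split.
- by move=> n; exact: simple_step_add.
- by move=> n i /=; case: fintype.split.
- apply: (@cvge0_le _ _ (fun n => \int[mu]_(t in D) N (f t - step_fun (s n) t)%R +
     \int[mu]_(t in D) N (g t - step_fun (r n) t)%R)%E) => [n|n|].
  + by apply: integral_ge0 => t _; exact: (snN_ge0 SN).
  + have [h [mh h0 hf]] := strongly_measurable_step_norm SN SMf (Vs n).
    have [k [mk k0 kg]] := strongly_measurable_step_norm SN SMg (Vr n).
    rewrite (ae_eq_lower_integral mD (measurable_funTS mh) _ _ hf)//; last first.
      by move=> t _; exact: (snN_ge0 SN).
    rewrite (ae_eq_lower_integral mD (measurable_funTS mk) _ _ kg)//; last first.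
      by move=> t _; exact: (snN_ge0 SN).
    rewrite -ge0_integralD//; try exact: measurable_funTS.
    apply: ae_le_lower_integral => //.
    * by apply: measurable_funTS; exact: emeasurable_funD.
    * by move=> t _; exact: (snN_ge0 SN).
    * by move=> t _; rewrite adde_ge0.
    apply: filterS2 hf kg => t hf kg Dt; rewrite -hf// -kg// step_fun_add.
    rewrite opprD addrACA; apply: (snN_D SN); apply: (snB SN);
      by [exact: Vf|exact: Vg|exact: (step_fun_in SN)].
  + by rewrite -[X in _ --> X]adde0; apply: cvgeD.
- apply: (@cvge0_le _ _ (fun n => N (v - step_integral mu D (s n))%R +
     N (w - step_integral mu D (r n))%R)%E) => [n|n|].
  + exact: (snN_ge0 SN).
  + rewrite step_integral_add opprD addrACA; apply: (snN_D SN); apply: (snB SN) => //;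
      exact: (step_integral_in mu SN).
  + by rewrite -[X in _ --> X]adde0; apply: cvgeD.
Qed.

Lemma is_bochner_integralZ D f v a : measurable D ->
  is_bochner_integral mu V N D f v ->
  is_bochner_integral mu V N D (fun t => a *: f t) (a *: v).
Proof.
move=> mD [SMf Vv [s [Vs soo sf sv]]]; have [Vf _] := SMf.
split; [exact: strongly_measurableZ|exact: (snZ SN)|].
exists (fun n => step_map ( *:%R a) (s n)); split => //.
- by move=> n; apply: simple_step_map => // x; exact: (snZ SN).
- apply: (@cvge0_le _ _ (fun n => `|a|%:E *
     \int[mu]_(t in D) N (f t - step_fun (s n) t)%R)%E) => [n|n|].
  + by apply: integral_ge0 => t _; exact: (snN_ge0 SN).
  + have [h [mh h0 hf]] := strongly_measurable_step_norm SN SMf (Vs n).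
    rewrite (ae_eq_lower_integral mD (measurable_funTS mh) _ _ hf)//; last first.
      by move=> t _; exact: (snN_ge0 SN).
    rewrite -ge0_integralZl//; last exact: measurable_funTS.
    apply: ae_le_lower_integral => //.
    * by apply: measurable_funTS; apply: measurable_funeM.
    * by move=> t _; exact: (snN_ge0 SN).
    * by move=> t _; rewrite mule_ge0.
    apply: filterS hf => t hf Dt; rewrite -hf// step_fun_scale -scalerBr (snN_Z SN)//.
    by apply: (snB SN); [exact: Vf|exact: (step_fun_in SN)].
  + by rewrite -[X in _ --> X](mule0 `|a|%:E); apply: cvgeZl.
- rewrite (_ : (fun n => _) = (fun n => `|a|%:E * N (v - step_integral mu D (s n))%R)%E).
    by rewrite -[X in _ --> X](mule0 `|a|%:E); apply: cvgeZl.
  apply/funext => n; rewrite step_integral_scale -scalerBr (snN_Z SN)//.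
  by apply: (snB SN) => //; exact: (step_integral_in mu SN).
Qed.

Lemma is_bochner_integralB D f g v w : measurable D ->
  is_bochner_integral mu V N D f v -> is_bochner_integral mu V N D g w ->
  is_bochner_integral mu V N D (fun t => f t - g t) (v - w).
Proof.
move=> mD fv gw.
have := is_bochner_integralD mD fv (is_bochner_integralZ (-1) mD gw).
rewrite scaleN1r; congr is_bochner_integral.
by apply/funext => t; rewrite scaleN1r.
Qed.

Lemma is_bochner_integral_congr D f g v : is_bochner_integral mu V N D f v ->
  (forall t, D t -> V (g t)) -> (forall t, D t -> N (f t - g t)%R = 0%E) ->
  is_bochner_integral mu V N D g v.
Proof.
move=> [SMf Vv [s [Vs soo sf sv]]] Vg fg; have [Vf _] := SMf.
split => //; first exact: strongly_measurable_congr fg.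
exists s; split => //; move: sf; apply: cvg_trans.
rewrite [X in X @ _](_ : _ =
  (fun n => \int[mu]_(t in D) N (f t - step_fun (s n) t)%R)%E)//.
apply/funext => n; apply: eq_integral => t /set_mem Dt; apply/esym.
apply: (snN_eq0_eq SN).
- by apply: (snB SN); [exact: Vf|exact: (step_fun_in SN)].
- by apply: (snB SN); [exact: Vg|exact: (step_fun_in SN)].
- by rewrite opprB addrA subrK fg.
Qed.

Lemma is_bochner_integral_unique D f v w : measurable D -> (mu D < +oo)%E ->
  is_bochner_integral mu V N D f v -> is_bochner_integral mu V N D f w ->
  N (v - w)%R = 0%E.
Proof.
move=> mD Doo fv fw; apply/eqP; rewrite eq_le (snN_ge0 SN) andbT.
have := @bochner_le _ _ _ _ mu _ _ SN D mD Doo _ _ (cst 0%E)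
  (is_bochner_integralB mD fv fw).
rewrite integral0; apply => //.
by apply: aeW => t _; rewrite subrr (snN0 SN).
Qed.

(** This makes the difference of integrals over ]0,t[ and ]0,s[ a single integral. *)
Lemma is_bochner_integral_extend D D' f v : measurable D -> D `<=` D' ->
  is_bochner_integral mu V N D f v ->
  is_bochner_integral mu V N D' (fun t => if t \in D then f t else 0) v.
Proof.
move=> mD DD' [SMf Vv [s [Vs soo sf sv]]]; have [Vf [r [Vr rf]]] := SMf.
have fE s' t : (if t \in D then f t else 0) - step_fun (step_restr D s') t =
    if t \in D then f t - step_fun s' t else 0.
  rewrite step_fun_restr indicE; case: ifPn => _.
    by rewrite scale1r.
  by rewrite scale0r subrr.
split => //.
- split => [t _|].
    by case: ifPn => [/set_mem/Vf//|_]; exact: (sn0 SN).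
  exists (fun n => step_restr D (r n)); split => [n|].
    exact: simple_step_restr.
  apply: filterS rf => t rf _; under eq_fun do rewrite fE.
  have [/set_mem/rf//|_] := boolP (t \in D).
  by rewrite (snN0 SN); exact: cvg_cst.
- exists (fun n => step_restr D (s n)); split => [n|n i||].
  + exact: simple_step_restr.
  + by rewrite /= -setIA (setIidl DD').
  + move: sf; apply: cvg_trans.
    rewrite [X in X @ _](_ : _ =
      (fun n => \int[mu]_(t in D) N (f t - step_fun (s n) t)%R)%E)//.
    apply/funext => n; rewrite -[in RHS](setIidr DD') integral_mkcondr.
    apply: eq_integral => t _; rewrite fE patchE; case: ifPn => // _.
    exact: (snN0 SN).
  + move: sv; apply: cvg_trans.
    rewrite [X in X @ _](_ : _ = (fun n => N (v - step_integral mu D (s n))%R))//.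
    apply/funext => n; congr (N (_ - _)%R); apply: eq_bigr => i _ /=.
    by rewrite -setIA (setIidl DD').
Qed.

(** Change of variables along a measure preserving map, to be used with the
    reflection u -> t - u. *)
Lemma is_bochner_integral_preimage d' (T' : measurableType d')
    (mu' : {measure set T' -> \bar R}) (phi : T -> T') (D' : set T') (f : T' -> E) v :
  measurable_fun setT phi -> measurable D' ->
  (forall A, measurable A -> mu (phi @^-1` A) = mu' A) ->
  is_bochner_integral mu' V N D' f v ->
  is_bochner_integral mu V N (phi @^-1` D')%R (f \o phi) v.
Proof.
move=> mphi mD' muE [SMf Vv [s [Vs soo sf sv]]]; have [Vf [r [Vr rf]]] := SMf.
have mpre A : measurable A -> measurable (phi @^-1` A).
  by move=> mA; rewrite -[X in measurable X]setTI; exact: mphi.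
have aepre (P : T' -> Prop) : {ae mu', forall t, P t} -> {ae mu, forall t, P (phi t)}.
  move=> [Z [mZ Z0 PZ]]; exists (phi @^-1` Z); split.
  - exact: mpre.
  - by rewrite muE.
  - by move=> t /= nP; apply: PZ.
split => //.
- split => [t|]; first exact: Vf.
  exists (fun n => step_preimage phi (r n)); split => [n|].
    exact: simple_step_preimage.
  exact: (aepre (fun t => D' t -> N (f t - step_fun (r n) t)%R @[n --> \oo] --> 0%E)).
- exists (fun n => step_preimage phi (s n)); split => [n|n i||].
  + exact: simple_step_preimage.
  + rewrite /= -preimage_setI muE; first exact: soo.
    by apply: measurableI => //; have [] := Vs n i.
  + move: sf; apply: cvg_trans.
    rewrite [X in X @ _](_ : _ =
      (fun n => \int[mu']_(t in D') N (f t - step_fun (s n) t)%R)%E)//.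
    apply/funext => n.
    have [h [mh h0 hf]] := strongly_measurable_step_norm SN SMf (Vs n).
    have /= hf' := aepre _ hf.
    rewrite (ae_eq_lower_integral mD' (measurable_funTS mh) _ _ hf)//; last first.
      by move=> t _; exact: (snN_ge0 SN).
    rewrite (@ae_eq_lower_integral _ _ _ mu (phi @^-1` D') _ (h \o phi))//.
    * rewrite -ge0_integral_pushforward//; last exact: measurable_funTS.
      by apply: eq_measure_integral => A mA _; exact: muE.
    * exact: mpre.
    * by apply: measurable_funTS; exact: measurableT_comp.
    * by move=> t _; exact: (snN_ge0 SN).
    * by move=> t _ /=.
  + move: sv; apply: cvg_trans.
    rewrite [X in X @ _](_ : _ = (fun n => N (v - step_integral mu' D' (s n))%R))//.
    apply/funext => n; congr (N (_ - _)%R); apply: eq_bigr => i _ /=.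
    rewrite -preimage_setI muE//.
    by apply: measurableI => //; have [] := Vs n i.
Qed.

End bochner_operations.

(** * Improper integrals and the Gamma function *)
Lemma eq_ler (R : realType) (x y : R) : x = y -> x <= y.
Proof. by move=> ->. Qed.

Lemma powRD_gt0 (R : realType) (x b c : R) : 0 < x -> x `^ (b + c) = x `^ b * x `^ c.
Proof. by move=> x0; rewrite powRD// (gt_eqF x0) implybT. Qed.

Section improper_integrals.
Context {R : realType}.
Local Notation mu := (@lebesgue_measure R).
Implicit Types (f F : R -> R) (b l : R).

Lemma is_derive_continuous F (x dF : R) : is_derive x 1 F dF -> {for x, continuous F}.
Proof. by move=> Fx; apply: differentiable_continuous; apply/derivable1_diffP; exact: ex_derive. Qed.

(** f may be unbounded at 0: the usual theorem applies on [b/(n+2), b], and these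
    intervals exhaust ]0, b]. *)
Lemma integral_FTC_at0 f F b l : 0 < b ->
  (forall x : R, 0 < x -> is_derive x 1 F (f x)) ->
  (forall x : R, 0 < x -> {for x, continuous f}) ->
  (forall x, 0 < x <= b -> 0 <= f x) ->
  F x @[x --> 0^'+] --> l ->
  (\int[mu]_(x in `]0%R, b]) (f x)%:E = (F b - l)%:E)%E.
Proof.
move=> b0 dF cf f0 Fl.
pose a n : R := b / n.+2%:R.
have a0 n : 0 < a n by rewrite divr_gt0.
have ab n : a n < b by rewrite ltr_pdivrMr// ltr_pMr// ltr1n.
have aF : F (a n) @[n --> \oo] --> l.
  apply: (cvg_comp a F _ Fl).
  have acvg : a n @[n --> \oo] --> 0.
    rewrite -(mulr0 b); apply: cvgMr.
    by have := @cvg_harmonic R; rewrite -cvg_shiftS.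
  move=> A [e /= e0 eA].
  have : \forall n \near \oo, ball (0 : R) e (a n) := acvg _ (nbhsx_ballx (0 : R) e e0).
  by apply: filterS => n an; exact: eA.
have FTC n : (\int[mu]_(x in `[a n, b]) (f x)%:E = (F b - F (a n))%:E)%E.
  rewrite (@continuous_FTC2 _ f F)// ?EFinB//.
  - apply: continuous_in_subspaceT => x; rewrite inE/= in_itv/= => /andP[ax _].
    by apply: cf; exact: lt_le_trans ax.
  - split.
    + move=> x; rewrite in_itv/= => /andP[ax _].
      by apply: ex_derive; apply: dF; exact: lt_trans ax.
    + by apply: cvg_at_right_filter; exact: is_derive_continuous (dF _ (a0 n)).
    + by apply: cvg_at_left_filter; exact: is_derive_continuous (dF _ b0).
  - move=> x; rewrite in_itv/= => /andP[ax _].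
    have x0 : 0 < x by exact: lt_trans ax.
    by rewrite derive1E; have := dF _ x0 => -[].
have UE : \bigcup_n `[a n, b]%classic = `]0, b]%classic.
  apply/seteqP; split=> [x [n _]|x] /=; rewrite !in_itv/=.
    by move=> /andP[ax ->]; rewrite andbT; exact: lt_le_trans ax.
  move=> /andP[x0 xb].
  have [n _ /(_ n (leqnn n))] : \forall n \near \oo, `|a n - 0| <= x.
    have acvg : a n @[n --> \oo] --> 0.
      rewrite -(mulr0 b); apply: cvgMr.
      by have := @cvg_harmonic R; rewrite -cvg_shiftS.
    by move/cvgrPdist_le : acvg => /(_ x x0); apply: filterS => n; rewrite distrC.
  rewrite subr0 gtr0_norm// => anx.
  by exists n => //=; rewrite in_itv/= anx xb.
have mf : measurable_fun `]0%R, b] (EFin \o f).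
  have mf0 : measurable_fun `](0 : R), +oo[ f.
    apply: open_continuous_measurable_fun => //.
    by move=> x; rewrite inE/= in_itv/= andbT; exact: cf.
  apply/measurable_EFinP; apply: measurable_funS mf0 => //.
  by move=> x /=; rewrite !in_itv/= andbT => /andP[].
have /cvg_lim <-// : (\int[mu]_(x in `[a n, b]) (f x)%:E)%E @[n --> \oo] -->
    (\int[mu]_(x in `]0%R, b]) (f x)%:E)%E.
  rewrite -UE; apply: ge0_nondecreasing_set_cvg_integral => //.
  - apply/nondecreasing_seqP => n; rewrite subsetEset => x /=.
    rewrite !in_itv/= => /andP[ax ->]; rewrite andbT; apply: le_trans ax.
    by rewrite ler_pM2l// lef_pV2 ?posrE// ler_nat.
  - move=> n; apply: measurable_funS mf => //.
    move=> x /=; rewrite !in_itv/= => /andP[ax ->]; rewrite andbT.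
    exact: lt_le_trans ax.
  - move=> n x /=; rewrite in_itv/= => /andP[ax xb]; rewrite lee_fin f0// xb andbT.
    exact: lt_le_trans ax.
apply/cvg_lim => //; under eq_fun do rewrite FTC.
apply: cvg_EFin; first exact: nearW.
by apply: cvgB => //; exact: cvg_cst.
Qed.

Lemma powR_continuous_pos (a x : R) : 0 < x -> {for x, continuous (fun y : R => y `^ a)}.
Proof. by move=> x0; exact: is_derive_continuous (is_derive1_powR a x0). Qed.

Lemma integral_powR_at0 (a b : R) : 0 < a -> 0 < b ->
  (\int[mu]_(x in `]0%R, b]) (x `^ (a - 1))%:E = (b `^ a / a)%:E)%E.
Proof.
move=> a0 b0.
have dF (x : R) : 0 < x -> is_derive x 1 (a^-1 *: (fun x => x `^ a)) (x `^ (a - 1)).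
  move=> x0; have h := is_derive1_powR a x0; apply: is_derive_eq.
  by rewrite /GRing.scale/= mulKf// gt_eqF.
rewrite (integral_FTC_at0 b0 dF (l := 0)).
- by rewrite subr0 mulrC.
- by move=> x x0; exact: powR_continuous_pos.
- by move=> x _; exact: powR_ge0.
- by rewrite -[X in _ --> X](scaler0 _ a^-1); apply: cvgZr; exact: powR_cvg0.
Qed.

End improper_integrals.

Section gamma.
Context {R : realType}.
Local Notation mu := (@lebesgue_measure R).
Implicit Types a b x y : R.

Let g a x : R := x `^ (a - 1) * expR (- x).

Let EG a : \bar R := (\int[mu]_(x in `]0%R, +oo[) (g a x)%:E)%E.

Let mg a (D : set R) : measurable_fun D (EFin \o g a).
Proof.
apply/measurable_EFinP; apply: measurable_funTS; apply: measurable_funM => //.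
by apply: measurableT_comp => //; exact: measurable_oppr.
Qed.

Let g0 a x : 0 <= g a x.
Proof. by rewrite mulr_ge0 ?powR_ge0 ?expR_ge0. Qed.

(** This is b ln y <= b y for y = x / (2 b). *)
Lemma powR_le_expR b x : 0 < b -> 0 < x -> x `^ b <= (2 * b) `^ b * expR (x / 2).
Proof.
move=> b0 x0; have b20 : 0 < 2 * b by rewrite mulr_gt0.
rewrite /powR !gt_eqF// -expRD ler_expR.
have : ln (x / (2 * b)) <= x / (2 * b).
  by apply: ltW; apply: ln_sublinear; exact: divr_gt0.
rewrite lnM ?posrE ?invr_gt0// lnV ?posrE// => h.
have : b * (ln x - ln (2 * b)) <= b * (x / (2 * b)) by rewrite ler_pM2l.
have -> : b * (x / (2 * b)) = x / 2 by field; rewrite gt_eqF.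
lra.
Qed.

(** The derivative of h b is x^(b-1) e^(-x) (b - x), positive before b and negative
    after.  Cutting the integral of Gamma at b thus gives the functional equation by
    integrating nonnegative functions only: the boundary terms h b b of the two
    halves cancel. *)
Let h b x : R := x `^ b * expR (- x).

Let dh b x : 0 < x -> is_derive x 1 (h b) (g b x * (b - x)).
Proof.
move=> x0; have d1 := is_derive1_powR b x0.
apply: is_derive_eq; rewrite /GRing.scale/= /g mulrN1 mulrN.
have -> : x `^ b = x * x `^ (b - 1).
  rewrite -{2}(powRr1 (ltW x0)) -powRD_gt0//.
  by congr powR; ring.
ring.
Qed.

Let ch b x : 0 < x -> {for x, continuous (fun x => g b x * (b - x))}.
Proof.
move=> x0; apply: continuousM; last by apply: continuousB; [exact: cvg_cst|exact: cvg_id].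
apply: continuousM; first exact: powR_continuous_pos.
by apply: continuous_comp; [exact: opp_continuous|exact: continuous_expR].
Qed.

Let h_at0 b : 0 < b -> h b x @[x --> 0^'+] --> 0.
Proof.
move=> b0; rewrite -[X in _ --> X](mul0r (expR (- 0))).
apply: (@cvgM _ _ _ _ (fun x => x `^ b) (fun x => expR (- x))); first exact: powR_cvg0.
apply: cvg_at_right_filter.
by apply: continuous_comp; [exact: opp_continuous|exact: continuous_expR].
Qed.

Let h_aty b : 0 < b -> h b x @[x --> +oo%R] --> 0.
Proof.
move=> b0; apply: (squeeze_cvgr (f := cst 0) (h := fun x => (2 * b) `^ b * expR (- (x / 2)))).
- near=> x; have x0 : 0 < x by near: x; exact: nbhs_pinfty_gt.
  rewrite /cst /h mulr_ge0 ?powR_ge0 ?expR_ge0//=.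
  apply: (@le_trans _ _ ((2 * b) `^ b * expR (x / 2) * expR (- x))).
    by rewrite ler_wpM2r ?expR_ge0// powR_le_expR.
  by rewrite -mulrA -expRD (_ : x / 2 - x = - (x / 2))//; lra.
- exact: cvg_cst.
- rewrite -[X in _ --> X](mulr0 ((2 * b) `^ b)); apply: cvgMr.
  apply: (@cvg_comp _ _ _ (fun x : R => x / 2) (fun x => expR (- x)) _ (+oo%R)).
    by apply: gt0_cvgMly => //; rewrite invr_gt0.
  exact: cvgr_expR.
Unshelve. all: by end_near. Qed.

Let mgb b (D : set R) : measurable_fun D (fun x : R => (g b x * (b - x))%:E).
Proof.
apply/measurable_EFinP; apply: measurable_funTS; apply: measurable_funM.
  by apply/measurable_EFinP; exact: mg.
by apply: measurable_funB.
Qed.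

Let mgb' b (D : set R) : measurable_fun D (fun x : R => (g b x * (x - b))%:E).
Proof.
apply/measurable_EFinP; apply: measurable_funTS; apply: measurable_funM.
  by apply/measurable_EFinP; exact: mg.
by apply: measurable_funB.
Qed.

Let int_h0 b : 0 < b ->
  (\int[mu]_(x in `]0%R, b]) (g b x * (b - x))%:E = (h b b)%:E)%E.
Proof.
move=> b0; rewrite (integral_FTC_at0 b0 (@dh b) (l := 0)) ?subr0//.
- by move=> x; exact: ch.
- by move=> x /andP[_ xb]; rewrite mulr_ge0// subr_ge0.
- exact: h_at0.
Qed.

Let int_hy b : 0 < b ->
  (\int[mu]_(x in `]b, +oo[) (g b x * (x - b))%:E = (h b b)%:E)%E.
Proof.
move=> b0.
have cg x : 0 < x -> {for x, continuous (fun x => g b x * (x - b))}.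
  move=> x0; rewrite (_ : (fun x => _) = - (fun x => g b x * (b - x))).
    by apply: continuousN; exact: ch.
  by apply/funext => y; rewrite fctE -mulrN opprB.
have dnh x : 0 < x -> is_derive x 1 (- h b) (g b x * (x - b)).
  move=> x0; have := dh b x0 => d; apply: is_derive_eq.
  by rewrite -mulrN opprB.
rewrite integral_itv_obnd_cbnd; last exact: mgb'.
rewrite (@ge0_continuous_FTC2y _ (fun x => g b x * (x - b)) (- h b) b 0)//.
- by rewrite sub0e -EFinN opprK.
- by move=> x bx; rewrite mulr_ge0// subr_ge0.
- apply: continuous_in_subspaceT => x; rewrite inE/= in_itv/= andbT => bx.
  by apply: cg; exact: lt_le_trans bx.
- by rewrite -oppr0; apply: cvgN; exact: h_aty.
- by move=> x bx; apply: ex_derive; apply: dnh; exact: lt_trans bx.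
- by apply: cvg_at_right_filter; exact: is_derive_continuous (dnh _ b0).
- move=> x; rewrite in_itv/= andbT => bx.
  by rewrite derive1E; have := dnh _ (lt_trans b0 bx) => -[].
Qed.

Let EG_split a b : 0 < b -> EG a =
  (\int[mu]_(x in `]0%R, b]) (g a x)%:E + \int[mu]_(x in `]b, +oo[) (g a x)%:E)%E.
Proof.
move=> b0; rewrite /EG (@itv_bndbnd_setU _ _ _ (BRight b)) ?bnd_simp ?ltW//.
rewrite ge0_integral_setU//=.
- exact: mg.
- by move=> x _; rewrite lee_fin.
- apply/disj_setPS => x [] /=; rewrite !in_itv/= andbT => /andP[_ xb].
  by rewrite ltNge xb.
Qed.

Let gS b x : 0 < x -> g (b + 1) x = x * g b x.
Proof.
move=> x0; rewrite /g mulrA; congr (_ * _).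
rewrite -{2}(powRr1 (ltW x0)) -powRD_gt0//.
by congr powR; ring.
Qed.

Let EGS b : 0 < b -> EG (b + 1) = (b%:E * EG b)%E.
Proof.
move=> b0; rewrite !(EG_split _ b0) ge0_muleDr; last 2 first.
- by apply: integral_ge0 => x _; rewrite lee_fin.
- by apply: integral_ge0 => x _; rewrite lee_fin.
have -> : (b%:E * \int[mu]_(x in `]0%R, b]) (g b x)%:E =
    \int[mu]_(x in `]0%R, b]) (g (b + 1) x)%:E + (h b b)%:E)%E.
  rewrite -ge0_integralZl_EFin//; [|by move=> x _; rewrite lee_fin|exact: mg|exact: ltW].
  rewrite -int_h0// -ge0_integralD//.
  - apply: eq_integral => x; rewrite inE/= in_itv/= => /andP[x0 xb].
    by rewrite gS// -EFinD -EFinM; congr EFin; ring.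
  - by move=> x _; rewrite lee_fin.
  - exact: mg.
  - by move=> x; rewrite /= in_itv/= => /andP[_ xb]; rewrite lee_fin mulr_ge0// subr_ge0.
  - exact: mgb.
have -> : (\int[mu]_(x in `]b, +oo[) (g (b + 1) x)%:E =
    b%:E * (\int[mu]_(x in `]b, +oo[) (g b x)%:E) + (h b b)%:E)%E.
  rewrite -ge0_integralZl_EFin//; [|by move=> x _; rewrite lee_fin|exact: mg|exact: ltW].
  rewrite -int_hy// -ge0_integralD//.
  - apply: eq_integral => x; rewrite inE/= in_itv/= andbT => bx.
    by rewrite gS ?(lt_trans b0)// -EFinM -EFinD; congr EFin; ring.
  - by move=> x _; rewrite -EFinM lee_fin mulr_ge0// ltW.
  - by apply: measurable_funeM; exact: mg.
  - move=> x; rewrite /= in_itv/= andbT => bx.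
    by rewrite lee_fin mulr_ge0// subr_ge0 ltW.
  - exact: mgb'.
by rewrite addeA addeAC.
Qed.

Let EG_gt0 b : 0 < b -> (0 < EG b)%E.
Proof.
move=> b0; apply: (@lt_le_trans _ _ (b^-1 * h b b)%:E).
  by rewrite lte_fin mulr_gt0 ?invr_gt0// mulr_gt0 ?powR_gt0 ?expR_gt0.
rewrite EFinM -int_h0// -ge0_integralZl_EFin//; last 3 first.
- by move=> x; rewrite /= in_itv/= => /andP[_ xb]; rewrite lee_fin mulr_ge0// subr_ge0.
- exact: mgb.
- by rewrite invr_ge0 ltW.
rewrite (EG_split _ b0); apply: (@le_trans _ _ (\int[mu]_(x in `]0%R, b]) (g b x)%:E)%E).
  apply: ge0_le_integral => //.
  - move=> x; rewrite /= in_itv/= => /andP[_ xb].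
    rewrite -EFinM lee_fin; apply: mulr_ge0; first by rewrite invr_ge0 ltW.
    by rewrite mulr_ge0// subr_ge0.
  - by apply: measurable_funeM; exact: mgb.
  - exact: mg.
  - move=> x; rewrite /= in_itv/= => /andP[x0 xb].
    rewrite -EFinM lee_fin mulrCA ler_piMr// ler_pdivrMl// mulr1.
    by rewrite gerBl ltW.
by rewrite leeDl//; apply: integral_ge0 => x _; rewrite lee_fin.
Qed.

Let int_expRN : (\int[mu]_(x in `[0%R, +oo[) (expR (- x))%:E = 1)%E.
Proof.
have dE (x : R) : is_derive x 1 (- (fun x => expR (- x))) (expR (- x)).
  apply: is_derive_eq; by rewrite /GRing.scale/= mulrN1 opprK.
have cE (x : R) : {for x, continuous (fun x => expR (- x))}.
  by apply: continuous_comp; [exact: opp_continuous|exact: continuous_expR].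
rewrite (@ge0_continuous_FTC2y _ (fun x => expR (- x)) (- (fun x => expR (- x))) 0 0)//.
- by rewrite sub0e -EFinN fctE oppr0 expR0 opprK.
- by apply: continuous_subspaceT => x; exact: cE.
- by rewrite -oppr0; apply: cvgN; exact: cvgr_expR.
- by apply: cvg_at_right_filter; exact: is_derive_continuous (dE 0).
- by move=> x _; rewrite derive1E; have [_] := dE x.
Qed.

Let EG_fin1 a : 0 < a -> a <= 1 -> (EG a < +oo)%E.
Proof.
move=> a0 a1; rewrite (EG_split _ ltr01); apply: lte_add_pinfty.
  apply: (@le_lt_trans _ _ (\int[mu]_(x in `]0%R, 1%R]) (x `^ (a - 1))%:E)%E).
    apply: ge0_le_integral => //.
    - by move=> x _; rewrite lee_fin.
    - exact: mg.
    - by apply/measurable_EFinP; exact: measurable_funTS.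
    - move=> x; rewrite /= in_itv/= => /andP[x0 _]; rewrite lee_fin.
      by rewrite ler_piMr ?powR_ge0// expR_le1// oppr_le0 ltW.
  by rewrite integral_powR_at0// ltry.
have mE : measurable_fun setT (fun x : R => expR (- x)).
  by apply: measurableT_comp => //; exact: measurable_oppr.
apply: (@le_lt_trans _ _ (\int[mu]_(x in `]1%R, +oo[) (expR (- x))%:E)%E).
  apply: ge0_le_integral => //.
  - by move=> x _; rewrite lee_fin.
  - exact: mg.
  - by apply/measurable_EFinP; exact: measurable_funTS.
  - move=> x; rewrite /= in_itv/= andbT => x1; rewrite lee_fin.
    have a10 : a - 1 <= 0 by rewrite subr_le0.
    rewrite /g ler_piMl ?expR_ge0//; apply: (le_trans (ler_powR (ltW x1) a10)).
    by rewrite powRr0.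
apply: (@le_lt_trans _ _ (\int[mu]_(x in `[0%R, +oo[) (expR (- x))%:E)%E).
  apply: ge0_subset_integral => //.
  - by apply/measurable_EFinP; exact: measurable_funTS.
  - by move=> x /=; rewrite !in_itv/= !andbT => x1; rewrite ltW// (lt_trans _ x1).
by rewrite int_expRN ltry.
Qed.

Lemma floor_decomp a : 0 < a -> exists (n : nat) (b : R), [/\ 0 < b, b <= 1 & a = b + n%:R].
Proof.
move=> a0; have := archi_boundP (ltW a0); move: (Num.bound a) => k.
elim: k a a0 => [|k IH] a a0 ak; first by move: ak; rewrite ltNge ltW.
have [a1|a1] := lerP a 1; first by exists 0%N, a; rewrite addr0.
have [||n [b [b0 b1 ab]]] := IH (a - 1); first by rewrite subr_gt0.
  by rewrite ltrBlDr natr1.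
by exists n.+1, b; split => //; rewrite -natr1 addrA -ab subrK.
Qed.

Let EG_fin a : 0 < a -> EG a \is a fin_num.
Proof.
move=> a0; have [n [b [b0 b1 ->]]] := floor_decomp a0.
elim: n => [|n IH].
  by rewrite addr0 ge0_fin_numE ?EG_fin1// ltW// EG_gt0.
by rewrite -natr1 addrA EGS ?fin_numM// ltr_wpDr.
Qed.

Lemma Gamma_gt0 a : 0 < a -> 0 < Gamma a.
Proof.
move=> a0; rewrite /Gamma /Rintegral fine_gt0// EG_gt0//=.
by have := EG_fin a0; rewrite fin_numElt => /andP[].
Qed.

Lemma Gamma1 : Gamma 1 = 1 :> R.
Proof.
rewrite /Gamma /Rintegral (_ : (\int[_]_(x in _) _)%E = 1%E)//.
rewrite -[RHS]int_expRN integral_itv_obnd_cbnd; last first.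
  by have := @mg 1 `]0%R, +oo[%classic.
by apply: eq_integral => x _; rewrite subrr powRr0 mul1r.
Qed.

Lemma GammaS a : 0 < a -> Gamma (a + 1) = a * Gamma a.
Proof.
move=> a0; rewrite /Gamma /Rintegral -[LHS]/(fine (EG (a + 1))) EGS//.
by rewrite fineM// EG_fin.
Qed.

(** Bernoulli's inequality, from the convexity of exp between ln z and 0. *)
Lemma powR_le_affine (b z : R) : 0 <= b <= 1 -> 0 < z -> z `^ b <= 1 + b * (z - 1).
Proof.
move=> /andP[b0 b1] z0; rewrite /powR gt_eqF//.
have [->|bn1] := eqVneq b 1; first by rewrite !mul1r lnK ?posrE//; lra.
have := @convex_expR R (Itv01 b0 b1) (ln z) 0.
rewrite !convRE/= mulr0 addr0 expR0 lnK ?posrE//.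
rewrite /unstable.onem mulr1 => /le_trans; apply; lra.
Qed.

(** By Bernoulli's inequality x^b <= y^b (1 + b (x/y - 1)).  Integrating against
    x^(y-1) e^(-x), the linear term disappears, since Gamma (y + 1) = y Gamma y. *)
Lemma Gamma_Wendel y b : 0 < y -> 0 <= b <= 1 -> Gamma (y + b) <= y `^ b * Gamma y.
Proof.
move=> y0 b01; have /andP[b0 b1] := b01.
have y1 : 0 < y + 1 by rewrite addr_gt0.
have yb : 0 < y + b by rewrite ltr_wpDr.
rewrite -lee_fin EFinM.
have GE a : 0 < a -> (Gamma a)%:E = EG a by move=> a0; rewrite fineK// EG_fin.
rewrite !GE//; set c := y `^ b.
have c0 : 0 <= c by exact: powR_ge0.
have step1 : (EG (y + b) <=
    \int[mu]_(x in `]0%R, +oo[) ((c * (1 - b))%:E * (g y x)%:E +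
                               (c * b / y)%:E * (g (y + 1) x)%:E))%E.
  apply: ge0_le_integral => //.
  - by move=> x _; rewrite lee_fin.
  - exact: mg.
  - by apply: emeasurable_funD; apply: measurable_funeM; exact: mg.
  - move=> x; rewrite /= in_itv/= andbT => x0.
    rewrite -!EFinM -EFinD lee_fin gS// /g.
    have -> : x `^ (y + b - 1) = x `^ b * x `^ (y - 1).
      by rewrite -powRD_gt0//; congr powR; ring.
    have xy0 : 0 < x / y by rewrite divr_gt0.
    have xbE : x `^ b = c * (x / y) `^ b.
      by rewrite -powRM ?ltW// mulrC divfK// gt_eqF.
    have := powR_le_affine b01 xy0 => le1.
    rewrite -mulrA xbE.
    apply: (@le_trans _ _ (c * (1 + b * (x / y - 1)) * (x `^ (y - 1) * expR (- x)))).
      by rewrite ler_wpM2r ?mulr_ge0 ?powR_ge0 ?expR_ge0// ler_wpM2l.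
    apply: eq_ler; field; rewrite gt_eqF//.
apply: (le_trans step1).
have mgT := fun a => @mg a `]0%R, +oo[%classic.
have g0' a : forall x, `]0%R, +oo[%classic x -> (0 <= (g a x)%:E)%E by move=> x _; rewrite lee_fin.
have c1 : 0 <= c * (1 - b) by rewrite mulr_ge0// subr_ge0.
have c2 : 0 <= c * b / y by rewrite divr_ge0 ?mulr_ge0// ltW.
rewrite ge0_integralD//; last 4 first.
- by move=> x _; rewrite -EFinM lee_fin mulr_ge0.
- by apply: measurable_funeM; exact: mgT.
- by move=> x _; rewrite -EFinM lee_fin mulr_ge0.
- by apply: measurable_funeM; exact: mgT.
rewrite !ge0_integralZl_EFin//; try (exact: mgT); try (exact: g0').
rewrite -/(EG y) -/(EG (y + 1)) EGS// muleA -EFinM -ge0_muleDl ?lee_fin//; last first.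
  by rewrite mulr_ge0// ltW.
rewrite -EFinD (_ : c * (1 - b) + c * b / y * y = c)//.
by field; rewrite gt_eqF.
Qed.

End gamma.

(** * Cauchy products and the coefficients of (1 - z)^(-b) *)
Section cauchy_product.
Context {R : comNzRingType}.
Implicit Types f g h : nat -> R.

Definition cauchy f g n : R := \sum_(i < n.+1) f i * g (n - i)%N.

(** Only finitely many terms matter at rank n, so the algebra of Cauchy products is
    that of polynomials. *)
Lemma cauchy_coef f g N n : (n < N)%N ->
  cauchy f g n = (\poly_(i < N) f i * \poly_(i < N) g i)`_n.
Proof.
move=> nN; rewrite coefM; apply: eq_bigr => i _.
have i_n : (i <= n)%N by rewrite -ltnS.
by rewrite !coef_poly (leq_ltn_trans i_n nN) (leq_ltn_trans (leq_subr i n) nN).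
Qed.

Lemma cauchyC f g n : cauchy f g n = cauchy g f n.
Proof. by rewrite !(cauchy_coef _ _ (ltnSn n)) mulrC. Qed.

Lemma cauchyA f g h n :
  cauchy f (cauchy g h) n = cauchy (cauchy f g) h n.
Proof.
rewrite !(cauchy_coef _ _ (ltnSn n)).
have E f1 g1 i : (i <= n)%N -> (\poly_(j < n.+1) cauchy f1 g1 j)`_i =
    (\poly_(i < n.+1) f1 i * \poly_(i < n.+1) g1 i)`_i.
  by move=> ni; rewrite coef_poly ltnS ni (cauchy_coef _ _ (_ : (i < n.+1)%N)).
transitivity ((\poly_(i < n.+1) f i *
  (\poly_(i < n.+1) g i * \poly_(i < n.+1) h i))`_n).
  by rewrite !coefM; apply: eq_bigr => i _; rewrite E// leq_subr.
rewrite mulrA [LHS]coefM [RHS]coefM; apply: eq_bigr => i _.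
by rewrite E// -ltnS.
Qed.

Lemma cauchyDr f g h n :
  cauchy f (fun i => g i + h i) n = cauchy f g n + cauchy f h n.
Proof. by rewrite /cauchy -big_split; apply: eq_bigr => i _; rewrite mulrDr. Qed.

Lemma cauchyZr f g a n : cauchy f (fun i => a * g i) n = a * cauchy f g n.
Proof. by rewrite /cauchy mulr_sumr; apply: eq_bigr => i _; rewrite mulrCA. Qed.

Lemma cauchy1 f n : cauchy f (fun i => (i == 0%N)%:R) n = f n.
Proof.
rewrite /cauchy big_ord_recr/= subnn eqxx mulr1 big1 ?add0r// => i _.
by rewrite subn_eq0 leqNgt ltn_ord mulr0.
Qed.

Lemma eq_cauchy f g f' g' n : f =1 f' -> g =1 g' -> cauchy f g n = cauchy f' g' n.
Proof. by move=> ff' gg'; apply: eq_bigr => i _; rewrite ff' gg'. Qed.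

End cauchy_product.

Section binomial_series.
Context {R : realFieldType}.
Implicit Types (b : R) (n : nat).

(** The coefficient of z^n in (1 - z)^(-b). *)
Definition bcoef b n : R := \prod_(i < n) ((b + i%:R) / i.+1%:R).

Lemma bcoef0 b : bcoef b 0 = 1.
Proof. by rewrite /bcoef big_ord0. Qed.

Lemma bcoefS b n : n.+1%:R * bcoef b n.+1 = (b + n%:R) * bcoef b n.
Proof.
rewrite /bcoef big_ord_recr/= mulrCA mulrC; congr (_ * _).
by rewrite mulrC divfK// pnatr_eq0.
Qed.

(** The recurrence is the differential equation (1 - z) F' = b F. *)
Lemma bcoef_uniq (f : nat -> R) b : f 0%N = 1 ->
  (forall n, n.+1%:R * f n.+1 = (b + n%:R) * f n) -> f =1 bcoef b.
Proof.
move=> f0 fS; elim=> [|n IH]; first by rewrite bcoef0.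
by apply: (@mulfI _ n.+1%:R); rewrite ?pnatr_eq0// fS bcoefS IH.
Qed.

(** (1-z)^(-b) (1-z)^(-c) = (1-z)^(-(b+c)): the product satisfies the recurrence of
    the right-hand side. *)
Lemma cauchy_bcoef b c n : cauchy (bcoef b) (bcoef c) n = bcoef (b + c) n.
Proof.
apply: bcoef_uniq n => [|n]; first by rewrite /cauchy big_ord1 !bcoef0 mulr1.
rewrite /cauchy !mulr_sumr.
pose u i := i%:R * bcoef b i * bcoef c (n.+1 - i).
pose v i := bcoef b i * ((n.+1 - i)%:R * bcoef c (n.+1 - i)).
rewrite (eq_bigr (fun i : 'I_n.+2 => u i + v i)); last first.
  move=> i _; have iS : (i <= n.+1)%N by rewrite -ltnS.
  have -> : n.+1%:R = i%:R + (n.+1 - i)%:R :> R by rewrite -natrD subnKC.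
  by rewrite mulrDl /u /v -!mulrA; congr (_ + _); exact: mulrCA.
rewrite big_split/= big_ord_recl {1}/u !mul0r add0r.
rewrite [X in _ + X]big_ord_recr/= {2}/v subnn mul0r mulr0 addr0 -big_split/=.
apply: eq_bigr => i _.
have iS : (i <= n)%N by rewrite -ltnS.
rewrite /u /v /bump/= add1n subSS bcoefS subSn// bcoefS.
have -> : n%:R = i%:R + (n - i)%:R :> R by rewrite -natrD subnKC.
by move: (bcoef b i) (bcoef c _) (_%:R) (_%:R) => B C x y; ring.
Qed.

Lemma bcoef_delta n : bcoef 0 n = (n == 0%N)%:R.
Proof.
case: n => [|n]; first by rewrite bcoef0.
by rewrite /bcoef big_ord_recl/= addr0 mul0r mul0r.
Qed.

Lemma bcoef_gt0 b n : 0 < b -> 0 < bcoef b n.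
Proof.
by move=> b0; apply: prodr_gt0 => i _; rewrite divr_gt0// ltr_wpDr.
Qed.

(** All the signs in the next part come from this property of (1 - z)^b. *)
Lemma bcoef_neg_le0 b n : 0 < b -> b <= 1 -> bcoef (- b) n.+1 <= 0.
Proof.
move=> b0 b1; rewrite /bcoef big_ord_recl/= addr0 divr1 mulNr oppr_le0.
apply: mulr_ge0; first exact: ltW.
apply: prodr_ge0 => i _.
apply: divr_ge0 => //; rewrite /bump/= add1n -natr1.
by have := ler0n R i; lra.
Qed.

Lemma bcoef_nonincr b m n : 0 < b -> b <= 1 -> (m <= n)%N -> bcoef b n <= bcoef b m.
Proof.
move=> b0 b1 mn; rewrite -(subnK mn); elim: (n - m)%N => [|k IH]; first by rewrite add0n.
apply: le_trans IH; rewrite addSn.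
rewrite -(@ler_pM2l _ (k + m).+1%:R)// bcoefS.
by rewrite ler_pM2r ?bcoef_gt0// -natr1 addrC lerD2l.
Qed.

End binomial_series.

Section bcoef_growth.
Context {R : realType}.

(** For fixed n, bcoef (a j) n is a polynomial in j, hence smaller than any geometric
    sequence of ratio k > 1.  The constant comes from y <= exp (e y) / e, applied to
    each of the n factors with e so small that the product grows at most like k^j. *)
Lemma bcoef_geometric (a k : R) n : 0 < a -> 1 < k ->
  exists2 C : R, 0 <= C & forall j, 0 <= bcoef (a * j%:R) n <= C * k ^+ j.
Proof.
move=> a0 k1; have k0 : 0 < k by exact: lt_trans k1.
have lnk : 0 < ln k by exact: ln_gt0.
pose e := ln k / (a * n.+1%:R).
have e0 : 0 < e by rewrite divr_gt0// mulr_gt0.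
exists (\prod_(i < n) (expR (e * i%:R) / (e * i.+1%:R))) => [|j].
  by apply: prodr_ge0 => i _; rewrite divr_ge0 ?expR_ge0// mulr_ge0// ltW.
have aj0 : 0 <= a * j%:R by rewrite mulr_ge0// ltW.
apply/andP; split.
  by apply: prodr_ge0 => i _; rewrite divr_ge0// addr_ge0.
apply: (@le_trans _ _ (\prod_(i < n) (expR (e * (a * j%:R + i%:R)) / (e * i.+1%:R)))).
  apply: ler_prod => i _; rewrite divr_ge0 ?addr_ge0//=.
  rewrite invfM mulrA ler_wpM2r ?invr_ge0// ler_pdivlMr// mulrC.
  by apply: le_trans (expR_ge1Dx _); rewrite lerDr.
rewrite (eq_bigr (fun i : 'I_n => (expR (e * i%:R) / (e * i.+1%:R)) * expR (e * (a * j%:R)))); last first.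
  by move=> i _; rewrite mulrDr expRD -mulrA mulrC.
rewrite big_split/= ler_wpM2l//.
  by apply: prodr_ge0 => i _; rewrite divr_ge0 ?expR_ge0// mulr_ge0// ltW.
rewrite prodr_const card_ord -expRM_natl -[k in leRHS](@lnK _ k) ?posrE// -expRM_natl ler_expR.
rewrite /e (_ : n%:R * _ = (n%:R / n.+1%:R) * (j%:R * ln k)); last first.
  have : n.+1%:R != 0 :> R by rewrite pnatr_eq0.
  by move: (n.+1%:R) => m m0; field; rewrite m0 gt_eqF.
by rewrite ler_piMl// ?mulr_ge0 ?(ltW lnk)// ler_pdivrMr// mul1r ler_nat.
Qed.

End bcoef_growth.

(** * Bounds for the Mittag-Leffler function *)
Section discrete_resolvent.
Context {R : realFieldType}.
Variable a : R.
Hypotheses (a0 : 0 < a) (a1 : a <= 1).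
Implicit Types (c : R) (f g : nat -> R).

(** f is the coefficient sequence of 1 / ((1-z)^a + c).  As (1-z)^a is a discrete
    fractional derivative, f is a discrete analogue of r^(a-1) E_{a,a}(-c r^a). *)
Definition resolvent c f :=
  forall n, cauchy (bcoef (- a)) f n = (n == 0%N)%:R - c * f n.

(** The equation expresses (1 + c) f n as a combination of the previous values with
    the coefficients of -(1-z)^a, which are nonnegative. *)
Lemma resolvent_ge0 c f n : 0 < c -> resolvent c f -> 0 <= f n.
Proof.
move=> c0 rf; elim/ltn_ind: n => n IH.
have := rf n; rewrite /cauchy big_ord_recl/= bcoef0 mul1r subn0.
set S := \sum_(i < n) _ => fE.
have S0 : S <= 0.
  rewrite -oppr_ge0 -sumrN; apply: sumr_ge0 => i _.
  rewrite -mulNr mulr_ge0 ?oppr_ge0 ?bcoef_neg_le0//.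
  by apply: IH; rewrite /bump/= add1n ltn_subrL/= (leq_trans _ (ltn_ord i)).
have cf : (1 + c) * f n = (n == 0%N)%:R - S by lra.
have c1 : 0 < 1 + c by rewrite addr_gt0.
by rewrite -(pmulr_rge0 _ c1) cf subr_ge0 (le_trans S0).
Qed.

(** The equation of f multiplied by (1-z)^(-a). *)
Lemma resolvent_eq c f n : resolvent c f ->
  f n = bcoef a n - c * cauchy (bcoef a) f n.
Proof.
move=> rf; have := cauchyA (bcoef a) (bcoef (- a)) f n.
rewrite (eq_cauchy n (frefl (bcoef a)) rf).
rewrite (@eq_cauchy _ _ _ (fun i => (i == 0%N)%:R) f n _ (frefl f)); last first.
  by move=> i; rewrite cauchy_bcoef subrr bcoef_delta.
rewrite [in RHS]cauchyC cauchy1 => <-.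
rewrite (@eq_cauchy _ _ _ (bcoef a) (fun i => (i == 0%N)%:R + (- c) * f i)) //; last first.
  by move=> i; rewrite mulNr.
by rewrite cauchyDr cauchy1 cauchyZr mulNr.
Qed.

Lemma resolvent_le c f n : 0 < c -> resolvent c f -> f n <= bcoef a n.
Proof.
move=> c0 rf; rewrite (resolvent_eq n rf) gerBl; apply: mulr_ge0; first exact: ltW.
apply: sumr_ge0 => i _; rewrite mulr_ge0//; first by rewrite ltW ?bcoef_gt0.
exact: (resolvent_ge0 _ c0 rf).
Qed.

(** As bcoef a is nonincreasing, bcoef a n times the sum is at most the Cauchy
    product of bcoef a and f, and c times the latter is bcoef a n - f n. *)
Lemma resolvent_sum_le c f n : 0 < c -> resolvent c f ->
  \sum_(i < n.+1) f i <= c^-1.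
Proof.
move=> c0 rf; rewrite -[leRHS]mul1r ler_pdivlMr// mulrC.
rewrite -(ler_pM2l (bcoef_gt0 n a0)) mulr1.
apply: (@le_trans _ _ (c * cauchy (bcoef a) f n)).
  rewrite mulrCA ler_pM2l// cauchyC mulr_sumr; apply: ler_sum => i _.
  rewrite mulrC ler_wpM2l//; first exact: (resolvent_ge0 _ c0 rf).
  by apply: bcoef_nonincr => //; exact: leq_subr.
have := resolvent_eq n rf; have := resolvent_ge0 n c0 rf; lra.
Qed.

(** Compute the product of g, (1-z)^a and f by associating it in the two ways. *)
Lemma resolvent_identity c c' f g n : resolvent c f -> resolvent c' g ->
  f n - g n = (c' - c) * cauchy g f n.
Proof.
move=> rf rg; have := cauchyA g (bcoef (- a)) f n.
rewrite (@eq_cauchy _ g _ g (fun i => (i == 0%N)%:R + (- c) * f i)) //; last first.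
  by move=> i; rewrite rf mulNr.
rewrite [RHS](@eq_cauchy _ _ f (fun i => (i == 0%N)%:R + (- c') * g i) f) //; last first.
  by move=> i; rewrite cauchyC rg mulNr.
rewrite [RHS]cauchyC !cauchyDr !cauchy1 !cauchyZr (cauchyC f g).
by move=> h; rewrite mulrBl; lra.
Qed.

(** In each term one of the two indices is at least n/2.  The corresponding factor is
    at most bcoef a n./2 by [resolvent_le], and the sums of the other factors are at
    most 1/c and 1/c' by [resolvent_sum_le]. *)
Lemma cauchy_resolvent_le c c' f g n : 0 < c -> 0 < c' ->
  resolvent c f -> resolvent c' g ->
  cauchy g f n <= bcoef a n./2 * (c^-1 + c'^-1).
Proof.
move=> c0 c'0 rf rg.
have f0 i := resolvent_ge0 i c0 rf; have g0 i := resolvent_ge0 i c'0 rg.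
apply: (@le_trans _ _ (\sum_(i < n.+1) bcoef a n./2 * (g i + f (n - i)%N))).
  apply: ler_sum => i _; have iN : (i <= n)%N by rewrite -ltnS.
  have [ni|ni] := leqP n./2 (n - i).
    apply: (@le_trans _ _ (g i * bcoef a n./2)).
      rewrite ler_wpM2l// (le_trans (resolvent_le _ c0 rf))//.
      exact: bcoef_nonincr.
    by rewrite mulrC ler_wpM2l ?lerDl// ltW ?bcoef_gt0.
  apply: (@le_trans _ _ (bcoef a n./2 * f (n - i)%N)).
    rewrite ler_wpM2r// (le_trans (resolvent_le _ c'0 rg))//.
    apply: bcoef_nonincr => //.
    move: ni; rewrite ltn_subLR// => ni.
    rewrite -(leq_add2r n./2); apply: leq_trans (ltnW ni).
    by rewrite addnn halfK leq_subr.
  by rewrite ler_wpM2l ?lerDr// ltW ?bcoef_gt0.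
rewrite -mulr_sumr ler_wpM2l//; first by rewrite ltW ?bcoef_gt0.
rewrite big_split/= addrC lerD//; last exact: (resolvent_sum_le _ c'0 rg).
have -> : \sum_(i < n.+1) f (n - i)%N = \sum_(i < n.+1) f i.
  have := cauchyC (fun=> 1) f n; rewrite /cauchy.
  by under eq_bigr do rewrite mul1r; under [RHS]eq_bigr do rewrite mulr1.
exact: (resolvent_sum_le _ c0 rf).
Qed.

End discrete_resolvent.

Section series_tools.
Context {R : realType}.

Lemma dominated_series_cvg (u M : nat -> R) : (forall j, `|u j| <= M j) ->
  cvgn (series M) -> cvgn (series u).
Proof.
move=> uM cM; apply: normed_cvg; apply: (series_le_cvg _ _ _ cM) => n //=.
exact: le_trans (normr_ge0 _) (uM n).
Qed.

Lemma series_tail_le (u M : nat -> R) J : (forall j, `|u j| <= M j) ->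
  cvgn (series M) -> `|limn (series u) - series u J| <= limn (series M) - series M J.
Proof.
move=> uM cM; have cu := dominated_series_cvg uM cM.
have cvgL : `|series u n - series u J| @[n --> \oo] --> `|limn (series u) - series u J|.
  by apply: cvg_norm; apply: cvgB => //; exact: cvg_cst.
have cvgR : series M n - series M J @[n --> \oo] --> limn (series M) - series M J.
  by apply: cvgB => //; exact: cvg_cst.
apply: (ler_cvg_to cvgL cvgR); near=> n.
have Jn : (J <= n)%N by near: n; exact: nbhs_infty_ge.
rewrite !sub_series_geq//; apply: (le_trans (ler_norm_sum _ _ _)).
by apply: ler_sum.
Unshelve. all: by end_near. Qed.

Lemma cvg_fin_sum n (F : nat -> nat -> R) (l : nat -> R) :
  (forall j, F m j @[m --> \oo] --> l j) ->
  \sum_(j < n) F m j @[m --> \oo] --> \sum_(j < n) l j.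
Proof.
move=> Fl; elim: n => [|n IH].
  rewrite big_ord0; under eq_fun do rewrite big_ord0; exact: cvg_cst.
rewrite big_ord_recr/=; under eq_fun do rewrite big_ord_recr/=.
exact: cvgD.
Qed.

(** Dominated convergence for series. *)
Lemma tannery (g : nat -> nat -> R) (l M : nat -> R) (n0 : nat) :
  (forall j, g n j @[n --> \oo] --> l j) ->
  (forall n j, (n0 <= n)%N -> `|g n j| <= M j) -> cvgn (series M) ->
  limn (series (g n)) @[n --> \oo] --> limn (series l).
Proof.
move=> gl gM cM.
have lM j : `|l j| <= M j.
  apply: (ler_cvg_to (cvg_norm (gl j)) (cvg_cst (M j))).
  by near=> n; apply: gM; near: n; exact: nbhs_infty_ge.
apply/cvgrPdist_le => e e0.
have e4 : 0 < e / 3 by rewrite divr_gt0.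
have /cvgrPdist_le /(_ _ e4) [J _ /(_ J (leqnn J))/= MJ] := cM.
have {}MJ : limn (series M) - series M J <= e / 3 by apply: le_trans MJ; exact: ler_norm.
have cJ : series (g n) J @[n --> \oo] --> series l J.
  rewrite /series/= big_mkord; under eq_fun do rewrite big_mkord.
  exact: cvg_fin_sum.
near=> n.
have nn0 : (n0 <= n)%N by near: n; exact: nbhs_infty_ge.
have h1 := series_tail_le J lM cM.
have h2 := series_tail_le J (fun j => gM n j nn0) cM.
have h3 : `|series l J - series (g n) J| <= e / 3.
  by near: n; exact: cvgr_dist_le cJ _ e4.
have -> : limn (series l) - limn (series (g n)) =
  (limn (series l) - series l J) + (series l J - series (g n) J)
  - (limn (series (g n)) - series (g n) J) by ring.
apply: (le_trans (ler_normB _ _)).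
have := ler_normD (limn (series l) - series l J) (series l J - series (g n) J).
lra.
Unshelve. all: by end_near. Qed.

End series_tools.

Section mittag_leffler_bound.
Context {R : realType}.
Variable a : R.
Hypotheses (a0 : 0 < a) (a1 : a < 1).
Implicit Types (b c x y : R) (n j : nat).

(* disc c n is the coefficient of z^n in the sum over j of (-c)^j (1-z)^(-a(j+1)),
   that is, in 1 / ((1-z)^a + c). *)
Let term c n j : R := (- c) ^+ j * bcoef (a * j.+1%:R) n.

Let disc c n : R := limn (series (term c n)).

Let term_dom c n : 0 < c < 1 -> exists M : nat -> R,
  (forall j, `|term c n j| <= M j) /\ cvgn (series M).
Proof.
(* k is halfway between 1 and 1/c, so that k > 1 and c k < 1. *)
move=> /andP[c0 c1]; pose k := (1 + c^-1) / 2.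
have k1 : 1 < k.
  have : 1 < c^-1 by rewrite invf_gt1.
  rewrite /k; lra.
have [C C0 hC] := bcoef_geometric n a0 k1.
exists (geometric (C * k) (c * k)); split.
  move=> j; rewrite /term normrM normrX normrN (gtr0_norm c0).
  have /andP[b0 bC] := hC j.+1; rewrite (ger0_norm b0).
  rewrite /geometric/= exprMn.
  apply: (@le_trans _ _ (c ^+ j * (C * k ^+ j.+1))).
    by rewrite ler_wpM2l// exprn_ge0// ltW.
  by rewrite exprS; apply: eq_ler; ring.
apply: is_cvg_geometric_series.
have ck : c * k = (c + 1) / 2 by rewrite /k; field; rewrite gt_eqF.
rewrite ck gtr0_norm; lra.
Qed.

Let term_cvg c n : 0 < c < 1 -> cvgn (series (term c n)).
Proof.
by move=> c01; have [M [tM cM]] := term_dom n c01; exact: dominated_series_cvg cM.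
Qed.

Let disc_resolvent c : 0 < c < 1 -> resolvent a c (disc c).
Proof.
move=> c01 n.
have step J : cauchy (bcoef (- a)) (fun m => series (term c m) J.+1) n =
    (n == 0%N)%:R - c * series (term c n) J.
  rewrite /cauchy /series/= big_mkord.
  under eq_bigr do rewrite big_mkord mulr_sumr.
  rewrite exchange_big/=.
  transitivity (\sum_(j < J.+1) (- c) ^+ j * bcoef (a * j%:R) n).
    apply: eq_bigr => j _.
    have -> : a * j%:R = - a + a * j.+1%:R by rewrite -natr1; ring.
    rewrite -cauchy_bcoef /cauchy mulr_sumr; apply: eq_bigr => i _.
    by rewrite /term mulrCA.
  rewrite big_ord_recl/= mulr0 bcoef_delta expr0 mul1r; congr (_ + _).
  rewrite -mulNr mulr_sumr; apply: eq_bigr => j _.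
  by rewrite /term /bump/= add1n exprS mulrA.
have cvg1 : cauchy (bcoef (- a)) (fun m => series (term c m) J.+1) n @[J --> \oo] -->
    cauchy (bcoef (- a)) (disc c) n.
  apply: (@cvg_fin_sum _ n.+1 (fun J i => bcoef (- a) i * series (term c (n - i)%N) J.+1)
     (fun i => bcoef (- a) i * disc c (n - i)%N)) => i.
  apply: cvgMr.
  by have := @term_cvg c (n - i)%N c01; rewrite -cvg_shiftS.
have cvg2 : (n == 0%N)%:R - c * series (term c n) J @[J --> \oo] -->
    (n == 0%N)%:R - c * disc c n.
  by apply: cvgB; [exact: cvg_cst|apply: cvgMr; exact: term_cvg].
rewrite (_ : (fun J => cauchy _ _ n) =
  (fun J => (n == 0%N)%:R - c * series (term c n) J)) in cvg1; last exact/funext.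
exact: (cvg_unique _ cvg1 cvg2).
Qed.

Let Gamma_add n b : 0 < b -> Gamma (n%:R + b : R) = bcoef b n * n`!%:R * Gamma b.
Proof.
move=> b0; elim: n => [|n IH]; first by rewrite add0r bcoef0 fact0 !mul1r.
have nb0 : 0 < n%:R + b by rewrite ltr_wpDl.
have -> : n.+1%:R + b = (n%:R + b) + 1 by rewrite -natr1 addrAC.
rewrite (GammaS nb0) IH factS natrM.
have := bcoefS b n; move: (bcoef b n.+1) (bcoef b n) => B' B h.
transitivity ((n.+1%:R * B') * n`!%:R * Gamma b).
  rewrite h; ring.
by move: (n.+1%:R) => m; ring.
Qed.

Let GammaSn n : Gamma (n%:R + 1 : R) = n`!%:R.
Proof.
rewrite Gamma_add// Gamma1 mulr1 (_ : bcoef 1 n = 1) ?mul1r//.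
apply/esym/(bcoef_uniq (f := fun=> 1)) => // k.
by rewrite !mulr1 addrC natr1.
Qed.

(* Rn n b -> 1 means that bcoef b n is asymptotic to n^(b-1) / Gamma b.  For b <= 1
   the two Wendel inequalities frame Rn n b between n / (n + b) and 1; the general
   case follows by b -> b + 1.  The domination needed below is Rn_le2. *)
Let Rn n b : R := n%:R `^ (1 - b) * (bcoef b n * Gamma b).

Let fact_neq0 n : n`!%:R != 0 :> R.
Proof. by rewrite pnatr_eq0 -lt0n fact_gt0. Qed.

Let bcoefG n b : 0 < b -> bcoef b n * Gamma b = Gamma (n%:R + b : R) / n`!%:R.
Proof. by move=> b0; rewrite Gamma_add// mulrAC mulfK. Qed.

Let Rn_ge0 n b : 0 < b -> 0 <= Rn n b.
Proof.
move=> b0; apply: mulr_ge0; first exact: powR_ge0.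
by apply: mulr_ge0; [exact/ltW/bcoef_gt0|exact/ltW/Gamma_gt0].
Qed.

Let Rn_le1 n b : (0 < n)%N -> 0 < b <= 1 -> Rn n b <= 1.
Proof.
move=> n0 /andP[b0 b1]; have n0R : 0 < n%:R :> R by rewrite ltr0n.
have b01 : 0 <= b <= 1 by rewrite ltW.
rewrite /Rn bcoefG// mulrA ler_pdivrMr ?ltr0n ?fact_gt0// mul1r.
have := Gamma_Wendel n0R b01.
rewrite -(ler_pM2l (powR_gt0 (1 - b) n0R)) => /le_trans; apply.
rewrite mulrA -powRD_gt0// subrK (powRr1 (ltW n0R)).
by rewrite -(GammaS n0R) GammaSn.
Qed.

Let Rn_ge n b : (0 < n)%N -> 0 < b <= 1 -> n%:R / (n%:R + b) <= Rn n b.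
Proof.
move=> n0 /andP[b0 b1]; have n0R : 0 < n%:R :> R by rewrite ltr0n.
have nb0 : 0 < n%:R + b by rewrite addr_gt0.
have b01 : 0 <= 1 - b <= 1 by apply/andP; split; lra.
have := Gamma_Wendel nb0 b01.
rewrite (_ : n%:R + b + (1 - b) = n%:R + 1); last by ring.
rewrite GammaSn -{1}(mul1r n`!%:R) -ler_pdivlMr ?ltr0n ?fact_gt0//.
rewrite -mulrA -bcoefG// => h.
have q1 : n%:R / (n%:R + b) <= (n%:R / (n%:R + b)) `^ (1 - b).
  apply: ger1_powR; last by lra.
  by rewrite divr_gt0//= ler_pdivrMr// mul1r lerDl ltW.
have inb0 : 0 <= (n%:R + b)^-1 by rewrite invr_ge0 ltW.
apply: (le_trans q1); rewrite /Rn (powRM _ (ltW n0R) inb0).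
rewrite ler_wpM2l ?powR_ge0// -[leLHS]mulr1.
have -> : (n%:R + b)^-1 `^ (1 - b) = ((n%:R + b) `^ (1 - b))^-1.
  by rewrite -powR_inv1 ?(ltW nb0)// -powRrM mulN1r powRN.
by rewrite ler_pdivrMl// powR_gt0.
Qed.

Let RnS n b : (0 < n)%N -> 0 < b -> Rn n (b + 1) = Rn n b * ((n%:R + b) / n%:R).
Proof.
move=> n0 b0; have n0R : 0 < n%:R :> R by rewrite ltr0n.
have nb0 : 0 < n%:R + b by rewrite addr_gt0.
rewrite /Rn !bcoefG ?addr_gt0//.
have -> : n%:R + (b + 1) = (n%:R + b) + 1 by rewrite addrA.
rewrite (GammaS nb0).
have -> : n%:R `^ (1 - b) = n%:R `^ (1 - (b + 1)) * n%:R.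
  rewrite -[X in _ * X]powRr1 ?ltW// -powRD_gt0//.
  by congr powR; ring.
have n0' : n%:R != 0 :> R by rewrite gt_eqF.
move: (fact_neq0 n) n0' => h1 h2; field; rewrite h1 h2//.
Qed.

Let Rn_cvg b : 0 < b -> Rn n b @[n --> \oo] --> (1 : R).
Proof.
have cvgq c : 0 < c -> (n%:R + c) / n%:R @[n --> \oo] --> (1 : R).
  move=> c0; have h : 1 + c * n%:R^-1 @[n --> \oo] --> 1 + c * 0.
    apply: cvgD; first exact: cvg_cst.
    by apply: cvgMr; rewrite -cvg_shiftS; exact: cvg_harmonic.
  rewrite mulr0 addr0 in h; move: h; apply: cvg_trans; apply: near_eq_cvg.
  near=> n; rewrite mulrDl divff//.
  by rewrite pnatr_eq0 -lt0n; near: n; exact: nbhs_infty_gt.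
move=> b0; have [m [c [c0 c1 ->]]] := floor_decomp b0.
elim: m => [|m IH].
  rewrite addr0.
  apply: (squeeze_cvgr (f := fun n => ((n%:R + c) / n%:R)^-1) (h := cst 1)).
  - near=> n; have n0 : (0 < n)%N by near: n; exact: nbhs_infty_gt.
    by rewrite invf_div Rn_ge ?Rn_le1 ?c0.
  - by rewrite -[X in _ --> X]invr1; apply: cvgV => //; exact: cvgq.
  - exact: cvg_cst.
have cm0 : 0 < c + m%:R by rewrite ltr_wpDr.
have h : Rn n (c + m%:R) * ((n%:R + (c + m%:R)) / n%:R) @[n --> \oo] --> (1 * 1 : R).
  by apply: cvgM => //; exact: cvgq.
rewrite mulr1 in h; move: h; apply: cvg_trans; apply: near_eq_cvg.
near=> n; have n0 : (0 < n)%N by near: n; exact: nbhs_infty_gt.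
have -> : c + m.+1%:R = c + m%:R + 1 by rewrite -natr1 addrA.
by rewrite RnS.
Unshelve. all: by end_near. Qed.

(* With z = (l+1)/l, the ratio of consecutive values is (1 + b (z-1)) / z^b, at most 1
   by Bernoulli's inequality for the exponent b >= 1. *)
Let Rn_nonincr n m b : (0 < m)%N -> (m <= n)%N -> 1 <= b -> Rn n b <= Rn m b.
Proof.
move=> m0 mn b1; have b0 : 0 < b by exact: lt_le_trans b1.
rewrite -(subnK mn); elim: (n - m)%N => [|k IH]; first by rewrite add0n.
apply: le_trans IH; rewrite addSn; set l := (k + m)%N.
have l0 : (0 < l)%N by rewrite /l addn_gt0 m0 orbT.
have l0R : 0 < l%:R :> R by rewrite ltr0n.
have lS0R : 0 < l.+1%:R :> R by rewrite ltr0n.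
pose z : R := l.+1%:R / l%:R.
have z0 : 0 < z by rewrite divr_gt0.
have zb : 1 + b * (z - 1) <= z `^ b.
  have bi : 0 <= b^-1 <= 1 by rewrite invr_ge0 ltW//= invf_le1.
  have w0 : 0 < 1 + b * (z - 1).
    have : 0 <= b * (z - 1).
      apply: mulr_ge0; first exact: ltW.
      by rewrite subr_ge0 ler_pdivlMr// mul1r ler_nat.
    lra.
  have := powR_le_affine bi w0.
  have -> : 1 + b^-1 * (1 + b * (z - 1) - 1) = z by field; rewrite gt_eqF.
  move=> h.
  have := @ge0_ler_powR _ b (ltW b0) _ _ (powR_ge0 _ _) (ltW z0) h.
  by rewrite -powRrM mulVf ?gt_eqF// (powRr1 (ltW w0)).
have zE : l.+1%:R = z * l%:R :> R by rewrite divfK// gt_eqF.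
have bE : l.+1%:R * bcoef b l.+1 = (b + l%:R) * bcoef b l by exact: bcoefS.
rewrite /Rn !mulrA ler_pM2r ?Gamma_gt0//.
rewrite -(ler_pM2l lS0R) mulrCA bE.
have PE : l.+1%:R `^ (1 - b) = z / z `^ b * l%:R `^ (1 - b).
  rewrite {1}zE (powRM _ (ltW z0) (ltW l0R)) powRB ?(gt_eqF z0) ?implybT//.
  by rewrite (powRr1 (ltW z0)).
have zb0 : 0 < z `^ b by exact: powR_gt0.
have hX : b + l%:R <= l%:R * z `^ b.
  have : l%:R * (1 + b * (z - 1)) <= l%:R * z `^ b by rewrite ler_pM2l.
  congr (_ <= _); rewrite mulrDr mulr1 addrC; congr (_ + _).
  have lz : l%:R * z = l%:R + 1 by rewrite mulrC -zE natr1.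
  by rewrite mulrCA mulrBr lz mulr1 addrAC subrr add0r mulr1.
have B0 : 0 < bcoef b l by exact: bcoef_gt0.
have L0 : 0 < l%:R `^ (1 - b) :> R by exact: powR_gt0.
rewrite PE; move: hX; rewrite {1}zE => hX.
apply: (@le_trans _ _ (z / z `^ b * l%:R `^ (1 - b) * ((l%:R * z `^ b) * bcoef b l))).
  by rewrite ler_pM2l ?mulr_gt0 ?invr_gt0// ler_pM2r.
apply: eq_ler; field; rewrite gt_eqF//.
Qed.

Let Rn_le2 n m b : (0 < m)%N -> (m <= n)%N -> 0 < b -> Rn n b <= 2 * Rn m b.
Proof.
move=> m0 mn b0; have [b1|b1] := leP 1 b.
  by apply: (le_trans (Rn_nonincr m0 mn b1)); rewrite ler_peMl ?Rn_ge0// ler1n.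
have b01 : 0 < b <= 1 by rewrite b0 ltW.
apply: (le_trans (Rn_le1 (leq_trans m0 mn) b01)).
have h := Rn_ge m0 b01.
have m1 : 1 <= m%:R :> R by rewrite ler1n.
have : 2^-1 <= m%:R / (m%:R + b).
  by rewrite ler_pdivlMr ?ler_pdivrMl; lra.
lra.
Qed.

(* n^(1-a) times the j-th term of disc at c = x n^(-a), in a form that shows its
   convergence to the j-th term of the Mittag-Leffler series. *)
Let gml x n j : R := (- x) ^+ j / Gamma (a * j.+1%:R) * Rn n (a * j.+1%:R).

Let ab0 j : 0 < a * j.+1%:R. Proof. by rewrite mulr_gt0. Qed.

Let gmlE x n j : (0 < n)%N ->
  gml x n j = n%:R `^ (1 - a) * term (x * n%:R `^ (- a)) n j.
Proof.
move=> n0; have n0R : 0 < n%:R :> R by rewrite ltr0n.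
have PE : (n%:R `^ (- a)) ^+ j = n%:R `^ (- a * j%:R) :> R.
  by rewrite -powR_mulrn ?powR_ge0// -powRrM.
rewrite /gml /Rn /term -(mulNr x) exprMn PE.
have -> : n%:R `^ (1 - a * j.+1%:R) = n%:R `^ (1 - a) * n%:R `^ (- a * j%:R).
  by rewrite -powRD_gt0//; congr powR; rewrite -natr1; ring.
have := Gamma_gt0 (ab0 j) => /gt_eqF/negbT; move: (Gamma _) => Ga Ga0.
by field.
Qed.

Let cn01 x n : 0 < x -> x < n%:R `^ a -> (0 < n)%N -> 0 < x * n%:R `^ (- a) < 1.
Proof.
move=> x0 xn n0; have na0 : 0 < n%:R `^ a :> R by rewrite powR_gt0// ltr0n.
by rewrite powRN divr_gt0//= ltr_pdivrMr// mul1r.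
Qed.

Let near_lt x : 0 < x -> \forall n \near \oo, x < n%:R `^ a.
Proof.
move=> x0; pose k := Num.bound (x `^ a^-1).
have kx : x `^ a^-1 < k%:R by apply: archi_boundP; exact: powR_ge0.
exists k => // n /= kn.
have -> : x = (x `^ a^-1) `^ a by rewrite -powRrM mulVf ?gt_eqF// (powRr1 (ltW x0)).
rewrite gt0_ltr_powR ?nnegrE ?powR_ge0//.
by apply: (lt_le_trans kx); rewrite ler_nat.
Qed.

Let disc_cvg x : 0 < x ->
  n%:R `^ (1 - a) * disc (x * n%:R `^ (- a)) n @[n --> \oo] --> mittag_leffler a a (- x).
Proof.
move=> x0.
have [k _ kx] := near_lt x0.
pose n0 := maxn k 1.
have n00 : (0 < n0)%N by rewrite leq_max orbT.
have n0x n : (n0 <= n)%N -> x < n%:R `^ a.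
  by move=> n0n; apply: kx; exact: leq_trans (leq_maxl _ _) n0n.
(* By Rn_le2 the terms of rank n >= n0 are at most twice those of rank n0, which form
   an absolutely convergent series. *)
have [M [tM cM]] := term_dom n0 (cn01 x0 (n0x _ (leqnn _)) n00).
have gl j : gml x n j @[n --> \oo] --> (- x) ^+ j / Gamma (a * j%:R + a).
  have -> : a * j%:R + a = a * j.+1%:R by rewrite -natr1; ring.
  rewrite -[X in _ --> X]mulr1; apply: cvgMr; exact: Rn_cvg.
have gM n j : (n0 <= n)%N -> `|gml x n j| <= 2 * n0%:R `^ (1 - a) * M j.
  move=> n0n; apply: (@le_trans _ _ (2 * `|gml x n0 j|)).
    have E m : `|gml x m j| = `|(- x) ^+ j / Gamma (a * j.+1%:R)| * Rn m (a * j.+1%:R).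
      by rewrite [LHS]normrM (ger0_norm (Rn_ge0 _ (ab0 j))).
    by rewrite !E [leRHS]mulrCA ler_wpM2l// Rn_le2.
  rewrite gmlE// normrM (ger0_norm (powR_ge0 _ _)) -mulrA ler_pM2l//.
  by rewrite ler_wpM2l ?powR_ge0.
have cM2 : cvgn (series (fun j => 2 * n0%:R `^ (1 - a) * M j)).
  exact: (is_cvg_seriesZ (k := 2 * n0%:R `^ (1 - a)) cM).
have := tannery gl gM cM2; apply: cvg_trans; apply: near_eq_cvg.
near=> n; have n0n : (n0 <= n)%N by near: n; exact: nbhs_infty_ge.
have n0' : (0 < n)%N by exact: leq_trans n0n.
have -> : gml x n = (n%:R `^ (1 - a)) *: term (x * n%:R `^ (- a)) n.
  by apply/funext => j; rewrite gmlE.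
rewrite lim_seriesZ//; apply: term_cvg; exact: cn01 (n0x _ n0n) n0'.
Unshelve. all: by end_near. Qed.

Let disc_ok x n := [/\ (0 < n)%N, 0 < x * n%:R `^ (- a) &
  resolvent a (x * n%:R `^ (- a)) (disc (x * n%:R `^ (- a)))].

Let near_resolvent x : 0 < x -> \forall n \near \oo, disc_ok x n.
Proof.
move=> x0; near=> n.
have n0 : (0 < n)%N by near: n; exact: nbhs_infty_gt.
have xn : x < n%:R `^ a by near: n; exact: near_lt.
have c01 := cn01 x0 xn n0.
by split; [|by case/andP: c01|exact: disc_resolvent].
Unshelve. all: by end_near. Qed.

(** The limit of 0 <= f n <= bcoef a n, multiplied by n^(1-a). *)
Lemma mittag_leffler_bounded x : 0 < x ->
  0 <= mittag_leffler a a (- x) <= (Gamma a)^-1.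
Proof.
move=> x0; have cv := disc_cvg x0; apply/andP; split.
  apply: (ler_cvg_to (cvg_cst 0) cv); near=> n.
  have [n0 c0 rf] : disc_ok x n by near: n; exact: near_resolvent.
  by apply: mulr_ge0; [exact: powR_ge0|exact: (resolvent_ge0 a0 (ltW a1) n c0 rf)].
apply: (ler_cvg_to cv (cvg_cst (Gamma a)^-1)); near=> n.
have [n0 c0 rf] : disc_ok x n by near: n; exact: near_resolvent.
apply: (@le_trans _ _ (n%:R `^ (1 - a) * bcoef a n)).
  by rewrite ler_wpM2l ?powR_ge0// (resolvent_le a0 (ltW a1) n c0 rf).
rewrite -[leRHS]mul1r ler_pdivlMr ?Gamma_gt0// -mulrA.
by apply: Rn_le1 => //; rewrite a0 ltW.
Unshelve. all: by end_near. Qed.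

(** The limit of the resolvent identity.  The constant 6 is 3 times 2: n is at most
    3 n./2, which compares n^(1-a) with n./2^(1-a), and 1/c + 1/c' is at most 2/c. *)
Lemma mittag_leffler_log_lipschitz x y : 0 < x -> x < y ->
  `|mittag_leffler a a (- x) - mittag_leffler a a (- y)| <=
  6 / Gamma a * ((y - x) / x).
Proof.
move=> x0 xy; have y0 : 0 < y by exact: lt_trans xy.
have cv : `|n%:R `^ (1 - a) * disc (x * n%:R `^ (- a)) n -
    n%:R `^ (1 - a) * disc (y * n%:R `^ (- a)) n| @[n --> \oo] -->
    `|mittag_leffler a a (- x) - mittag_leffler a a (- y)|.
  by apply: cvg_norm; exact: cvgB (disc_cvg x0) (disc_cvg y0).
apply: (ler_cvg_to cv (cvg_cst _)); near=> n.
have [n0 c0 rf] : disc_ok x n by near: n; exact: near_resolvent.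
have [_ c'0 rg] : disc_ok y n by near: n; exact: near_resolvent.
have n1 : (1 < n)%N by near: n; exact: nbhs_infty_gt.
have m0 : (0 < n./2)%N by rewrite half_gt0.
have m0R : 0 < n./2%:R :> R by rewrite ltr0n.
have n3m : n%:R <= 3 * n./2%:R :> R.
  rewrite -natrM ler_nat -{1}(odd_double_half n) mulSn mul2n leq_add2r.
  by apply: leq_trans m0; exact: leq_b1.
set f := disc _; set g := disc _.
rewrite /= -mulrBr normrM (ger0_norm (powR_ge0 _ _)).
rewrite (resolvent_identity n rf rg) normrM.
set c := x * _; set c' := y * _.
have na0 : 0 < n%:R `^ (- a) :> R by rewrite powR_gt0// ltr0n.
have cc' : c < c' by rewrite ltr_pM2r.
have cau0 : 0 <= cauchy g f n.
  apply: sumr_ge0 => i _; apply: mulr_ge0.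
    exact: (resolvent_ge0 a0 (ltW a1) i c'0 rg).
  exact: (resolvent_ge0 a0 (ltW a1) (n - i)%N c0 rf).
rewrite (ger0_norm cau0) gtr0_norm ?subr_gt0//.
have cau := cauchy_resolvent_le a0 (ltW a1) n c0 c'0 rf rg.
have c'c : c'^-1 <= c^-1 by rewrite lef_pV2 ?posrE// ltW.
set B := bcoef a n./2 in cau.
have B0 : 0 < B by exact: bcoef_gt0.
have nB : n%:R `^ (1 - a) * B <= 3 / Gamma a.
  apply: (@le_trans _ _ (3 * (n./2%:R `^ (1 - a) * B))).
    rewrite mulrA ler_wpM2r ?(ltW B0)//.
    have a1' : 0 <= 1 - a by rewrite subr_ge0 ltW.
    have := ge0_ler_powR a1' (ler0n _ n) (mulr_ge0 (ler0n _ 3) (ltW m0R)) n3m.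
    move=> /le_trans; apply; rewrite (powRM _ (ler0n _ 3) (ltW m0R)).
    rewrite ler_wpM2r ?powR_ge0//.
    by apply: ler1_powR; [rewrite ler1n|rewrite gerBl ltW].
  rewrite ler_pM2l// -[leRHS]mul1r ler_pdivlMr ?Gamma_gt0// -mulrA.
  by apply: Rn_le1 => //; rewrite a0 ltW.
have ratio : (c' - c) / c = (y - x) / x.
  by rewrite /c /c'; field; rewrite !gt_eqF.
rewrite -ratio.
apply: (@le_trans _ _ (n%:R `^ (1 - a) * ((c' - c) * (B * (2 * c^-1))))).
  rewrite ler_wpM2l ?powR_ge0// ler_wpM2l ?subr_ge0 ?(ltW cc')//.
  apply: (le_trans cau); rewrite ler_pM2l//.
  by rewrite mulr_natl mulr2n lerD2l.
have -> : n%:R `^ (1 - a) * ((c' - c) * (B * (2 * c^-1))) =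
  (n%:R `^ (1 - a) * B) * (2 * ((c' - c) / c)) by ring.
have q0 : 0 <= 2 * ((c' - c) / c).
  by rewrite mulr_ge0// divr_ge0 ?subr_ge0 ?(ltW cc')// ltW.
apply: (le_trans (ler_wpM2r q0 nB)).
apply: eq_ler; ring.
Unshelve. all: by end_near. Qed.

End mittag_leffler_bound.

(** * The relaxation kernel *)
Section relaxation_kernel.
Context {R : realType}.
Variable a : R.
Hypotheses (a0 : 0 < a) (a1 : a < 1).
Implicit Types l r t : R.

(** The multiplier of S_0(r), with l standing for lam_k^beta. *)
Definition relax l r : R := r `^ (a - 1) * mittag_leffler a a (- (l * r `^ a)).

Lemma relax_le l r : 0 < l -> 0 < r -> `|relax l r| <= (Gamma a)^-1 * r `^ (a - 1).
Proof.
move=> l0 r0; have x0 : 0 < l * r `^ a by rewrite mulr_gt0// powR_gt0.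
have /andP[h1 h2] := mittag_leffler_bounded a0 a1 x0.
by rewrite normrM (ger0_norm (powR_ge0 _ _)) (ger0_norm h1) mulrC ler_wpM2r ?powR_ge0.
Qed.

Let powRm1 r : 0 < r -> r `^ (a - 1) = r `^ a / r.
Proof. by move=> r0; rewrite powRB ?(gt_eqF r0) ?implybT// (powRr1 (ltW r0)). Qed.

Let powRa_le r1 r2 : 0 < r1 -> r1 < r2 -> (r2 `^ a - r1 `^ a) / r1 `^ a <= (r2 - r1) / r1.
Proof.
move=> r10 r12; have r20 : 0 < r2 by exact: lt_trans r12.
have a01 : 0 <= a <= 1 by rewrite !ltW.
have := powR_le_affine a01 (divr_gt0 r20 r10).
have r1i : 0 <= r1^-1 by rewrite invr_ge0 ltW.
rewrite (powRM _ (ltW r20) r1i).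
have -> : r1^-1 `^ a = (r1 `^ a)^-1.
  by rewrite -powR_inv1 ?(ltW r10)// -powRrM mulN1r powRN.
have ra0 : 0 < r1 `^ a by exact: powR_gt0.
have -> : (r2 `^ a - r1 `^ a) / r1 `^ a = r2 `^ a / r1 `^ a - 1.
  by rewrite mulrBl divff ?gt_eqF.
have -> : (r2 - r1) / r1 = r2 / r1 - 1 by rewrite mulrBl divff ?gt_eqF.
have : 0 < r2 / r1 - 1 by rewrite subr_gt0 ltr_pdivlMr// mul1r.
move: (r2 / r1) (_ / _ `^ _) => q X q0 h; nra.
Qed.

Lemma powR_subr1_nonincr r1 r2 : 0 < r1 -> r1 < r2 -> r2 `^ (a - 1) <= r1 `^ (a - 1).
Proof.
move=> r10 r12; have r20 : 0 < r2 by exact: lt_trans r12.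
rewrite -(opprB 1 a) !powRN lef_pV2 ?posrE ?powR_gt0//.
by apply: ge0_ler_powR; rewrite ?nnegrE ?subr_ge0 ltW.
Qed.

Let powRm1_sub r1 r2 : 0 < r1 -> r1 < r2 ->
  r1 `^ (a - 1) - r2 `^ (a - 1) <= r1 `^ (a - 1) * ((r2 - r1) / r1).
Proof.
move=> r10 r12; have r20 : 0 < r2 by exact: lt_trans r12.
have h : r1 `^ a <= r2 `^ a by apply: ge0_ler_powR; rewrite ?nnegrE ltW.
rewrite !powRm1//; have ra0 : 0 < r1 `^ a by exact: powR_gt0.
have h2 : r1 `^ a / r2 <= r2 `^ a / r2 by rewrite ler_pM2r ?invr_gt0.
have h3 : r1 `^ a / r1 - r1 `^ a / r2 <= r1 `^ a / r1 * ((r2 - r1) / r1).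
  have -> : r1 `^ a / r1 - r1 `^ a / r2 = r1 `^ a / r1 * ((r2 - r1) / r2).
    by field; rewrite !gt_eqF.
  rewrite ler_pM2l ?divr_gt0// ler_pM2l ?subr_gt0// lef_pV2 ?posrE// ltW//.
lra.
Qed.

(** From r1 to r2 the relative variation of r^(a-1) and of l r^a is at most
    (r2 - r1) / r1.  As E is Lipschitz in the logarithm of its argument, l disappears
    from the estimate. *)
Lemma relax_lipschitz l r1 r2 : 0 < l -> 0 < r1 -> r1 < r2 ->
  `|relax l r2 - relax l r1| <= 7 / Gamma a * r1 `^ (a - 1) * ((r2 - r1) / r1).
Proof.
move=> l0 r10 r12; have r20 : 0 < r2 by exact: lt_trans r12.
have x10 : 0 < l * r1 `^ a by rewrite mulr_gt0// powR_gt0.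
have x12 : l * r1 `^ a < l * r2 `^ a.
  by rewrite ltr_pM2l// gt0_ltr_powR ?nnegrE// ltW.
have /andP[h1 h2] := mittag_leffler_bounded a0 a1 x10.
have h3 := mittag_leffler_log_lipschitz a0 a1 x10 x12.
have ratio : (l * r2 `^ a - l * r1 `^ a) / (l * r1 `^ a) = (r2 `^ a - r1 `^ a) / r1 `^ a.
  by field; rewrite !gt_eqF ?powR_gt0.
rewrite ratio in h3.
have h4 := powRa_le r10 r12; have h5 := powR_subr1_nonincr r10 r12.
have h6 := powRm1_sub r10 r12.
have G0 : 0 < (Gamma a)^-1 by rewrite invr_gt0 Gamma_gt0.
have p2 := powR_ge0 r2 (a - 1); have p1 := powR_ge0 r1 (a - 1).
have d0 : 0 <= (r2 - r1) / r1.
  by apply: divr_ge0; rewrite ?subr_ge0; exact: ltW.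
rewrite /relax; set E1 := mittag_leffler a a (- (l * r1 `^ a)) in h1 h2 h3 *.
set E2 := mittag_leffler a a (- (l * r2 `^ a)) in h3 *.
have -> : r2 `^ (a - 1) * E2 - r1 `^ (a - 1) * E1 =
   r2 `^ (a - 1) * (E2 - E1) - (r1 `^ (a - 1) - r2 `^ (a - 1)) * E1 by ring.
apply: (le_trans (ler_normB _ _)); rewrite !normrM (ger0_norm p2) (ger0_norm h1).
rewrite (@ger0_norm _ (r1 `^ (a - 1) - _)) ?subr_ge0// (distrC E2).
set d := (r2 - r1) / r1 in h4 h6 d0 *.
have t1 : r2 `^ (a - 1) * `|E1 - E2| <= r1 `^ (a - 1) * (6 / Gamma a * d).
  apply: ler_pM => //; apply: (le_trans h3).
  by rewrite ler_pM2l// mulr_gt0.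
have t2 : (r1 `^ (a - 1) - r2 `^ (a - 1)) * E1 <= (r1 `^ (a - 1) * d) * (Gamma a)^-1.
  by apply: ler_pM => //; rewrite subr_ge0.
apply: (le_trans (lerD t1 t2)).
apply: eq_ler; ring.
Qed.

(** For r2 - r1 <= r1 this follows from [relax_lipschitz], since q <= q^th for q <= 1;
    otherwise ((r2 - r1)/r1)^th >= 1 and the bound by the sizes suffices. *)
Lemma relax_holder l r1 r2 th : 0 < l -> 0 < r1 -> r1 < r2 -> 0 <= th <= 1 ->
  `|relax l r2 - relax l r1| <=
  7 / Gamma a * (r2 - r1) `^ th * r1 `^ (a - 1 - th).
Proof.
move=> l0 r10 r12 /andP[th0 th1]; have r20 : 0 < r2 by exact: lt_trans r12.
have d0 : 0 < r2 - r1 by rewrite subr_gt0.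
have q0 : 0 < (r2 - r1) / r1 by rewrite divr_gt0.
have G0 : 0 < (Gamma a)^-1 by rewrite invr_gt0 Gamma_gt0.
have -> : 7 / Gamma a * (r2 - r1) `^ th * r1 `^ (a - 1 - th) =
    7 / Gamma a * r1 `^ (a - 1) * ((r2 - r1) / r1) `^ th.
  have r1i : 0 <= r1^-1 by rewrite invr_ge0 ltW.
  rewrite (powRM _ (ltW d0) r1i).
  have -> : r1^-1 `^ th = (r1 `^ th)^-1.
    by rewrite -powR_inv1 ?(ltW r10)// -powRrM mulN1r powRN.
  by rewrite powRB ?(gt_eqF r10) ?implybT//; ring.
have c0 : 0 <= 7 / Gamma a * r1 `^ (a - 1) by rewrite mulr_ge0 ?powR_ge0// mulr_ge0// ltW.
have [q1|q1] := leP ((r2 - r1) / r1) 1.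
  apply: (le_trans (relax_lipschitz l0 r10 r12)).
  by rewrite ler_wpM2l// ger1_powR// q0.
have qth : 1 <= ((r2 - r1) / r1) `^ th.
  by rewrite -(powRr0 ((r2 - r1) / r1)) ler_powR// ltW.
apply: (@le_trans _ _ (7 / Gamma a * r1 `^ (a - 1))); last by rewrite ler_peMr.
apply: (le_trans (ler_normB _ _)).
have h1 := relax_le l0 r10; have h2 := relax_le l0 r20.
have h3 := powR_subr1_nonincr r10 r12; have p1 := powR_ge0 r1 (a - 1).
have : (Gamma a)^-1 * r2 `^ (a - 1) <= (Gamma a)^-1 * r1 `^ (a - 1) by rewrite ler_pM2l.
have : 0 <= (Gamma a)^-1 * r1 `^ (a - 1) by rewrite mulr_ge0// ltW.
rewrite -mulrA; move: h1 h2; move: (_ * r1 `^ _) (_ * r2 `^ _) `|_| `|_| => A B X Y.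
lra.
Qed.

End relaxation_kernel.

(** * Integrals of singular powers *)
Section singular_integrals.
Context {R : realType}.
Local Notation mu := (@lebesgue_measure R).
Implicit Types (a b c s t : R).

Lemma lebesgue_measure_reflect c (A : set R) : measurable A ->
  mu ((fun u => c - u) @^-1` A) = mu A.
Proof.
move=> mA; have m : measurable_fun setT ((fun u => c - u) : R -> measurableTypeR R).
  by apply: measurable_funB.
rewrite -[LHS]/(pushforward mu ((fun u => c - u) : R -> measurableTypeR R) A).
apply/esym; apply: (@lebesgue_measure_unique R
  (pushforward mu ((fun u => c - u) : R -> measurableTypeR R))) => //= _ [[x y]] _ <-.
rewrite /pushforward.
have -> : (fun u => c - u) @^-1` `]x, y] = `[c - y, c - x[%classic.
  apply/seteqP; split => u /=; rewrite !in_itv/= => /andP[h1 h2]; apply/andP; split; lra.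
rewrite !lebesgue_measure_itv/= !lte_fin ltrD2l ltrN2.
by case: ifPn => // xy; rewrite -!EFinD; congr EFin; ring.
Qed.

Lemma measurable_reflect c : measurable_fun setT ((fun u => c - u) : R -> measurableTypeR R).
Proof. by apply: measurable_funB. Qed.

Lemma integral_reflect c a b (f : R -> \bar R) : measurable_fun setT f ->
  (forall x, 0 <= f x)%E ->
  (\int[mu]_(u in `](c - b)%R, (c - a)%R[) f (c - u)%R = \int[mu]_(u in `]a, b[) f u)%E.
Proof.
move=> mf f0.
have -> : `](c - b), (c - a)[%classic =
    ((fun u => c - u) : R -> measurableTypeR R) @^-1` `]a, b[%classic.
  apply/seteqP; split => u /=; rewrite !in_itv/= => /andP[h1 h2]; apply/andP; split; lra.
rewrite -[LHS]/(\int[mu]_(u in ((fun u => c - u)%R : R -> measurableTypeR R) @^-1` `]a, b[)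
  (f \o ((fun u => c - u)%R : R -> measurableTypeR R)) u)%E.
rewrite -ge0_integral_pushforward//; last 2 first.
- exact: measurable_reflect.
- exact: measurable_funTS.
apply: eq_measure_integral => [|mphi A mA _]; first exact: measurable_reflect.
exact: (lebesgue_measure_reflect c mA).
Qed.

Let mpow (a : R) : measurable_fun setT (fun u : R => (u `^ a)%:E).
Proof. by apply/measurable_EFinP; exact: measurable_powR. Qed.

Lemma integral_powR_oo a s : 0 < a -> 0 < s ->
  (\int[mu]_(u in `]0%R, s[) (u `^ (a - 1))%:E = (s `^ a / a)%:E)%E.
Proof.
move=> a0 s0; rewrite -integral_powR_at0//; apply/esym/integral_itv_bndoo.
by apply: measurable_funTS; exact: mpow.
Qed.

Lemma integral_powR_itv a s t : 0 < a -> 0 < s -> s < t ->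
  (\int[mu]_(u in `]s, t[) (u `^ (a - 1))%:E = ((t `^ a - s `^ a) / a)%:E)%E.
Proof.
move=> a0 s0 st; have t0 : 0 < t by exact: lt_trans st.
have := integral_powR_oo a0 t0.
have -> : `]0, t[%classic = `]0, s] `|` `]s, t[ :> set R.
  by rewrite (@itv_bndbnd_setU _ _ _ (BRight s)) ?bnd_simp ?(ltW s0)//.
rewrite ge0_integral_setU//=.
- rewrite integral_powR_at0// => h.
  have /(congr1 (fun x => x - (s `^ a / a)%:E)%E) := h.
  by rewrite addeAC subee// add0e => ->; rewrite -EFinB mulrBl.
- by apply: measurable_funTS; exact: mpow.
- by move=> x _; rewrite lee_fin powR_ge0.
- apply/disj_setPS => x [] /=; rewrite !in_itv/= => /andP[_ xs] /andP[sx _].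
  by move: xs; rewrite leNgt sx.
Qed.

Lemma integral_powR_refl a s t : 0 < a -> s < t ->
  (\int[mu]_(u in `]s, t[) ((t - u) `^ (a - 1))%:E = ((t - s) `^ a / a)%:E)%E.
Proof.
move=> a0 st; have ts0 : 0 < t - s by rewrite subr_gt0.
rewrite -(integral_powR_oo a0 ts0).
rewrite -(@integral_reflect t 0 (t - s) (fun u => (u `^ (a - 1))%:E)).
- by rewrite subKr subr0.
- exact: mpow.
- by move=> x; rewrite lee_fin powR_ge0.
Qed.

Lemma integral_powR_shift a s t : 0 < a -> s < t ->
  (\int[mu]_(u in `]s, t[) ((u - s) `^ (a - 1))%:E = ((t - s) `^ a / a)%:E)%E.
Proof.
move=> a0 st; have ts0 : 0 < t - s by rewrite subr_gt0.
have := integral_powR_refl a0 ts0; rewrite subr0 => <-.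
rewrite -(@integral_reflect t 0 (t - s) (fun u => ((t - s - u) `^ (a - 1))%:E)).
- rewrite subKr subr0; apply: eq_integral => u _; congr (_ `^ _)%:E; ring.
- by apply: (measurableT_comp (mpow (a - 1))); apply: measurable_funB.
- by move=> x; rewrite lee_fin powR_ge0.
Qed.

Lemma integral_piecewise (g1 g2 : measurableTypeR R -> \bar R) s t : 0 < s -> s < t ->
  measurable_fun setT g1 -> measurable_fun setT g2 ->
  (forall u, 0 <= g1 u)%E -> (forall u, 0 <= g2 u)%E ->
  (\int[mu]_(u in `]0%R, t[)
     (if u \in (`]0%R, s[%classic : set (measurableTypeR R)) then g1 u else g2 u) =
   \int[mu]_(u in `]0%R, s[) g1 u + \int[mu]_(u in `]s, t[) g2 u)%E.
Proof.
move=> s0 st m1 m2 g10 g20.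
have mg : measurable_fun setT (fun u =>
    if u \in (`]0%R, s[%classic : set (measurableTypeR R)) then g1 u else g2 u).
  exact: measurable_fun_if_mem.
have -> : `]0, t[%classic = `]0, s[ `|` `[s, t[ :> set (measurableTypeR R).
  by rewrite (@itv_bndbnd_setU _ _ _ (BLeft s)) ?bnd_simp ?(ltW s0)// ltW.
rewrite ge0_integral_setU//; last 3 first.
- exact: measurable_funTS.
- by move=> u _; case: ifPn.
- apply/disj_setPS => x [] /=; rewrite !in_itv/= => /andP[_ xs] /andP[sx _].
  by move: xs; rewrite ltNge sx.
congr (_ + _)%E; first by apply: eq_integral => u ->.
rewrite -integral_itv_obnd_cbnd; last exact: measurable_funTS.
apply: eq_integral => u; rewrite inE/= in_itv/= => /andP[su ut].
by rewrite memNset//= in_itv/= (ltNge u) (ltW su) andbF.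
Qed.

Lemma powR_half_le a s x : 0 < s -> s / 2 <= x -> x <= s -> 0 < a ->
  x `^ (a - 1) <= 2 * s `^ (a - 1).
Proof.
move=> s0 sx xs a0; have s20 : 0 < s / 2 by rewrite divr_gt0.
have x0 : 0 < x by exact: lt_le_trans sx.
have p0 := powR_ge0 s (a - 1).
have [a1|a1] := leP 1 a.
  apply: (@le_trans _ _ (s `^ (a - 1))); last by rewrite ler_peMl// ler1n.
  by apply: ge0_ler_powR; rewrite ?nnegrE ?subr_ge0// ltW.
have b0 : 0 <= 1 - a by rewrite subr_ge0 ltW.
rewrite -(opprB 1 a) !powRN.
apply: (@le_trans _ _ ((s / 2) `^ (1 - a))^-1).
  by rewrite lef_pV2 ?posrE ?powR_gt0//; apply: ge0_ler_powR; rewrite ?nnegrE ?(ltW s20) ?(ltW x0).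
have i2 : 0 <= 2^-1 :> R by rewrite invr_ge0.
rewrite (powRM _ (ltW s0) i2) invfM mulrC ler_wpM2r ?invr_ge0 ?powR_ge0//.
rewrite -powRN.
have -> : 2^-1 `^ (- (1 - a)) = 2 `^ (1 - a) :> R.
  by rewrite -powR_inv1// -powRrM mulrNN mul1r.
by apply: ler1_powR; [rewrite ler1n|rewrite gerBl ltW].
Qed.

(** On each half of ]0, s[ the factor that is regular there is comparable to its value
    at s.  The integral of the left-hand side is thereby bounded by those of powers. *)
Lemma beta_integrand_le a b s u : 0 < a -> 0 < b -> 0 < u -> u < s ->
  (s - u) `^ (a - 1) * u `^ (b - 1) <=
  2 * s `^ (a - 1) * u `^ (b - 1) + 2 * s `^ (b - 1) * (s - u) `^ (a - 1).
Proof.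
move=> a0 b0 u0 us; have s0 : 0 < s by exact: lt_trans us.
have p1 := powR_ge0 s (a - 1); have p2 := powR_ge0 s (b - 1).
have p3 := powR_ge0 u (b - 1); have p4 := powR_ge0 (s - u) (a - 1).
have [h|h] := leP u (s / 2).
  apply: (@le_trans _ _ (2 * s `^ (a - 1) * u `^ (b - 1))); last first.
    by rewrite lerDl mulr_ge0// mulr_ge0.
  by rewrite ler_wpM2r// powR_half_le//; lra.
apply: (@le_trans _ _ (2 * s `^ (b - 1) * (s - u) `^ (a - 1))); last first.
  by rewrite lerDr mulr_ge0// mulr_ge0.
by rewrite mulrC ler_wpM2r// powR_half_le//; lra.
Qed.

End singular_integrals.

(** * Convolution with a singular kernel *)

(** K r is only assumed linear up to N because the values of the solution operator are
    representatives chosen in their classes. *)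
Record singular_kernel (R : realType) (E : lmodType R) (V : set E)
    (N : E -> \bar R) (a C : R) (K : R -> E -> E) : Prop := SingularKernel {
  sk_in : forall r x, 0 < r -> V x -> V (K r x) ;
  sk_D : forall r x y, 0 < r -> V x -> V y -> N (K r (x + y) - (K r x + K r y))%R = 0%E ;
  sk_Z : forall r b x, 0 < r -> V x -> N (K r (b *: x) - b *: K r x)%R = 0%E ;
  sk_le : forall r x, 0 < r -> V x ->
    (N (K r x)%R <= (C * r `^ (a - 1))%:E * N x)%E ;
  sk_holder : forall r1 r2 th x, 0 < r1 -> r1 < r2 -> 0 <= th <= 1 -> V x ->
    (N (K r2 x - K r1 x)%R <=
     (C * (r2 - r1) `^ th * r1 `^ (a - 1 - th))%:E * N x)%E }.

Section singular_kernel_theory.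
Context {R : realType} {E : lmodType R} {V : set E} {N : E -> \bar R}.
Context {a C : R} {K : R -> E -> E}.
Hypothesis SN : seminormed V N.
Hypothesis SK : singular_kernel V N a C K.
Hypotheses (C0 : 0 <= C) (a0 : 0 < a) (a1 : a < 1).

Lemma snN0_trans x y z : V x -> V y -> V z ->
  N (x - y)%R = 0%E -> N (y - z)%R = 0%E -> N (x - z)%R = 0%E.
Proof.
move=> Vx Vy Vz xy yz; apply/eqP; rewrite eq_le (snN_ge0 SN) andbT.
by apply: (le_trans (snN_tri SN Vx Vy Vz)); rewrite xy yz adde0.
Qed.

Lemma sk_B r x y : 0 < r -> V x -> V y -> N (K r (x - y) - (K r x - K r y))%R = 0%E.
Proof.
move=> r0 Vx Vy; have VN : V ((-1) *: y) by exact: (snZ SN).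
have VNy : V (- y) by rewrite -scaleN1r.
have Vk := fun z => @sk_in _ _ _ _ _ _ _ SK r z r0.
have VKy : V ((-1) *: K r y) by apply: (snZ SN); exact: Vk.
apply: (@snN0_trans _ (K r x + K r (- y))).
- by apply: Vk; exact: (snD SN).
- by apply: (snD SN); exact: Vk.
- by apply: (snB SN); exact: Vk.
- exact: (sk_D SK).
- have E3 (p q s : E) : p + q - (p - s) = q + s by rewrite opprB addrC addrA subrK addrC.
  by rewrite E3; have := sk_Z SK (-1) r0 Vy; rewrite !scaleN1r opprK.
Qed.

Lemma sk_sum r n (c : 'I_n -> R) (x : 'I_n -> E) : 0 < r -> (forall i, V (x i)) ->
  N (K r (\sum_i c i *: x i) - \sum_i c i *: K r (x i))%R = 0%E.
Proof.
move=> r0 Vx; have Vk := fun z => @sk_in _ _ _ _ _ _ _ SK r z r0.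
have VS m (y : 'I_m -> E) (b : 'I_m -> R) : (forall i, V (y i)) -> V (\sum_i b i *: y i).
  by move=> Vy; apply: (sn_sum SN) => i _; exact: (snZ SN).
elim: n => [|n IH] in c x Vx *.
  rewrite !big_ord0 subr0; have := sk_Z SK 0 r0 (sn0 SN).
  by rewrite !scale0r subr0.
rewrite !big_ord_recl.
set S := \sum_(i < n) _; set S' := \sum_(i < n) _.
have V1 : V (c ord0 *: x ord0) by exact: (snZ SN).
have V2 : V S by apply: VS.
have V3 : V (c ord0 *: K r (x ord0)) by apply: (snZ SN); exact: Vk.
have V4 : V S' by apply: VS => i; exact: Vk.
apply: (@snN0_trans _ (K r (c ord0 *: x ord0) + K r S)).
- by apply: Vk; exact: (snD SN).
- by apply: (snD SN); exact: Vk.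
- exact: (snD SN).
- exact: (sk_D SK).
- rewrite opprD addrACA; apply/eqP; rewrite eq_le (snN_ge0 SN) andbT.
  have VK1 := Vk _ V1; have VK2 := Vk _ V2.
  apply: (le_trans (snN_D SN (snB SN VK1 V3) (snB SN VK2 V4))).
  by rewrite (sk_Z SK)// IH// adde0.
Qed.

Lemma sk_step_le d (T : measurableType d) (s : step T E) r x t : 0 < r -> V x ->
  simple_step V s -> (N (K r x - step_fun (step_map (K r) s) t)%R <=
    (C * r `^ (a - 1))%:E * N (x - step_fun s t)%R)%E.
Proof.
move=> r0 Vx Vs; have Vst := step_fun_in SN t Vs.
have Vk := fun z => @sk_in _ _ _ _ _ _ _ SK r z r0.
have VM : V (step_fun (step_map (K r) s) t).
  by apply: (step_fun_in SN); apply: simple_step_map => // z; exact: Vk.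
have VB := snB SN Vx Vst; have V2 := snB SN (Vk _ Vx) (Vk _ Vst).
apply: (le_trans (snN_tri SN (Vk _ Vx) (Vk _ Vst) VM)).
rewrite (sk_sum (fun i => \1_(step_set i) t) r0); last by move=> i; have [] := Vs i.
rewrite adde0; apply: (le_trans (snN_le SN V2 (Vk _ VB))).
rewrite [X in (_ + X <= _)%E](snN_subC SN V2 (Vk _ VB)) sk_B// adde0.
exact: (sk_le SK).
Qed.

Let kc r : 0 < r -> 0 <= C * r `^ (a - 1).
Proof. by move=> r0; rewrite mulr_ge0// powR_ge0. Qed.

Local Notation mu := (@lebesgue_measure R).
Local Notation RT := (measurableTypeR R).

Fixpoint step_sum d (T : measurableType d) (n : nat) (s : nat -> step T E) : step T E :=
  if n is m.+1 then step_add (step_sum m s) (s m) else @step0 _ T R E.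

Lemma step_fun_sum d (T : measurableType d) n (s : nat -> step T E) t :
  step_fun (step_sum n s) t = \sum_(k < n) step_fun (s k) t.
Proof.
elim: n => [|n IH] /=; first by rewrite step_fun0 big_ord0.
by rewrite step_fun_add IH big_ord_recr.
Qed.

Lemma simple_step_sum d (T : measurableType d) n (s : nat -> step T E) :
  (forall k, simple_step V (s k)) -> simple_step V (step_sum n s).
Proof.
move=> Vs; elim: n => [|n IH] /=; first by case.
exact: simple_step_add.
Qed.

(** On cells of length t / (n+1) the kernel is frozen at r n k, the right end of the
    cell of t - u, and X is replaced by its n-th step function.  The first change costs
    the length of the cell, by sk_holder with exponent 1; the second is controlled by
    the size of the kernel at t - u. *)
Lemma strongly_measurable_convolution t (X : R -> E) : 0 < t -> 
  strongly_measurable mu V N `]0, t[ X ->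
  strongly_measurable mu V N `]0, t[ (fun u => K (t - u) (X u)).
Proof.
move=> t0 [VX [s [Vs sX]]].
pose r n k : R := k.+1%:R * (t / n.+1%:R).
have tn0 n : 0 < t / n.+1%:R by rewrite divr_gt0.
have r0 n k : 0 < r n k by rewrite mulr_gt0.
pose A n k : set RT := [set u : R | r n k - t / n.+1%:R <= t - u < r n k].
have mA n k : measurable (A n k).
  rewrite (_ : A n k = `]t - r n k, t - (r n k - t / n.+1%:R)]%classic); first by [].
  apply/seteqP; split => u; rewrite /A /= in_itv/=; move: (r n k) (t / _) => x y;
    move=> /andP[h1 h2]; apply/andP; split; lra.
pose h n := @step_sum _ RT n.+1 (fun k => step_restr (A n k) (step_map (K (r n k)) (s n))).
have Vmap n k : simple_step V (step_map (K (r n k)) (s n)).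
  by apply: simple_step_map => // x; exact: (sk_in SK).
have Vh n : simple_step V (h n).
  by apply: simple_step_sum => k; exact: simple_step_restr.
split => [u|].
  rewrite /= in_itv/= => /andP[u0 ut]; apply: (sk_in SK); first by rewrite subr_gt0.
  by apply: VX; rewrite /= in_itv/= u0.
exists h; split => //.
apply: filterS sX => u sX Du; move: (sX Du) => {}sX.
have VXu := VX _ Du.
have /andP[u0 ut] : 0 < u < t by move: Du; rewrite /= in_itv.
pose q := t - u; have q0 : 0 < q by rewrite subr_gt0.
have qt : q < t by rewrite /q; lra.
have cell n : exists2 k, (k < n.+1)%N & A n k u.
  have z0 : 0 <= q / (t / n.+1%:R) by rewrite divr_ge0 ?ltW.
  have /andP[k1 k2] := truncn_itv z0.
  set k := Num.trunc _ in k1 k2; exists k.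
    rewrite -(ltr_nat R); apply: (le_lt_trans k1).
    by rewrite ltr_pdivrMr// mulrCA divff ?mulr1// pnatr_eq0.
  rewrite /A /= -/q; move: k1 k2; rewrite ler_pdivlMr// ltr_pdivrMr// => k1 k2.
  rewrite /r k2 andbT -natr1 mulrDl mul1r addrK//.
have hE n k : (k < n.+1)%N -> A n k u ->
    step_fun (h n) u = step_fun (step_map (K (r n k)) (s n)) u.
  move=> kn Ak; rewrite step_fun_sum (bigD1 (Ordinal kn))//= big1 => [|i ik].
    by rewrite addr0 step_fun_restr indicE mem_set// scale1r.
  rewrite step_fun_restr indicE memNset ?scale0r// => Ai.
  move/eqP : ik; apply; apply/val_inj => /=.
  have := tn0 n; set w := t / n.+1%:R => w0.
  have rE m : r n m = m%:R * w + w by rewrite /r -/w -natr1 mulrDl mul1r.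
  move: Ai Ak; rewrite /A /= -/w !rE !addrK => /andP[i1 i2] /andP[k1 k2].
  have lt1 (x y : nat) : x%:R * w < y%:R * w + w -> (x <= y)%N.
    by rewrite -[X in _ + X](mul1r w) -mulrDl ltr_pM2r// natr1 ltr_nat ltnS.
  apply/eqP; rewrite eqn_leq !lt1//.
    exact: le_lt_trans k1 i2.
  exact: le_lt_trans i1 k2.
apply: (@cvge0_le _ _ (fun n =>
   ((C * (t / n.+1%:R) * q `^ (a - 2)) * fine (N (X u)%R))%:E +
   (C * q `^ (a - 1))%:E * N (X u - step_fun (s n) u)%R)%E) => [n|n|].
- exact: (snN_ge0 SN).
- have [k kn Ak] := cell n; rewrite (hE n k kn Ak).
  have /andP[A1 A2] := Ak; rewrite -/q in A1 A2.
  have VKx := @sk_in _ _ _ _ _ _ _ SK q _ q0 VXu.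
  have VKrx := @sk_in _ _ _ _ _ _ _ SK _ _ (r0 n k) VXu.
  have Vm := step_fun_in SN u (Vmap n k).
  apply: (le_trans (snN_tri SN VKx VKrx Vm)); apply: leeD.
    rewrite (snN_subC SN)//.
    have th1 : 0 <= (1 : R) <= 1 by rewrite ler01 lexx.
    have := sk_holder SK q0 A2 th1 VXu.
    have -> : N (X u)%R = (fine (N (X u)%R))%:E by rewrite fineK// (snN_fin SN).
    rewrite -EFinM => /le_trans; apply; rewrite lee_fin.
    rewrite (_ : a - 1 - 1 = a - 2); last by ring.
    rewrite ler_wpM2r ?fine_ge0 ?(snN_ge0 SN)// ler_wpM2r ?powR_ge0// ler_wpM2l//.
    rewrite powRr1; last by rewrite subr_ge0 ltW.
    by rewrite lerBlDr -lerBlDl.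
  apply: (le_trans (sk_step_le u (r0 n k) VXu (Vs n))).
  rewrite lee_pmul ?lee_fin ?kc ?(snN_ge0 SN)//.
  rewrite ler_wpM2l//.
  exact: powR_subr1_nonincr.
- rewrite -[X in _ --> X]adde0; apply: cvgeD => //.
    apply: cvg_EFin; first exact: nearW.
    rewrite (_ : 0 = C * (t * 0) * q `^ (a - 2) * fine (N (X u)%R)); last by rewrite !(mulr0, mul0r).
    apply: cvgMl; apply: cvgMl; apply: cvgMr; apply: cvgMr; exact: cvg_harmonic.
  by rewrite -[X in _ --> X](mule0 (C * q `^ (a - 1))%:E); apply: cvgeZl.
Qed.


Let conv (X : R -> E) t := bochner_integral mu V N `]0, t[ (fun u => K (t - u) (X u)).

Let mD t : measurable (`]0, t[%classic : set RT). Proof. by []. Qed.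

Let Doo t : (mu (`]0%R, t[%classic : set RT) < +oo)%E.
Proof. by rewrite lebesgue_measure_itv/=; case: ifPn => // _; rewrite -EFinB ltry. Qed.

Let kr t M (u : RT) : \bar R := (C * M * (t - u) `^ (a - 1))%:E.

Let mkr t M : measurable_fun [set: RT] (kr t M).
Proof.
apply/measurable_EFinP; apply: measurable_funM => //.
by apply: (measurableT_comp (measurable_powR _)); apply: measurable_funB.
Qed.

Lemma convolution_exists t (X : R -> E) (M : R) : seminorm_complete V N ->
  0 < t -> 0 <= M -> strongly_measurable mu V N `]0, t[ X ->
  (forall u, 0 < u < t -> (N (X u)%R <= M%:E)%E) ->
  is_bochner_integral mu V N `]0, t[ (fun u => K (t - u) (X u)) (conv X t).
Proof.
move=> VC t0 M0 mX XM; apply: bochner_integralP.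
apply: (bochner_exists SN (mD t) (Doo t) (g := kr t M)) => //.
- exact: strongly_measurable_convolution.
- by move=> u; rewrite lee_fin mulr_ge0 ?powR_ge0// mulr_ge0.
- under eq_integral do rewrite /kr EFinM.
  rewrite ge0_integralZl_EFin//; last 3 first.
  + by move=> u _; rewrite lee_fin powR_ge0.
  + apply/measurable_EFinP; apply: measurable_funTS.
    by apply: (measurableT_comp (measurable_powR _)); apply: measurable_funB.
  + by rewrite mulr_ge0.
  by rewrite integral_powR_refl// -EFinM ltry.
- apply: aeW => u; rewrite /= in_itv/= => /andP[u0 ut].
  have [VX _] := mX; have Vu : V (X u) by apply: VX; rewrite /= in_itv/= u0.
  have tu : 0 < t - u by rewrite subr_gt0.
  apply: (le_trans (sk_le SK tu Vu)).
  have -> : kr t M u = ((C * (t - u) `^ (a - 1))%:E * M%:E)%E by rewrite /kr -EFinM mulrAC.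
  by apply: lee_wpmul2l; [rewrite lee_fin; exact: kc|apply: XM; rewrite u0].
Qed.

Lemma convolution0 (X : R -> E) : V (conv X 0) /\ N (conv X 0)%R = 0%E.
Proof.
have D0 : `]0, 0[%classic = set0 :> set R by rewrite set_itvoo0.
have IB0 : is_bochner_integral mu V N `]0, 0[ (fun u => K (0 - u) (X u)) 0.
  rewrite D0; split; [split => //|exact: (sn0 SN)|].
    by exists (fun=> @step0 _ _ R E); split => [n []//|]; exact: aeW.
  exists (fun=> @step0 _ _ R E); split => [n []//|n []//||].
    by under eq_fun do rewrite integral_set0; exact: cvg_cst.
  under eq_fun do rewrite /step_integral big_ord0 subrr (snN0 SN).
  exact: cvg_cst.
have := bochner_integralP (ex_intro _ _ IB0) => h; split; first by case: h.
by have := is_bochner_integral_unique SN (mD 0) (Doo 0) h IB0; rewrite subr0.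
Qed.

Lemma convolutionD t (X Y Z : R -> E) (M : R) : seminorm_complete V N ->
  0 < t -> 0 <= M ->
  strongly_measurable mu V N `]0, t[ X -> strongly_measurable mu V N `]0, t[ Y ->
  (forall u, 0 < u < t -> (N (X u)%R <= M%:E)%E) ->
  (forall u, 0 < u < t -> (N (Y u)%R <= M%:E)%E) ->
  (forall u, Z u = X u + Y u) ->
  N (conv Z t - (conv X t + conv Y t))%R = 0%E.
Proof.
move=> VC t0 M0 mX mY XM YM /funext ->; have [VX _] := mX; have [VY _] := mY.
have h1 := convolution_exists VC t0 M0 mX XM.
have h2 := convolution_exists VC t0 M0 mY YM.
have h3 : is_bochner_integral mu V N `]0, t[ (fun u => K (t - u) (X u + Y u))
    (conv (fun u => X u + Y u) t).
  apply: (@convolution_exists _ _ (M + M)) => //; first by rewrite addr_ge0.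
    exact: strongly_measurableD.
  move=> u u01; have Du : (`]0, t[%classic : set R) u by rewrite /= in_itv.
  apply: (le_trans (snN_D SN (VX _ Du) (VY _ Du))); rewrite EFinD.
  by apply: leeD; [exact: XM|exact: YM].
apply: (is_bochner_integral_unique SN (mD t) (Doo t) h3).
apply: (is_bochner_integral_congr SN (is_bochner_integralD SN (mD t) h1 h2)) => u;
  rewrite /= in_itv/= => /andP[u0 ut]; have Du : (`]0, t[%classic : set R) u by rewrite /= in_itv/= u0.
  apply: (sk_in SK); first by rewrite subr_gt0.
  by apply: (snD SN); [exact: VX|exact: VY].
have tu : 0 < t - u by rewrite subr_gt0.
have VKX := @sk_in _ _ _ _ _ _ _ SK _ _ tu (VX _ Du).
have VKY := @sk_in _ _ _ _ _ _ _ SK _ _ tu (VY _ Du).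
rewrite (snN_subC SN); first exact: (sk_D SK tu (VX _ Du) (VY _ Du)).
- exact: (snD SN).
- by apply: (sk_in SK) => //; apply: (snD SN); [exact: VX|exact: VY].
Qed.

(** After the substitution u -> t - u the two convolutions integrate the same function
    K u z, over ]0,t[ and ]0,s[; the difference is its integral over ]s,t[. *)
Lemma convolution_cst_increment (z : E) s t : seminorm_complete V N ->
  V z -> 0 < s -> s < t ->
  (N (conv (fun=> z) t - conv (fun=> z) s)%R <=
   (C / a * (t `^ a - s `^ a))%:E * N z)%E.
Proof.
move=> VC Vz s0 st; have t0 : 0 < t by exact: lt_trans st.
have mz r : strongly_measurable mu V N `]0, r[ (fun=> z) by exact: strongly_measurable_cst.
have Nz : N z = (fine (N z))%:E by rewrite fineK// (snN_fin SN).
have z0 : 0 <= fine (N z) by rewrite fine_ge0// (snN_ge0 SN).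
have IB r : 0 < r -> is_bochner_integral mu V N `]0, r[ (fun u => K u z) (conv (fun=> z) r).
  move=> r0; have h : is_bochner_integral mu V N `]0, r[ (fun u => K (r - u) z) (conv (fun=> z) r).
    by apply: (convolution_exists VC r0 z0 (mz r)) => u _; rewrite -Nz.
  have := is_bochner_integral_preimage SN (phi := (fun u => r - u) : R -> measurableTypeR R)
    (mu := mu) (measurable_reflect r) (mD r) (fun A mA => lebesgue_measure_reflect r mA) h.
  have -> : ((fun u => r - u) : R -> measurableTypeR R) @^-1` `]0, r[%classic = `]0, r[%classic.
    by apply/seteqP; split => u /=; rewrite !in_itv/= => /andP[h1 h2]; apply/andP; split; lra.
  by congr is_bochner_integral; apply/funext => u /=; rewrite subKr.
have sub : (`]0, s[%classic : set RT) `<=` `]0, t[%classic.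
  by move=> u /=; rewrite !in_itv/= => /andP[-> us]; exact: lt_trans st.
have IBs := is_bochner_integral_extend SN (mD s) sub (IB s s0).
have IBd := is_bochner_integralB SN (mD t) (IB t t0) IBs.
pose g (u : RT) : \bar R := if u \in (`]0, s[%classic : set RT) then 0%E else (C * fine (N z) * u `^ (a - 1))%:E.
have mg : measurable_fun [set: RT] g.
  apply: measurable_fun_if_mem => //.
  by apply/measurable_EFinP; apply: measurable_funM.
have g0 u : (0 <= g u)%E.
  by rewrite /g; case: ifPn => // _; rewrite lee_fin mulr_ge0 ?powR_ge0// mulr_ge0.
apply: (le_trans (bochner_le SN (mD t) (Doo t) IBd mg g0 _)).
  apply: aeW => u; rewrite /= in_itv/= => /andP[u0 ut]; rewrite /g.
  have [us|us] := boolP (u \in (`]0, s[%classic : set RT)).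
    by rewrite subrr (snN0 SN).
  rewrite subr0; apply: (le_trans (sk_le SK u0 Vz)).
  by rewrite Nz -EFinM lee_fin mulrAC.
rewrite integral_piecewise//; last 2 first.
- by apply/measurable_EFinP; apply: measurable_funM.
- by move=> u; rewrite lee_fin mulr_ge0 ?powR_ge0// mulr_ge0.
rewrite integral0 add0e; under eq_integral do rewrite EFinM.
rewrite ge0_integralZl_EFin//; last 3 first.
- by move=> u _; rewrite lee_fin powR_ge0.
- by apply/measurable_EFinP; exact: measurable_funTS.
- exact: mulr_ge0.
rewrite integral_powR_itv// Nz -!EFinM lee_fin; apply: eq_ler.
by field; rewrite gt_eqF.
Qed.

Let integral_lin2 (D : set RT) (c1 c2 : R) (f1 f2 : R -> R) : measurable D ->
  0 <= c1 -> 0 <= c2 -> measurable_fun [set: RT] f1 -> measurable_fun [set: RT] f2 ->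
  (forall u, 0 <= f1 u) -> (forall u, 0 <= f2 u) ->
  (\int[mu]_(u in D) (c1 * f1 u + c2 * f2 u)%:E =
   c1%:E * \int[mu]_(u in D) (f1 u)%:E + c2%:E * \int[mu]_(u in D) (f2 u)%:E)%E.
Proof.
move=> mDD c10 c20 m1 m2 f10 f20.
have e1 : measurable_fun D (fun u : RT => (f1 u)%:E).
  by apply/measurable_EFinP; exact: measurable_funTS.
have e2 : measurable_fun D (fun u : RT => (f2 u)%:E).
  by apply/measurable_EFinP; exact: measurable_funTS.
rewrite -!ge0_integralZl_EFin//; try by [move=> u _; rewrite lee_fin].
rewrite -ge0_integralD//.
- by move=> u _; rewrite -EFinM lee_fin mulr_ge0.
- exact: measurable_funeM.
- by move=> u _; rewrite -EFinM lee_fin mulr_ge0.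
- exact: measurable_funeM.
Qed.

Let mshift s b : measurable_fun [set: RT] (fun u : RT => (u - s) `^ b).
Proof. by apply: (measurableT_comp (measurable_powR _)); apply: measurable_funB. Qed.

Let mrefl s b : measurable_fun [set: RT] (fun u : RT => (s - u) `^ b).
Proof. by apply: (measurableT_comp (measurable_powR _)); apply: measurable_funB. Qed.

(** X is centred at s.  On ]0,s[ the kernel increment of exponent th multiplied by the
    size of X leaves (s-u)^(a+nu-th-1) u^(-m); on ]s,t[ the kernel leaves
    (t-u)^(a-1) (u-s)^nu.  Both are integrands of Beta type. *)
Lemma convolution_increment_centered (X : R -> E) s t K0 m nu th M :
  seminorm_complete V N -> 0 < s -> s < t -> 0 <= M -> 0 <= K0 ->
  m < 1 -> - a < nu -> 0 <= th <= 1 -> th < a + nu ->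
  strongly_measurable mu V N `]0, t[ X ->
  (forall u, 0 < u < t -> (N (X u)%R <= M%:E)%E) ->
  (forall u, 0 < u -> u < s -> (N (X u)%R <= (K0 * u `^ (- m) * (s - u) `^ nu)%:E)%E) ->
  N (X s)%R = 0%E ->
  (forall u, s < u -> u < t -> (N (X u)%R <= (K0 * s `^ (- m) * (u - s) `^ nu)%:E)%E) ->
  (N (conv X t - conv X s)%R <= (C * K0 * s `^ (- m) *
     ((t - s) `^ th * s `^ (a + nu - th) * (2 / (1 - m) + 2 / (a + nu - th)) +
      (t - s) `^ (a + nu) * (2 / (nu + 1) + 2 / a)))%:E)%E.
Proof.
move=> VC s0 st M0 K00 m1 nua th01 thn mX XM Xl Xs Xr.
have t0 : 0 < t by exact: lt_trans st.
have sub : (`]0, s[%classic : set RT) `<=` `]0, t[%classic.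
  by move=> u /=; rewrite !in_itv/= => /andP[-> us]; exact: lt_trans st.
have IBt := convolution_exists VC t0 M0 mX XM.
have IBs : is_bochner_integral mu V N `]0, s[ (fun u => K (s - u) (X u)) (conv X s).
  apply: (convolution_exists VC s0 M0) => [|u /andP[u0 us]].
    exact: strongly_measurable_subset sub mX.
  by apply: XM; rewrite u0 (lt_trans us).
have IBd := is_bochner_integralB SN (mD t) IBt
  (is_bochner_integral_extend SN (mD s) sub IBs).
set h := t - s; have h0 : 0 < h by rewrite subr_gt0.
pose A := a + nu - th; pose B := 1 - m.
have A0 : 0 < A by rewrite subr_gt0.
have B0 : 0 < B by rewrite subr_gt0.
have n0 : 0 < nu + 1 by rewrite -ltrBlDr sub0r; apply: lt_trans nua; rewrite ltrN2.
(* gl and gr are the bounds of beta_integrand_le on ]0,s[ and ]s,t[. *)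
pose gl (u : RT) : R := (C * K0 * h `^ th * 2 * s `^ (A - 1)) * u `^ (B - 1) +
  (C * K0 * h `^ th * 2 * s `^ (B - 1)) * (s - u) `^ (A - 1).
pose gr (u : RT) : R := (C * K0 * s `^ (- m) * 2 * h `^ (a - 1)) * (u - s) `^ (nu + 1 - 1) +
  (C * K0 * s `^ (- m) * 2 * h `^ (nu + 1 - 1)) * (t - u) `^ (a - 1).
have cl1 : 0 <= C * K0 * h `^ th * 2 * s `^ (A - 1) by rewrite !mulr_ge0 ?powR_ge0.
have cl2 : 0 <= C * K0 * h `^ th * 2 * s `^ (B - 1) by rewrite !mulr_ge0 ?powR_ge0.
have cr1 : 0 <= C * K0 * s `^ (- m) * 2 * h `^ (a - 1) by rewrite !mulr_ge0 ?powR_ge0.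
have cr2 : 0 <= C * K0 * s `^ (- m) * 2 * h `^ (nu + 1 - 1) by rewrite !mulr_ge0 ?powR_ge0.
have gl0 u : 0 <= gl u.
  by apply: addr_ge0; apply: mulr_ge0 => //; exact: powR_ge0.
have gr0 u : 0 <= gr u.
  by apply: addr_ge0; apply: mulr_ge0 => //; exact: powR_ge0.
have mgl : measurable_fun [set: RT] gl.
  apply: measurable_funD; apply: measurable_funM => //; exact: measurable_powR.
have mgr : measurable_fun [set: RT] gr.
  by apply: measurable_funD; apply: measurable_funM.
pose g (u : RT) : \bar R := if u \in (`]0, s[%classic : set RT) then (gl u)%:E else (gr u)%:E.
have mg : measurable_fun [set: RT] g.
  by apply: measurable_fun_if_mem => //; exact/measurable_EFinP.
have g0 u : (0 <= g u)%E by rewrite /g; case: ifPn => _; rewrite lee_fin.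
have [VX _] := mX.
apply: (le_trans (bochner_le SN (mD t) (Doo t) IBd mg g0 _)).
  apply: aeW => u Du; have VXu := VX _ Du.
  move: Du; rewrite /= in_itv/= => /andP[u0 ut]; rewrite /g.
  have tu0 : 0 < t - u by rewrite subr_gt0.
  have [us|us] := boolP (u \in (`]0, s[%classic : set RT)).
    move/set_mem : us; rewrite /= in_itv/= => /andP[_ us].
    have su0 : 0 < s - u by rewrite subr_gt0.
    have tusu : s - u < t - u by rewrite ltrD2r.
    apply: (le_trans (sk_holder SK su0 tusu th01 VXu)).
    rewrite (_ : t - u - (s - u) = h); last by rewrite /h; ring.
    have c0 : 0 <= C * h `^ th * (s - u) `^ (a - 1 - th) by rewrite !mulr_ge0 ?powR_ge0.
    apply: (le_trans (lee_wpmul2l _ (Xl u u0 us))); first by rewrite lee_fin.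
    rewrite -EFinM lee_fin.
    have -> : C * h `^ th * (s - u) `^ (a - 1 - th) * (K0 * u `^ (- m) * (s - u) `^ nu) =
        C * K0 * h `^ th * ((s - u) `^ (A - 1) * u `^ (B - 1)).
      have -> : (s - u) `^ (A - 1) = (s - u) `^ (a - 1 - th) * (s - u) `^ nu.
        rewrite -powRD_gt0//; congr powR; rewrite /A; ring.
      rewrite (_ : B - 1 = - m); last by rewrite /B; ring.
      ring.
    have ch0 : 0 <= C * K0 * h `^ th by rewrite !mulr_ge0 ?powR_ge0.
    apply: (le_trans (ler_wpM2l ch0 (beta_integrand_le A0 B0 u0 us))).
    by rewrite /gl; apply: eq_ler; ring.
  rewrite subr0; apply: (le_trans (sk_le SK tu0 VXu)).
  have su : s <= u.
    by rewrite leNgt; apply: contra us => us; rewrite inE/= in_itv/= u0.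
  have [us'|us'] := eqVneq u s; first by rewrite us' Xs mule0 lee_fin.
  have {}su : s < u by rewrite lt_neqAle eq_sym us'.
  apply: (le_trans (lee_wpmul2l _ (Xr u su ut))); first by rewrite lee_fin kc.
  rewrite -EFinM lee_fin.
  have us0 : 0 < u - s by rewrite subr_gt0.
  have ush : u - s < h by rewrite ltrD2r.
  have hus : h - (u - s) = t - u by rewrite /h; ring.
  have := beta_integrand_le a0 n0 us0 ush; rewrite hus => bb.
  have cs0 : 0 <= C * K0 * s `^ (- m) by rewrite !mulr_ge0 ?powR_ge0.
  have := ler_wpM2l cs0 bb; rewrite [X in _ <= X -> _](_ : _ = gr u); last first.
    by rewrite /gr; ring.
  apply: le_trans; apply: eq_ler.
  rewrite (_ : nu + 1 - 1 = nu); last by ring.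
  ring.
rewrite integral_piecewise//; try by [exact/measurable_EFinP|move=> u; rewrite lee_fin].
rewrite integral_lin2//; try by [exact: measurable_powR|move=> u; exact: powR_ge0].
rewrite integral_lin2//; try by move=> u; exact: powR_ge0.
rewrite integral_powR_oo// integral_powR_refl// integral_powR_shift// integral_powR_refl//.
rewrite subr0 -/h -!EFinM -!EFinD lee_fin; apply: eq_ler.
have e1 : s `^ (A - 1) * s `^ B = s `^ (- m) * s `^ A.
  by rewrite -!powRD_gt0//; congr powR; rewrite /B; ring.
have e2 : s `^ (B - 1) * s `^ A = s `^ (- m) * s `^ A.
  by rewrite -!powRD_gt0//; congr powR; rewrite /B; ring.
have e3 : h `^ (a - 1) * h `^ (nu + 1) = h `^ (a + nu).
  by rewrite -!powRD_gt0//; congr powR; ring.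
have e4 : h `^ (nu + 1 - 1) * h `^ a = h `^ (a + nu).
  by rewrite -!powRD_gt0//; congr powR; ring.
transitivity (C * K0 * h `^ th * 2 / B * (s `^ (A - 1) * s `^ B) +
   C * K0 * h `^ th * 2 / A * (s `^ (B - 1) * s `^ A) +
   (C * K0 * s `^ (- m) * 2 / (nu + 1) * (h `^ (a - 1) * h `^ (nu + 1)) +
    C * K0 * s `^ (- m) * 2 / a * (h `^ (nu + 1 - 1) * h `^ a))).
  by move: (_^-1) (_^-1) (_^-1) (_^-1) => i1 i2 i3 i4; ring.
rewrite e1 e2 e3 e4 -/A -/B.
by move: (_^-1) (_^-1) (_^-1) (_^-1) => i1 i2 i3 i4; ring.
Qed.

Let powRB_ge0 s t : 0 < s -> s < t -> 0 <= t `^ a - s `^ a.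
Proof.
move=> s0 st; rewrite subr_ge0 ge0_ler_powR ?(ltW a0) ?nnegrE ?(ltW s0) ?(ltW st)//.
exact: ltW (lt_trans s0 st).
Qed.

Lemma convolution_in t (X : R -> E) (M : R) : seminorm_complete V N ->
  0 < t -> 0 <= M -> strongly_measurable mu V N `]0, t[ X ->
  (forall u, 0 < u < t -> (N (X u)%R <= M%:E)%E) -> V (conv X t).
Proof.
by move=> VC t0 M0 mX XM; have [] := convolution_exists VC t0 M0 mX XM.
Qed.

(** H is centred at s by subtracting the constant H s, whose convolution has the
    increment t^a - s^a.  The exponent th stays below a + nu thanks to eps, and the
    excess powers s^(a+nu-th) and (t-s)^(a+nu-th) are at most T^(a+nu-th). *)
Lemma convolution_increment_holder (H : R -> E) (T M K0 m nu eps : R) :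
  seminorm_complete V N -> 0 < T -> 0 <= M -> 0 < K0 -> m < 1 -> - a < nu ->
  0 < eps < a + nu ->
  strongly_measurable mu V N `[0, T] H ->
  (forall u, 0 <= u <= T -> (N (H u)%R <= M%:E)%E) ->
  (forall u1 u2, 0 < u1 -> u1 < u2 -> u2 <= T ->
    (N (H u2 - H u1)%R <= (K0 * u1 `^ (- m) * (u2 - u1) `^ nu)%:E)%E) ->
  exists2 C1 : R, 0 < C1 & forall s t, 0 < s -> s < t -> t <= T ->
    (N (conv H t - conv H s)%R <= (C1 * (t `^ a - s `^ a)
      + C1 * s `^ (- m) * (t - s) `^ (Num.min (a + nu - eps) 1))%:E)%E.
Proof.
move=> VC T0 M0 K00 m1 nua /andP[e0 en] mH HM HH.
have n0 : 0 < nu + 1 by rewrite -ltrBlDr sub0r; apply: lt_trans nua; rewrite ltrN2.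
set th := Num.min _ _.
have th01 : 0 <= th <= 1.
  by rewrite /th le_min ge_min lexx orbT ler01 andbT subr_ge0 (ltW en).
have thn : th < a + nu.
  by rewrite /th gt_min ltrBlDr ltrDl e0.
pose A := a + nu - th; have A0 : 0 < A by rewrite subr_gt0.
have B0 : 0 < 1 - m by rewrite subr_gt0.
pose c := (2 / (1 - m) + 2 / A) + (2 / (nu + 1) + 2 / a).
have c10 : 0 <= 2 / (1 - m) + 2 / A by rewrite addr_ge0 ?divr_ge0 ?(ltW B0) ?(ltW A0).
have c20 : 0 <= 2 / (nu + 1) + 2 / a by rewrite addr_ge0 ?divr_ge0 ?(ltW n0) ?(ltW a0).
have k10 : 0 <= C / a * M by rewrite mulr_ge0// divr_ge0// (ltW a0).
have k20 : 0 <= C * K0 * (T `^ A * c).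
  by rewrite mulr_ge0 ?mulr_ge0 ?powR_ge0 ?(ltW K00)// addr_ge0.
exists (C / a * M + C * K0 * (T `^ A * c) + 1).
  by rewrite ltr_wpDl ?ltr01// addr_ge0.
move=> s t s0 st tT; have t0 : 0 < t by exact: lt_trans st.
have sT : s < T by exact: lt_le_trans tT.
have [VH _] := mH.
have Vz : V (H s) by apply: VH; rewrite /= in_itv/= (ltW s0) (ltW sT).
have sub r : r <= T -> (`]0, r[%classic : set RT) `<=` `[0, T]%classic.
  move=> rT u /=; rewrite !in_itv/= => /andP[u0 ur].
  by rewrite (ltW u0) (le_trans (ltW ur)).
pose X u := H u - H s.
have mH' r : r <= T -> strongly_measurable mu V N `]0, r[ H.
  by move=> rT; exact: strongly_measurable_subset (sub r rT) mH.
have mz r : strongly_measurable mu V N `]0, r[ (fun=> H s) by exact: strongly_measurable_cst.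
have mX r : r <= T -> strongly_measurable mu V N `]0, r[ X.
  by move=> rT; apply: strongly_measurableB => //; exact: mH'.
have HM' r u : r <= T -> 0 < u < r -> (N (H u)%R <= M%:E)%E.
  by move=> rT /andP[u0 ur]; apply: HM; rewrite (ltW u0) (le_trans (ltW ur)).
have HsM : (N (H s)%R <= M%:E)%E by apply: HM; rewrite (ltW s0) (ltW sT).
have M20 : 0 <= M + M by rewrite addr_ge0.
have XM r u : r <= T -> 0 < u < r -> (N (X u)%R <= (M + M)%:E)%E.
  move=> rT ur; have VHu : V (H u).
    by apply: VH; move: ur; rewrite /= in_itv/= => /andP[u0 ur]; rewrite (ltW u0) (le_trans (ltW ur)).
  apply: (le_trans (snN_B SN VHu Vz)); rewrite EFinD.
  by apply: leeD => //; exact: HM' rT ur.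
have HsM' r u : 0 < u < r -> (N (H s)%R <= M%:E)%E by [].
have dec r : 0 < r -> r <= T -> [/\ V (conv H r), V (conv X r), V (conv (fun=> H s) r) &
    N (conv H r - (conv X r + conv (fun=> H s) r))%R = 0%E].
  move=> r0 rT; split.
  - by apply: (convolution_in VC r0 M0 (mH' r rT)) => u; exact: HM'.
  - by apply: (convolution_in VC r0 M20 (mX r rT)) => u; exact: XM.
  - by apply: (convolution_in VC r0 M0 (mz r)) => u _.
  - apply: (convolutionD VC r0 M20 (mX r rT) (mz r)) => u; [exact: XM| |by rewrite subrK].
    by move=> _; apply: (le_trans HsM); rewrite lee_fin lerDl.
have [V1 V2 V3 Nt] := dec t t0 tT.
have [W1 W2 W3 Ns] := dec s s0 (ltW sT).
have V4 : V (conv X t + conv (fun=> H s) t) by exact: (snD SN).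
have W4 : V (conv X s + conv (fun=> H s) s) by exact: (snD SN).
apply: (le_trans (snN_tri SN V1 V4 W1)); rewrite Nt add0e.
apply: (le_trans (snN_tri SN V4 W4 W1)).
rewrite [X in (_ + X <= _)%E](snN_subC SN)// Ns adde0 opprD addrACA.
apply: (le_trans (snN_D SN (snB SN V2 W2) (snB SN V3 W3))).
have I1 := convolution_cst_increment VC Vz s0 st.
have I2 := @convolution_increment_centered X s t K0 m nu th (M + M) VC s0 st M20 (ltW K00)
  m1 nua th01 thn (mX t tT) (fun u => XM t u tT).
have {}I2 : (N (conv X t - conv X s)%R <= (C * K0 * s `^ (- m) *
     ((t - s) `^ th * s `^ (a + nu - th) * (2 / (1 - m) + 2 / (a + nu - th)) +
      (t - s) `^ (a + nu) * (2 / (nu + 1) + 2 / a)))%:E)%E.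
  apply: I2.
  - move=> u u0 us; rewrite /X (snN_subC SN)//; last first.
      by apply: VH; rewrite /= in_itv/= (ltW u0) (ltW (lt_trans us sT)).
    exact: HH u0 us (ltW sT).
  - by rewrite /X subrr (snN0 SN).
  - by move=> u su ut; apply: HH s0 su _; rewrite (le_trans (ltW ut)).
apply: (le_trans (leeD I2 I1)).
have ta := powRB_ge0 s0 st.
have cta : 0 <= C / a * (t `^ a - s `^ a).
  by rewrite mulr_ge0// divr_ge0// (ltW a0).
have I3 : ((C / a * (t `^ a - s `^ a))%:E * N (H s) <= (C / a * (t `^ a - s `^ a) * M)%:E)%E.
  by rewrite [leRHS]EFinM; apply: lee_wpmul2l; rewrite ?lee_fin.
apply: (le_trans (leeD2l _ I3)); rewrite -EFinD lee_fin -/A.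
set h := t - s; have h0 : 0 < h by rewrite subr_gt0.
have hT : h <= T by rewrite lerBlDr (le_trans tT)// lerDl (ltW s0).
have sA : s `^ A <= T `^ A.
  by rewrite ge0_ler_powR ?(ltW A0) ?nnegrE ?(ltW s0) ?(ltW T0) ?(ltW sT).
have hA : h `^ A <= T `^ A.
  by rewrite ge0_ler_powR ?(ltW A0) ?nnegrE ?(ltW h0) ?(ltW T0).
have -> : h `^ (a + nu) = h `^ th * h `^ A.
  by rewrite -powRD_gt0//; congr powR; rewrite /A; ring.
have hth : 0 <= h `^ th by exact: powR_ge0.
have sm : 0 <= s `^ (- m) by exact: powR_ge0.
have L1 : h `^ th * s `^ A * (2 / (1 - m) + 2 / A) + h `^ th * h `^ A * (2 / (nu + 1) + 2 / a)
    <= h `^ th * (T `^ A * c).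
  rewrite -2!mulrA -mulrDr; apply: ler_wpM2l => //; rewrite /c [leRHS]mulrDr.
  by apply: lerD; apply: ler_wpM2r.
have L2 : C * K0 * s `^ (- m) * (h `^ th * s `^ A * (2 / (1 - m) + 2 / A) +
     h `^ th * h `^ A * (2 / (nu + 1) + 2 / a)) <=
    C * K0 * (T `^ A * c) * (s `^ (- m) * h `^ th).
  rewrite [leRHS](_ : _ = C * K0 * s `^ (- m) * (h `^ th * (T `^ A * c))); last first.
    by move: (T `^ A * c) => q; ring.
  by apply: ler_wpM2l => //; rewrite !mulr_ge0// (ltW K00).
have L3 : 0 <= s `^ (- m) * h `^ th by rewrite mulr_ge0.
apply: (le_trans (lerD L2 (lexx _))).
rewrite -[X in _ <= _ + X]mulrA addrC; apply: lerD.
  rewrite mulrAC; apply: ler_wpM2r => //.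
  by rewrite -addrA lerDl addr_ge0.
apply: ler_wpM2r => //.
by rewrite addrAC lerDr addr_ge0.
Qed.

(** G and G - G 0 have the same increments, so that [convolution_increment_holder]
    applies to both; small means eps < a + nu. *)
Lemma convolution_regularity (T : R) (G : R -> E) :
  seminorm_complete V N -> 0 < T ->
  strongly_measurable mu V N `[0, T] G ->
  (ereal_sup [set N (G t) | t in (`[0%R, T]%classic : set R)] < +oo)%E ->
  [/\ forall t, 0 <= t <= T ->
        N (conv G t - (conv (fun=> G 0) t + conv (fun u => G u - G 0)%R t))%R = 0%E,
      exists2 C1 : R, 0 < C1 & forall s t, 0 < s -> s < t -> t <= T ->
        (N (conv (fun=> G 0%R) t - conv (fun=> G 0%R) s)%R <= (C1 * (t `^ a - s `^ a))%:E)%E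
    & forall K0 m nu : R, 0 < K0 -> m < 1 -> - a < nu < 1 ->
        (forall u1 u2, 0 < u1 -> u1 < u2 -> u2 <= T ->
          (N (G u2 - G u1)%R <= (K0 * u1 `^ (- m) * (u2 - u1) `^ nu)%:E)%E) ->
        exists2 eps0 : R, 0 < eps0 & forall eps, 0 < eps < eps0 ->
          exists2 C1 : R, 0 < C1 & forall s t, 0 < s -> s < t -> t <= T ->
            let bound := C1 * (t `^ a - s `^ a)
              + C1 * s `^ (- m) * (t - s) `^ (Num.min (a + nu - eps) 1) in
            (N (conv (fun u => G u - G 0)%R t - conv (fun u => G u - G 0)%R s)%R <= bound%:E)%E /\
            (N (conv G t - conv G s)%R <= bound%:E)%E].
Proof.
move=> VC hT Gmeas Gbnd; have [VG _] := Gmeas.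
have G0L : V (G 0) by apply: VG; rewrite /= in_itv/= lexx (ltW hT).
have [M M0 GM] : exists2 M : R, 0 <= M & forall u, 0 <= u <= T -> (N (G u) <= M%:E)%E.
  have ub u : 0 <= u <= T -> (N (G u) <= ereal_sup
      [set N (G t) | t in (`[0%R, T]%classic : set R)])%E.
    by move=> uT; apply: ereal_sup_ubound; exists u => //; rewrite /= in_itv.
  have s0 := le_trans (snN_ge0 SN (G 0)) (ub 0 _); rewrite lexx (ltW hT) in s0.
  exists (fine (ereal_sup [set N (G t) | t in (`[0%R, T]%classic : set R)])).
    by rewrite fine_ge0// s0.
  by move=> u uT; rewrite fineK ?ub// ge0_fin_numE// s0.
have GM0 : (N (G 0%R) <= M%:E)%E by apply: GM; rewrite lexx (ltW hT).
have M20 : 0 <= M + M by rewrite addr_ge0.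
pose H u := G u - G 0.
have mH : strongly_measurable mu V N `[0, T] H.
  by apply: strongly_measurableB => //; exact: strongly_measurable_cst.
have HM u : 0 <= u <= T -> (N (H u) <= (M + M)%:E)%E.
  move=> uT; have VGu : V (G u) by apply: VG; rewrite /= in_itv.
  by apply: (le_trans (snN_B SN VGu G0L)); rewrite EFinD; apply: leeD => //; exact: GM.
split.
- move=> t /andP[t0 tT]; have [t0'|t0'] := eqVneq t 0.
    rewrite t0'.
    have conv0 (X : R -> E) : V (conv X 0) /\ N (conv X 0) = 0%E.
      exact: convolution0.
    have [V1 N1] := conv0 G; have [V2 N2] := conv0 (fun=> G 0).
    have [V3 N3] := conv0 (fun u => G u - G 0).
    have V4 := snD SN V2 V3.
    apply/eqP; rewrite eq_le (snN_ge0 SN) andbT.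
    apply: (le_trans (snN_B SN V1 V4)); rewrite N1 add0e.
    by apply: (le_trans (snN_D SN V2 V3)); rewrite N2 N3 adde0.
  have {}t0 : 0 < t by rewrite lt_neqAle eq_sym t0'.
  have sub : (`]0, t[%classic : set (measurableTypeR R)) `<=` `[0, T]%classic.
    move=> u /=; rewrite !in_itv/= => /andP[u0 ut].
    by rewrite (ltW u0) (le_trans (ltW ut)).
  have tu u : 0 < u < t -> 0 <= u <= T.
    by move=> /andP[u0 ut]; rewrite (ltW u0) (le_trans (ltW ut)).
  apply: (@convolutionD t (fun=> G 0) H G (M + M) VC t0 M20).
  + exact: strongly_measurable_cst.
  + exact: strongly_measurable_subset sub mH.
  + by move=> u _; apply: (le_trans GM0); rewrite lee_fin lerDl.
  + by move=> u /tu; exact: HM.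
  + by move=> u; rewrite /H addrC subrK.
- exists (C / a * M + 1) => [|s t s0 st tT].
    by rewrite ltr_wpDl// mulr_ge0// divr_ge0// (ltW a0).
  apply: (le_trans (convolution_cst_increment VC G0L s0 st)).
  have ta := powRB_ge0 s0 st.
  have ca : 0 <= C / a by rewrite divr_ge0// (ltW a0).
  apply: (le_trans (lee_wpmul2l _ GM0)); first by rewrite lee_fin mulr_ge0.
  rewrite -EFinM lee_fin mulrAC; apply: ler_wpM2r => //.
  by rewrite lerDl.
- move=> K0 m nu K00 m1 /andP[nua nu1] GH.
  exists (a + nu); first by rewrite -ltrBlDl sub0r.
  move=> eps he.
  have [C1 C10 h1] := convolution_increment_holder VC hT M0 K00 m1 nua he Gmeas GM GH.
  have HH u1 u2 : 0 < u1 -> u1 < u2 -> u2 <= T ->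
      (N (H u2 - H u1)%R <= (K0 * u1 `^ (- m) * (u2 - u1) `^ nu)%:E)%E.
    move=> u10 u12 u2T; rewrite /H opprB addrA subrK; exact: GH.
  have [C2 C20 h2] := convolution_increment_holder VC hT M20 K00 m1 nua he mH HM HH.
  exists (C1 + C2); first exact: addr_gt0.
  move=> s t s0 st tT bound.
  have ta := powRB_ge0 s0 st.
  have sm : 0 <= s `^ (- m) by exact: powR_ge0.
  have tm : 0 <= (t - s) `^ Num.min (a + nu - eps) 1 by exact: powR_ge0.
  have mono (c : R) : c <= C1 + C2 -> c * (t `^ a - s `^ a) +
      c * s `^ (- m) * (t - s) `^ Num.min (a + nu - eps) 1 <= bound.
    move=> cC; apply: lerD; first exact: ler_wpM2r.
    by apply: ler_wpM2r => //; exact: ler_wpM2r.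
  split.
  + apply: (le_trans (h2 s t s0 st tT)); rewrite lee_fin; apply: mono.
    by rewrite lerDr (ltW C10).
  + apply: (le_trans (h1 s t s0 st tT)); rewrite lee_fin; apply: mono.
    by rewrite lerDl (ltW C20).
Qed.

End singular_kernel_theory.

(** * The Lp seminorm of nonnegative functions *)
Lemma sum_half_le (R : realType) n : \sum_(0 <= k < n) 2^-1 ^+ k <= 2 :> R.
Proof.
have -> : \sum_(0 <= k < n) 2^-1 ^+ k = 2 - 2 * 2^-1 ^+ n :> R.
  elim: n => [|n IH]; first by rewrite big_nil expr0 mulr1 subrr.
  by rewrite big_nat_recr//= IH exprS mulrA divff// mul1r; ring.
by rewrite gerBl mulr_ge0// exprn_ge0.
Qed.

Lemma limn_einf_ge0 (R : realType) (u : nat -> \bar R) :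
  (forall n, 0 <= u n)%E -> (0 <= limn_einf u)%E.
Proof.
move=> u0; rewrite limn_einf_lim; apply: lime_ge; first exact: is_cvg_einfs.
by apply: nearW => n; apply: le_ereal_inf_tmp => _ [m _ <-].
Qed.

Section Lp_seminorm.
Context d (T : measurableType d) (R : realType).
Variables (mu : {measure set T -> \bar R}) (p : R).
Hypothesis p1 : 1 <= p.
Implicit Types (f g : T -> \bar R) (h : T -> R).
Local Open Scope ereal_scope.

Let p0 : (0 < p)%R. Proof. exact: lt_le_trans p1. Qed.

Lemma ge0_LnormE f : (forall t, 0 <= f t) ->
  Lnorm mu p%:E f = (\int[mu]_t (f t `^ p)) `^ p^-1.
Proof.
move=> f0; rewrite unlock; congr (_ `^ _); apply: eq_integral => t _.
by rewrite gee0_abs.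
Qed.

(** Plays the role of measurability for norms of vector-valued functions, which are
    measurable only up to a null set. *)
Definition represented_by f h := [/\ measurable_fun setT h, (forall t, (0 <= h t)%R) &
  {ae mu, forall t, f t = (h t)%:E}].

Lemma measurable_EFin_powR h : measurable_fun setT h ->
  measurable_fun setT (fun t => (h t)%:E `^ p).
Proof.
move=> mh; under eq_fun do rewrite poweR_EFin.
by apply/measurable_EFinP; exact: (measurableT_comp (measurable_powR p)).
Qed.

Lemma ae_le_Lnorm f g h : (forall t, 0 <= f t) -> (forall t, 0 <= g t) ->
  represented_by g h -> {ae mu, forall t, f t <= g t} ->
  Lnorm mu p%:E f <= Lnorm mu p%:E g.
Proof.
move=> f0 g0 [mh h0 gh] fg; rewrite !ge0_LnormE//.
apply: gt0_ler_poweR.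
- by rewrite invr_ge0 (ltW p0).
- by rewrite in_itv/= leey andbT integral_ge0// => t _; exact: poweR_ge0.
- by rewrite in_itv/= leey andbT integral_ge0// => t _; exact: poweR_ge0.
rewrite [leRHS](@ae_eq_lower_integral _ _ _ mu setT _ (fun t => (h t)%:E `^ p))//.
- apply: ae_le_lower_integral => //.
  + exact: measurable_EFin_powR.
  + by move=> t _; exact: poweR_ge0.
  + by move=> t _; exact: poweR_ge0.
  + apply: filterS2 gh fg => t gh fg _; rewrite -gh.
    apply: gt0_ler_poweR => //; first exact: (ltW p0).
      by rewrite in_itv/= leey andbT.
    by rewrite in_itv/= leey andbT.
- exact: measurable_EFin_powR.
- by move=> t _; exact: poweR_ge0.
- by move=> t _; exact: poweR_ge0.
- by apply: filterS gh => t -> _.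
Qed.

Lemma represented_EFin h : measurable_fun setT h -> (forall t, (0 <= h t)%R) ->
  represented_by (EFin \o h) h.
Proof. by move=> mh h0; split => //; exact: aeW. Qed.

Lemma represented_Lnorm f h : (forall t, 0 <= f t) -> represented_by f h ->
  Lnorm mu p%:E f = Lnorm mu p%:E (EFin \o h).
Proof.
move=> f0 fh; have [mh h0 fhe] := fh; apply/eqP; rewrite eq_le; apply/andP; split.
  apply: (ae_le_Lnorm (h := h)) => //; first exact: represented_EFin.
  by apply: filterS fhe => t ->.
by apply: (ae_le_Lnorm (h := h)) => //; apply: filterS fhe => t ->.
Qed.

Lemma ae_LnormD f g k h1 h2 : (forall t, 0 <= f t) -> (forall t, 0 <= g t) ->
  (forall t, 0 <= k t) ->
  represented_by f h1 -> represented_by g h2 -> {ae mu, forall t, k t <= f t + g t} ->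
  Lnorm mu p%:E k <= Lnorm mu p%:E f + Lnorm mu p%:E g.
Proof.
move=> f0 g0 k0 fh1 gh2 kfg; rewrite (represented_Lnorm f0 fh1) (represented_Lnorm g0 gh2).
have [m1 h10 fe] := fh1; have [m2 h20 ge] := gh2.
have := @eminkowski _ _ _ mu h1 h2 p%:E m1 m2; rewrite lee_fin => /(_ p1).
apply: le_trans.
apply: (ae_le_Lnorm (h := (h1 \+ h2)%R)) => //.
- by move=> t; rewrite lee_fin addr_ge0.
- apply: represented_EFin; first exact: measurable_funD.
  by move=> t; rewrite addr_ge0.
- by apply: filterS3 fe ge kfg => t fe ge; rewrite fe ge.
Qed.

Lemma ge0_LnormZ f h (a : R) : (0 <= a)%R -> (forall t, 0 <= f t) -> represented_by f h ->
  Lnorm mu p%:E (fun t => a%:E * f t) = a%:E * Lnorm mu p%:E f.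
Proof.
move=> a0 f0 fh; have [mh h0 fe] := fh.
have r : represented_by (fun t => a%:E * f t) (fun t => a * h t)%R.
  split; first exact: measurable_funM.
  - by move=> t; rewrite mulr_ge0.
  - by apply: filterS fe => t ->.
have af0 t : 0 <= a%:E * f t by rewrite mule_ge0.
rewrite (represented_Lnorm af0 r) (represented_Lnorm f0 fh).
rewrite !ge0_LnormE//; last by move=> t; rewrite lee_fin mulr_ge0.
rewrite (@eq_integral _ _ _ mu setT (fun t => (a `^ p)%:E * (h t)%:E `^ p)); last first.
  by move=> t _; rewrite -poweR_EFin -poweRM ?lee_fin.
rewrite ge0_integralZl//.
- rewrite poweRM//.
  + by rewrite -poweR_EFin -poweRrM mulfV ?gt_eqF// poweRe1.
  + by rewrite lee_fin powR_ge0.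
  + by apply: integral_ge0 => t _; exact: poweR_ge0.
- exact: measurable_EFin_powR.
- by move=> t _; exact: poweR_ge0.
- by rewrite lee_fin powR_ge0.
Qed.

Lemma Lnorm_le_integral f (e : R) : (0 <= e)%R -> (forall t, 0 <= f t) ->
  (Lnorm mu p%:E f <= e%:E) = (\int[mu]_t (f t `^ p) <= (e `^ p)%:E).
Proof.
move=> e0 f0; rewrite ge0_LnormE//.
have I0 : 0 <= \int[mu]_t (f t `^ p) by apply: integral_ge0 => t _; exact: poweR_ge0.
apply/idP/idP => h.
- have -> : \int[mu]_t (f t `^ p) = ((\int[mu]_t (f t `^ p)) `^ p^-1) `^ p.
    by rewrite -poweRrM mulVf ?gt_eqF// poweRe1.
  rewrite -poweR_EFin; apply: gt0_ler_poweR => //; first exact: (ltW p0).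
    by rewrite in_itv/= leey andbT poweR_ge0.
  by rewrite in_itv/= leey andbT lee_fin.
- have -> : e%:E = (e `^ p)%:E `^ p^-1.
    by rewrite poweR_EFin -powRrM mulfV ?gt_eqF// powRr1.
  apply: gt0_ler_poweR => //; first by rewrite invr_ge0 (ltW p0).
    by rewrite in_itv/= leey andbT.
  by rewrite in_itv/= leey andbT lee_fin powR_ge0.
Qed.

(** Fatou's lemma for h n ^ p.  Where f is positive, powers are continuous; where f
    vanishes, there is nothing to prove. *)
Lemma Lnorm_fatou f (h : nat -> T -> R) (e : R) : (0 <= e)%R ->
  (forall t, 0 <= f t) -> (forall t, f t \is a fin_num) ->
  (forall n, measurable_fun setT (h n)) -> (forall n t, (0 <= h n t)%R) ->
  {ae mu, forall t, (h n t)%:E @[n --> \oo] --> f t} ->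
  (forall n, Lnorm mu p%:E (EFin \o h n) <= e%:E) -> Lnorm mu p%:E f <= e%:E.
Proof.
move=> e0 f0 ff mh h0 hf he; rewrite Lnorm_le_integral//.
have mhp n : measurable_fun setT (fun t => (h n t)%:E `^ p).
  exact: measurable_EFin_powR.
have hp0 n t : setT t -> 0 <= (h n t)%:E `^ p by move=> _; exact: poweR_ge0.
apply: (@le_trans _ _ (\int[mu]_t limn_einf (fun n => (h n t)%:E `^ p))).
  apply: ae_le_lower_integral => //.
  - rewrite (_ : (fun t => _) = \- (fun t => limn_esup (fun n => - ((h n t)%:E `^ p)))).
      apply: measurableT_comp => //; apply: measurable_fun_limn_esup => n.
      exact: measurableT_comp.
    by apply/funext => t /=; rewrite -limn_einfN; congr limn_einf; apply/funext => n; exact: esym (oppeK _).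
  - by move=> t _; exact: poweR_ge0.
  - by move=> t _; apply: limn_einf_ge0 => n; exact: poweR_ge0.
  - apply: filterS hf => t hf _.
    have [ft0|ftn0] := eqVneq (f t) 0.
      rewrite ft0 poweR0r ?gt_eqF//.
      by apply: limn_einf_ge0 => n; exact: poweR_ge0.
    have fte : f t = (fine (f t))%:E by rewrite fineK.
    have ft0 : (0 < fine (f t))%R by rewrite fine_gt0// lt0e ftn0 f0 ltey_eq ff.
    have hc : h n t @[n --> \oo] --> fine (f t).
      by move: hf; rewrite fte; exact: fine_cvg.
    have := cvg_comp _ _ hc (powR_continuous_pos (a := p) ft0) => hcp.
    have {}hcp : (h n t)%:E `^ p @[n --> \oo] --> (f t) `^ p.
      by rewrite fte; apply: cvg_EFin; [exact: nearW|exact: hcp].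
    by have [-> _] := cvg_limn_einf_sup hcp.
apply: (le_trans (fatou mu measurableT mhp hp0)).
have hb n : \int[mu]_t ((h n t)%:E `^ p) <= (e `^ p)%:E.
  by rewrite -(Lnorm_le_integral (f := EFin \o h n))// => t; rewrite lee_fin.
apply: (le_trans (limn_einf_sup _)).
rewrite limn_esup_lim; apply: lime_le; first exact: is_cvg_esups.
apply: nearW => n; apply: ge_ereal_sup => _ [m _ <-]; exact: hb.
Qed.

(** Pointwise h n <= 2^(-n) + 2^(n(p-1)) (h n)^p, whichever of h n and 2^(-n) is larger.
    The integrals of the last terms are at most 2^(-n), so these terms are summable
    almost everywhere; the measure may be infinite. *)
Lemma Lnorm_summable (h : nat -> T -> R) :
  (forall n, measurable_fun setT (h n)) -> (forall n t, (0 <= h n t)%R) ->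
  (forall n, Lnorm mu p%:E (EFin \o h n) <= (4^-1 ^+ n)%:E) ->
  {ae mu, forall t, cvgn (series (fun n => h n t))}.
Proof.
move=> mh h0 he.
pose c n : R := ((2 ^+ n) `^ (p - 1))%R.
have c0 n : (0 <= c n)%R by exact: powR_ge0.
pose u n t := (c n * h n t `^ p)%:E.
have mu_ n : measurable_fun setT (u n).
  apply/measurable_EFinP; apply: measurable_funM => //.
  exact: (measurableT_comp (measurable_powR p)).
have u0 n t : 0 <= u n t by rewrite lee_fin mulr_ge0// powR_ge0.
pose F t := \sum_(n <oo) u n t.
have F0 t : 0 <= F t by apply: nneseries_ge0 => n _ _; exact: u0.
have mF : measurable_fun setT F.
  by apply: ge0_emeasurable_sum => n *; [exact: u0|exact: mu_].
have intu n : \int[mu]_t u n t <= (2^-1 ^+ n)%:E.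
  rewrite /u; under eq_integral do rewrite EFinM.
  rewrite ge0_integralZl_EFin//; last 2 first.
  - by move=> t _; rewrite lee_fin powR_ge0.
  - by apply/measurable_EFinP; exact: (measurableT_comp (measurable_powR p)).
  have q0 : (0 <= 4^-1 ^+ n :> R)%R by rewrite exprn_ge0.
  have h0' t : 0 <= (EFin \o h n) t by rewrite lee_fin.
  have := he n; rewrite (Lnorm_le_integral q0 h0') => hb.
  apply: (@le_trans _ _ ((c n)%:E * ((4^-1 ^+ n) `^ p)%:E)).
    by apply: lee_wpmul2l; rewrite ?lee_fin// (le_trans _ hb).
  rewrite -EFinM lee_fin /c.
  have t0 : (0 < 2 ^+ n :> R)%R by rewrite exprn_gt0.
  have -> : (4^-1 ^+ n = (2 ^+ n) `^ (- 2) :> R)%R.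
    rewrite powRN powR_mulrn ?(ltW t0)// exprVn; congr (_^-1)%R.
    by rewrite -exprM mulnC exprM; congr (_ ^+ n)%R; ring.
  have -> : (2^-1 ^+ n = (2 ^+ n) `^ (- 1) :> R)%R.
    by rewrite powRN powRr1 ?(ltW t0)// exprVn.
  rewrite -powRrM -powRD_gt0//.
  rewrite ler_powR//; first by rewrite exprn_ege1// ler1n.
  have : (0 < p)%R by exact: p0.
  lra.
have intF : \int[mu]_t F t < +oo.
  rewrite integral_nneseries//.
  apply: (@le_lt_trans _ _ (\sum_(n <oo) (2^-1 ^+ n)%:E)).
    apply: lee_nneseries => [n _ _|n _]; last exact: intu.
    by apply: integral_ge0 => t _.
  apply: (@le_lt_trans _ _ 2%:E); last exact: ltry.
  apply: lime_le; first by apply: is_cvg_nneseries => n _ _; rewrite lee_fin exprn_ge0.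
  by apply: nearW => n; rewrite sumEFin lee_fin sum_half_le.
have Foo : {ae mu, forall t, setT t -> F t \is a fin_num}.
  apply: integrable_ae => //; apply/integrableP; split => //.
  by under eq_integral do rewrite gee0_abs//.
apply: filterS Foo => t /(_ I) Ft.
apply: nondecreasing_is_cvgn.
  by apply: nondecreasing_series => n _ _; exact: h0.
exists (2 + fine (F t))%R => _ [n _ <-].
apply: (@le_trans _ _ (\sum_(0 <= k < n) (2^-1 ^+ k + c k * h k t `^ p))%R).
  rewrite /series/=; apply: ler_sum => k _.
  have [hk|hk] := leP (h k t) (2^-1 ^+ k)%R.
    by rewrite (le_trans hk)// lerDl mulr_ge0// powR_ge0.
  apply: (@le_trans _ _ (c k * h k t `^ p)%R); last by rewrite lerDr exprn_ge0.
  have hk0 : (0 < h k t)%R by apply: lt_trans hk; rewrite exprn_gt0// invr_gt0.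
  have -> : (h k t `^ p = h k t `^ (p - 1) * h k t)%R.
    by rewrite mulrC mulr_powRB1// (ltW hk0).
  rewrite /c mulrA -powRM ?(ltW hk0) ?exprn_ge0//.
  rewrite -[leLHS]mul1r ler_pM2r// -[leLHS](powRr0 (2 ^+ k * h k t)%R).
  rewrite ler_powR ?subr_ge0//.
  rewrite exprVn in hk; rewrite mulrC -ler_pdivrMr ?exprn_gt0// mul1r.
  exact: (ltW hk).
rewrite big_split; apply: lerD; first exact: sum_half_le.
rewrite -lee_fin fineK// -sumEFin; apply: nneseries_lim_ge => k _ _; exact: u0.
Qed.

End Lp_seminorm.

(** * Completeness of spaces of p-integrable functions *)

(** What the Riesz-Fischer theorem requires from a notion of measurability.  In mc_lim
    the limit may have to be modified on a null set: a limit almost everywhere of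
    measurable real functions need not be measurable. *)
Record measurability_class d (T : measurableType d) (R : realType)
    (mu : {measure set T -> \bar R}) (E : lmodType R) (V : set E) (N : E -> \bar R)
    (M : set (T -> E)) : Prop := MeasurabilityClass {
  mc_val : forall X t, M X -> V (X t) ;
  mc0 : M 0 ;
  mcD : forall X Y, M X -> M Y -> M (X + Y) ;
  mcZ : forall a X, M X -> M (a *: X) ;
  mc_norm : forall X, M X -> exists h, represented_by mu (fun t => N (X t)) h ;
  mc_lim : forall (X : nat -> T -> E) Y, (forall n, M (X n)) -> (forall t, V (Y t)) ->
    {ae mu, forall t, N (Y t - X n t)%R @[n --> \oo] --> 0%E} ->
    exists2 Z, M Z & {ae mu, forall t, N (Z t - Y t)%R = 0%E} }.

Section Lp_space.
Context d (T : measurableType d) (R : realType) (mu : {measure set T -> \bar R}).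
Context {E : lmodType R} {V : set E} {N : E -> \bar R} {M : set (T -> E)} {p : R}.
Hypothesis SN : seminormed V N.
Hypothesis MC : measurability_class mu V N M.
Hypothesis p1 : 1 <= p.

Definition Lp_norm (X : T -> E) : \bar R := Lnorm mu p%:E (fun t => N (X t)).

Definition Lp_space : set (T -> E) := [set X | M X /\ (Lp_norm X < +oo)%E].

Let p0 : 0 < p. Proof. exact: lt_le_trans p1. Qed.

Let N0 (X : T -> E) t : (0 <= N (X t))%E. Proof. exact: (snN_ge0 SN). Qed.

Lemma Lp_norm_le_D (X Y Z : T -> E) : M X -> M Y ->
  {ae mu, forall t, (N (Z t) <= N (X t) + N (Y t))%E} ->
  (Lp_norm Z <= Lp_norm X + Lp_norm Y)%E.
Proof.
move=> /(mc_norm MC)[h hX] /(mc_norm MC)[k kY].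
by move=> ?; apply: (ae_LnormD p1 _ _ _ hX kY).
Qed.

Lemma Lp_norm_ae_le (X Y : T -> E) : M Y ->
  {ae mu, forall t, (N (X t) <= N (Y t))%E} -> (Lp_norm X <= Lp_norm Y)%E.
Proof. by move=> /(mc_norm MC)[k kY] ?; apply: (ae_le_Lnorm p1 _ _ kY). Qed.

Lemma Lp_seminormed : seminormed Lp_space Lp_norm.
Proof.
have D (X Y : T -> E) : Lp_space X -> Lp_space Y -> (Lp_norm (X + Y)%R <= Lp_norm X + Lp_norm Y)%E.
  move=> [MX _] [MY _]; apply: Lp_norm_le_D => //.
  by apply: aeW => t; apply: (snN_D SN); exact: (mc_val MC).
have Z a (X : T -> E) : Lp_space X -> Lp_norm (a *: X) = (`|a|%:E * Lp_norm X)%E.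
  move=> [MX _]; have [h hX] := mc_norm MC MX.
  rewrite /Lp_norm -(ge0_LnormZ p1 (normr_ge0 a) _ hX)//; apply: eq_Lnorm => t.
  by rewrite (snN_Z SN)//; exact: (mc_val MC).
split => //.
- split; first exact: (mc0 MC).
  rewrite /Lp_norm (_ : (fun _ => _) = cst 0%E); last by apply/funext => t; exact: (snN0 SN).
  by rewrite Lnorm0// eqe gt_eqF.
- move=> X Y hX hY; split; first by apply: (mcD MC); [case: hX|case: hY].
  by apply: (le_lt_trans (D _ _ hX hY)); rewrite lte_add_pinfty//; [case: hX|case: hY].
- move=> a X hX; split; first by apply: (mcZ MC); case: hX.
  by rewrite Z// lte_mul_pinfty//; case: hX.
- by move=> X; exact: Lnorm_ge0.
- by move=> X [].
Qed.

Lemma pointwise_cauchy_cvg (u : nat -> E) (h : nat -> R) : seminorm_complete V N ->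
  (forall n, V (u n)) -> (forall n, N (u n.+1 - u n)%R = (h n)%:E) ->
  cvgn (series h) -> exists2 x, V x & N (x - u n)%R @[n --> \oo] --> 0%E.
Proof.
move=> VC Vu uh ch; apply: VC => // e e0.
have le_series m k : (N (u (m + k)%N - u m)%R <= (series h (m + k)%N - series h m)%:E)%E.
  elim: k => [|k IH]; first by rewrite addn0 !subrr (snN0 SN).
  apply: (le_trans (snN_tri SN (Vu _) (Vu (m + k)%N) (Vu _))).
  rewrite addnS uh /series/= big_nat_recr//= (addrC _ (h _)) -addrA EFinD.
  by apply: leeD => //; exact: IH.
have e20 : 0 < e / 2 by rewrite divr_gt0.
move/cvgrPdist_le : ch => /(_ _ e20)[n0 _ hn0].
have lim_e m n : (n0 <= m)%N -> (n0 <= n)%N -> (series h n - series h m <= e).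
  move=> /hn0 /= hm /hn0 /= hn; rewrite (splitr e) -(subrKA (limn (series h))).
  apply: lerD; apply: le_trans (ler_norm _) _ => //; by rewrite distrC.
have mn_e m n : (n0 <= m)%N -> (m <= n)%N -> (N (u n - u m)%R <= e%:E)%E.
  move=> n0m mn; rewrite -(subnKC mn); apply: (le_trans (le_series _ _)).
  by rewrite lee_fin lim_e// (leq_trans n0m) ?leq_addr.
exists n0 => m n n0m n0n; have [mn|nm] := leqP m n; last exact: mn_e (ltnW nm).
by rewrite (snN_subC SN)//; exact: mn_e.
Qed.

(** A subsequence with increments at most 4^(-k) converges almost everywhere by
    [Lnorm_summable]; Fatou's lemma shows that its limit is the limit in Lp. *)
Lemma Lp_complete : seminorm_complete V N -> seminorm_complete Lp_space Lp_norm.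
Proof.
move=> VC u uL uC; have LSN := Lp_seminormed.
have Mu n : M (u n) by case: (uL n).
have /choice[n_ n_P] : forall k, exists n, forall i j, (n <= i)%N -> (n <= j)%N ->
    (Lp_norm (u i - u j)%R <= (4^-1 ^+ k)%:E)%E.
  by move=> k; apply: uC; rewrite exprn_gt0// invr_gt0.
(* Partial sums of n_ form a nondecreasing sequence of ranks above n_. *)
pose m_ k := (\sum_(i < k.+1) n_ i)%N.
have nm k : (n_ k <= m_ k)%N by rewrite /m_ big_ord_recr/= leq_addl.
have mS k : (m_ k <= m_ k.+1)%N by rewrite /m_ [leqRHS]big_ord_recr/= leq_addr.
have mM k l : (k <= l)%N -> (m_ k <= m_ l)%N.
  by move=> /subnK <-; elim: (l - k)%N => // i; rewrite addSn => /leq_trans; apply.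
pose v k := u (m_ k).
have Mv k : M (v k) by exact: Mu.
have MB X Y : M X -> M Y -> M (X - Y).
  by move=> MX MY; rewrite -(scaleN1r Y); apply: (mcD MC) => //; exact: (mcZ MC).
have /choice[h hP] : forall k, exists h, represented_by mu (fun t => N (v k.+1 t - v k t)%R) h.
  by move=> k; apply: (mc_norm MC (X := v k.+1 - v k)); exact: MB.
have hs : {ae mu, forall t, cvgn (series (fun k => h k t))}.
  apply: (Lnorm_summable p1).
  - by move=> k; have [] := hP k.
  - by move=> k; have [] := hP k.
  - move=> k; rewrite -(represented_Lnorm p1 _ (hP k)); last exact: (N0 (v k.+1 - v k)).
    by apply: n_P; rewrite ?nm// (leq_trans (nm k)).
have hE : {ae mu, forall t k, N (v k.+1 t - v k t)%R = (h k t)%:E}.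
  by apply: ae_foralln => k; have [] := hP k.
have /choice[x xP] : forall t, exists x, V x /\
    (cvgn (series (fun k => h k t)) -> (forall k, N (v k.+1 t - v k t)%R = (h k t)%:E) ->
     N (x - v k t)%R @[k --> \oo] --> 0%E).
  move=> t.
  have [[hc he]|nh] := pselect (cvgn (series (fun k => h k t)) /\
     (forall k, N (v k.+1 t - v k t)%R = (h k t)%:E)); last first.
    exists 0; split => [|hc he]; first exact: (sn0 SN).
    by exfalso; apply: nh.
  have [x Vx xv] := pointwise_cauchy_cvg VC (fun k => mc_val MC t (Mv k)) he hc.
  by exists x.
have xv : {ae mu, forall t, N (x t - v k t)%R @[k --> \oo] --> 0%E}.
  by apply: filterS2 hs hE => t hc he; have [_] := xP t; apply.
have Vx t : V (x t) by have [] := xP t.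
have [y My yx] := mc_lim MC Mv Vx xv.
have Vy t : V (y t) by exact: (mc_val MC).
have Vu n t : V (u n t) by exact: (mc_val MC).
have yv : {ae mu, forall t, N (y t - v k t)%R @[k --> \oo] --> 0%E}.
  apply: filterS2 yx xv => t yx; apply: cvg_trans.
  rewrite [X in X @ _](_ : _ = (fun k => N (x t - v k t)%R))//; apply/funext => k.
  have V1 := snB SN (Vx t) (mc_val MC t (Mv k)).
  have V2 := snB SN (Vy t) (mc_val MC t (Mv k)).
  by apply: (snN_eq0_eq SN V2 V1); rewrite opprB addrA subrK.
have key k n : (n_ k <= n)%N -> (Lp_norm (y - u n)%R <= (4^-1 ^+ k)%:E)%E.
  move=> kn.
  have /choice[g gP] : forall j, exists g, represented_by mu (fun t => N (v (j + k)%N t - u n t)%R) g.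
    by move=> j; apply: (mc_norm MC (X := v (j + k)%N - u n)); exact: MB.
  apply: (Lnorm_fatou p1 (h := g)).
  - by rewrite exprn_ge0.
  - by move=> t; exact: N0.
  - by move=> t; rewrite (snN_fin SN)//; exact: (snB SN).
  - by move=> j; have [] := gP j.
  - by move=> j; have [] := gP j.
  - have gE : {ae mu, forall t j, N (v (j + k)%N t - u n t)%R = (g j t)%:E}.
      by apply: ae_foralln => j; have [] := gP j.
    apply: filterS2 gE yv => t gE yv; under eq_fun do rewrite -gE.
    have V1 := snB SN (Vy t) (Vu n t).
    have V2 j := snB SN (Vu (m_ (j + k)) t) (Vu n t).
    apply: (cvg_snN SN V1 V2).
    rewrite (_ : (fun j => _) = (fun j => N (y t - v (j + k)%N t)%R)); last first.
      by apply/funext => j; rewrite opprB addrA subrK.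
    by rewrite (cvg_shiftn k (fun k => N (y t - v k t)%R)).
  - move=> j; rewrite -(represented_Lnorm p1 _ (gP j)); last exact: (N0 (v (j + k)%N - u n)).
    by apply: n_P => //; rewrite (leq_trans (nm k))// mM// leq_addl.
have Ly : Lp_space y.
  split => //; have k0 := key 0%N _ (leqnn _).
  have := @Lp_norm_le_D (y - u (n_ 0%N)) (u (n_ 0%N)) y (MB _ _ My (Mu _)) (Mu _).
  move=> /(_ _)/le_lt_trans; apply.
    apply: aeW => t; rewrite -{1}(subrK (u (n_ 0%N) t) (y t)).
    by apply: (snN_D SN) => //; exact: (snB SN).
  rewrite lte_add_pinfty//; last by case: (uL (n_ 0%N)).
  by apply: (le_lt_trans k0); rewrite ltry.
exists y => //; apply/cvge0P => [n|e e0]; first exact: (snN_ge0 LSN).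
have [k ke] : exists k, 4^-1 ^+ k <= e.
  have q1 : `|4^-1 : R| < 1 by rewrite ger0_norm// invf_lt1// ltr1n.
  have /cvgr0Pnorm_le/(_ e e0)[k _ hk] := cvg_expr q1; exists k.
  by have := hk k (leqnn k); rewrite /= ger0_norm// exprn_ge0.
exists (n_ k) => // n kn; apply: (le_trans (key k n kn)).
by rewrite lee_fin.
Qed.

End Lp_space.

(** * Random variables with values in a seminormed space *)
Section strongly_measurable_class.
Context d (T : measurableType d) (R : realType) (mu : {measure set T -> \bar R}).
Context {E : lmodType R} {V : set E} {N : E -> \bar R}.
Hypothesis SN : seminormed V N.
Local Notation SM := (strongly_measurable mu V N setT).

Lemma strongly_measurable_represented (X : T -> E) : SM X ->
  exists h, represented_by mu (fun t => N (X t)) h.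
Proof.
move=> SX; have [VX _] := SX; have [h [mh h0 hX]] := strongly_measurable_norm SN SX.
exists (fine \o h); split.
- exact: measurableT_comp.
- by move=> t /=; rewrite fine_ge0.
- apply: filterS hX => t /(_ I) hX; rewrite /= -hX fineK// (snN_fin SN)//; exact: VX.
Qed.

(** For each n a step function s n (k_ n) is chosen such that the integral of
    min (1, N (X n - s n (k_ n))) is at most 4^(-n), which is possible by dominated
    convergence on a finite measure space.  These functions are then summable almost
    everywhere, hence tend to 0, and s n (k_ n) converges to Y. *)
Lemma strongly_measurable_lim (X : nat -> T -> E) (Y : T -> E) : (mu setT < +oo)%E ->
  (forall n, SM (X n)) -> (forall t, V (Y t)) ->
  {ae mu, forall t, N (Y t - X n t)%R @[n --> \oo] --> 0%E} -> SM Y.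
Proof.
move=> muoo SX VY XY; split => [t _//|].
have VX n t : V (X n t) by have [VX _] := SX n; exact: VX.
have /choice[s sP] : forall n, exists s : nat -> step T E, (forall k, simple_step V (s k)) /\
    {ae mu, forall t, setT t -> N (X n t - step_fun (s k) t)%R @[k --> \oo] --> 0%E}.
  by move=> n; have [_] := SX n.
have Vs n k t : V (step_fun (s n k) t).
  by apply: (step_fun_in SN); have [Vs _] := sP n.
have /choice[g gP] : forall nk : nat * nat, exists g,
    represented_by mu (fun t => N (X nk.1 t - step_fun (s nk.1 nk.2) t)%R) g.
  move=> [n k] /=; apply: strongly_measurable_represented.
  by apply: (strongly_measurableB SN) => //; apply: (strongly_measurable_step mu SN);
    have [Vsn _] := sP n.
pose h n k t := Num.min 1 (g (n, k) t).
have mh n k : measurable_fun setT (h n k).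
  by apply: measurable_minr => //; have [] := gP (n, k).
have h0 n k t : 0 <= h n k t.
  by rewrite le_min ler01/=; have [_ g0 _] := gP (n, k); exact: g0.
have gE : {ae mu, forall t n k, N (X n t - step_fun (s n k) t)%R = (g (n, k) t)%:E}.
  by apply: ae_foralln => n; apply: ae_foralln => k; have [] := gP (n, k).
have int_cvg n : (\int[mu]_t (h n k t)%:E)%E @[k --> \oo] --> 0%E.
  have mhE k : measurable_fun setT (fun t => (h n k t)%:E) by apply/measurable_EFinP.
  have hc : {ae mu, forall t, setT t -> (h n k t)%:E @[k --> \oo] --> cst 0%E t}.
    have [_ sn] := sP n; apply: filterS2 sn gE => t /(_ I) + gE _.
    under eq_fun do rewrite gE.
    apply: cvge0_le => k; first by rewrite lee_fin.
    by rewrite lee_fin ge_min lexx orbT.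
  have int1 : mu.-integrable setT (fun=> 1%E : \bar R).
    apply/integrableP; split => //.
    by under eq_integral do rewrite abse1; rewrite integral_cst// mul1e.
  have hle : {ae mu, forall t k, setT t -> (`|(h n k t)%:E| <= 1)%E}.
    by apply: aeW => t k _; rewrite gee0_abs ?lee_fin// ge_min lexx.
  have [_ _] := dominated_convergence measurableT mhE (measurable_cst _) hc int1 hle.
  by rewrite integral0.
have /choice[k_ k_P] : forall n, exists k, (\int[mu]_t (h n k t)%:E <= (4^-1 ^+ n)%:E)%E.
  move=> n; have i0 k : (0 <= \int[mu]_t (h n k t)%:E)%E.
    by apply: integral_ge0 => t _; rewrite lee_fin.
  have q0 : 0 < 4^-1 ^+ n :> R by rewrite exprn_gt0// invr_gt0.
  have /(cvge0P i0)/(_ _ q0)[k _ hk] := int_cvg n.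
  by exists k; apply: hk => /=.
have hs : {ae mu, forall t, cvgn (series (fun n => h n (k_ n) t))}.
  apply: (Lnorm_summable (lexx 1)) => // n.
  by rewrite Lnorm1; under eq_integral do rewrite gee0_abs ?lee_fin/=//; exact: k_P.
exists (fun n => s n (k_ n)); split; first by move=> n; have [] := sP n.
apply: filterS3 hs gE XY => t hs gE XY _.
apply: (@cvge0_le _ _ (fun n => N (Y t - X n t)%R + N (X n t - step_fun (s n (k_ n)) t)%R)%E).
- by move=> n; exact: (snN_ge0 SN).
- by move=> n; apply: (snN_tri SN).
rewrite -[X in _ --> X]adde0; apply: cvgeD => //.
apply/cvge0P => [n|e e0]; first exact: (snN_ge0 SN).
pose e' := Num.min e (2^-1).
have e'0 : 0 < e' by rewrite lt_min e0 invr_gt0/=.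
have /cvgr0Pnorm_le/(_ e' e'0) := cvg_series_cvg_0 hs.
apply: filterS => n; rewrite /= ger0_norm// gE lee_fin /h ge_min => /orP[h1|].
  have := le_trans h1 (_ : e' <= 2^-1); rewrite ge_min lexx orbT => /(_ isT).
  by rewrite leNgt invf_lt1// ltr1n.
by move/le_trans; apply; rewrite ge_min lexx.
Qed.

Lemma strongly_measurable_measurability_class : (mu setT < +oo)%E ->
  measurability_class mu V N SM.
Proof.
move=> muoo; split.
- by move=> X t [VX _]; exact: VX.
- exact: (strongly_measurable_cst mu SN setT (sn0 SN)).
- by move=> X Y SX SY; exact: (strongly_measurableD SN).
- by move=> a X SX; exact: (strongly_measurableZ SN).
- exact: strongly_measurable_represented.
- move=> X Y SX VY XY; exists Y; first exact: strongly_measurable_lim XY.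
  by apply: aeW => t; rewrite subrr (snN0 SN).
Qed.

Variables (a C : R) (K : R -> E -> E) (p : R).
Hypotheses (SK : singular_kernel V N a C K) (C0 : 0 <= C) (p1 : 1 <= p).
Hypothesis muoo : (mu setT < +oo)%E.

Lemma strongly_measurable_kernel r (X : T -> E) : 0 < r -> SM X -> SM (fun t => K r (X t)).
Proof.
move=> r0 [VX [s [Vs sX]]]; split => [t Dt|]; first by apply: (sk_in SK) => //; exact: VX.
exists (fun n => step_map (K r) (s n)); split => [n|].
  by apply: simple_step_map => // x; exact: (sk_in SK).
apply: filterS sX => t sX Dt; have VXt := VX _ Dt.
apply: (@cvge0_le _ _ (fun n => (C * r `^ (a - 1))%:E * N (X t - step_fun (s n) t)%R)%E).
- by move=> n; exact: (snN_ge0 SN).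
- by move=> n; exact: (sk_step_le SN SK).
- by rewrite -[X in _ --> X](mule0 (C * r `^ (a - 1))%:E); apply: cvgeZl => //; exact: sX.
Qed.

Local Notation LV := (Lp_space mu (N := N) (M := SM) (p := p)).
Local Notation LN := (Lp_norm mu (N := N) (p := p)).

Let MC := strongly_measurable_measurability_class muoo.
Let LSN := Lp_seminormed SN MC p1.

Lemma Lp_norm_le_scale (X Y : T -> E) (c : R) : 0 <= c -> LV X ->
  (forall t, (N (Y t) <= c%:E * N (X t))%E) ->
  (LN Y <= c%:E * LN X)%E.
Proof.
move=> c0 LX XY; have [MX _] := LX.
have -> : c%:E = `|c|%:E by rewrite ger0_norm.
rewrite -(snN_Z LSN c LX); apply: (Lp_norm_ae_le SN MC p1); first exact: (mcZ MC).
by apply: aeW => t; rewrite (snN_Z SN) ?ger0_norm//; exact: (mc_val MC).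
Qed.

Lemma Lp_norm_eq0 (X : T -> E) : (forall t, N (X t) = 0%E) ->
  LN X = 0%E.
Proof.
move=> X0; rewrite /Lp_norm (_ : (fun _ => _) = cst 0%E); last exact/funext.
by rewrite Lnorm0// eqe gt_eqF// (lt_le_trans ltr01).
Qed.

(** Each bound on K r x is linear in N x, so it holds pointwise and is preserved by the
    Lp norm. *)
Lemma Lp_singular_kernel :
  singular_kernel LV LN a C
    (fun r X t => K r (X t)).
Proof.
have cr r : 0 <= C * r `^ (a - 1) by rewrite mulr_ge0// powR_ge0.
have le r (X : T -> E) : 0 < r -> LV X ->
    (LN (fun t => K r (X t)) <=
     (C * r `^ (a - 1))%:E * LN X)%E.
  move=> r0 LX; apply: Lp_norm_le_scale => // t.
  by apply: (sk_le SK) => //; have [MX _] := LX; exact: (mc_val MC).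
split => //.
- move=> r X r0 LX; split; first by apply: strongly_measurable_kernel => //; case: LX.
  by apply: (le_lt_trans (le r X r0 LX)); rewrite lte_mul_pinfty ?lee_fin//; case: LX.
- move=> r X Y r0 [MX _] [MY _]; apply: Lp_norm_eq0 => t.
  by apply: (sk_D SK) => //; exact: (mc_val MC).
- move=> r b X r0 [MX _]; apply: Lp_norm_eq0 => t.
  by apply: (sk_Z SK) => //; exact: (mc_val MC).
- move=> r1 r2 th X r10 r12 th01 LX; apply: Lp_norm_le_scale => //.
    by rewrite !mulr_ge0// powR_ge0.
  by move=> t; apply: (sk_holder SK) => //; have [MX _] := LX; exact: (mc_val MC).
Qed.

End strongly_measurable_class.

(** * Multipliers along an orthonormal basis *)
Record inner_product (R : realType) (E : lmodType R) (V : set E) (N : E -> \bar R)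
    (ip : E -> E -> R) : Prop := InnerProduct {
  ipC : forall x y, V x -> V y -> ip x y = ip y x ;
  ipD : forall x y z, V x -> V y -> V z -> ip (x + y) z = ip x z + ip y z ;
  ipZ : forall a x z, V x -> V z -> ip (a *: x) z = a * ip x z ;
  ipN : forall x, V x -> N x = (Num.sqrt (ip x x))%:E }.

Section multipliers.
Context {R : realType} {E : lmodType R} {V : set E} {N : E -> \bar R} {ip : E -> E -> R}.
Variable phi : nat -> E.
Hypothesis SN : seminormed V N.
Hypothesis IP : inner_product V N ip.
Hypothesis Vphi : forall k, V (phi k).
Hypothesis phi_orthonormal : forall j k, ip (phi j) (phi k) = (j == k)%:R.

Lemma ip_sum m n (b : nat -> R) y : V y ->
  ip (\sum_(m <= k < n) b k *: phi k) y = \sum_(m <= k < n) b k * ip (phi k) y.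
Proof.
move=> Vy; elim: (index_iota m n) => [|k r IH].
  by rewrite !big_nil -(scale0r (phi 0%N)) (ipZ IP)// mul0r.
rewrite !big_cons (ipD IP) ?(ipZ IP) ?IH//; first exact: (snZ SN).
by apply: (sn_sum SN) => i _; exact: (snZ SN).
Qed.

Lemma orthonormal_norm m n (b : nat -> R) :
  N (\sum_(m <= k < n) b k *: phi k) = (Num.sqrt (\sum_(m <= k < n) b k ^+ 2))%:E.
Proof.
have VS : V (\sum_(m <= k < n) b k *: phi k).
  by apply: (sn_sum SN) => i _; exact: (snZ SN).
rewrite (ipN IP)// ip_sum//; congr (Num.sqrt _)%:E.
apply: eq_big_nat => j jmn; rewrite expr2; congr (_ * _).
rewrite (ipC IP)// ip_sum// -[RHS](_ : (if (m <= j < n)%N then b j else 0) = b j); last by rewrite jmn.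
rewrite -(big_nat1_eq +%R) [RHS]big_mkcond/=; apply: eq_bigr => k _.
by rewrite phi_orthonormal; case: eqVneq => _; rewrite ?mulr1 ?mulr0.
Qed.

(** By Pythagoras both norms are sums of squares of coefficients. *)
Lemma orthonormal_norm_le m n (b c : nat -> R) (B : R) : 0 <= B ->
  (forall k, `|b k| <= B * `|c k|) ->
  (N (\sum_(m <= k < n) b k *: phi k)%R <= B%:E * N (\sum_(m <= k < n) c k *: phi k)%R)%E.
Proof.
move=> B0 bc; rewrite !orthonormal_norm -EFinM lee_fin.
have -> : B = Num.sqrt (B ^+ 2) by rewrite sqrtr_sqr ger0_norm.
rewrite -sqrtrM ?exprn_ge0//; apply: ler_wsqrtr; rewrite mulr_sumr.
apply: ler_sum => k _; rewrite -exprMn -[leLHS]real_normK ?num_real//.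
rewrite -[leRHS]real_normK ?num_real// normrM (ger0_norm B0).
by rewrite lerXn2r ?nnegrE ?mulr_ge0.
Qed.

(** v represents the sum of the m k <f, phi k> phi k.  A relation is used because sums
    of series are only determined up to N. *)
Definition is_multiplier (m : nat -> R) (f v : E) := V v /\
  N (\sum_(k < n) (m k * ip f (phi k)) *: phi k - v)%R @[n --> \oo] --> 0%E.

Let VP (m : nat -> R) (f : E) n : V (\sum_(k < n) (m k * ip f (phi k)) *: phi k).
Proof. by apply: (sn_sum SN) => i _; exact: (snZ SN). Qed.

Let dist_le (u1 u2 u3 : nat -> E) (x y z : E) :
  (forall n, V (u1 n)) -> V x -> (forall n, V (u2 n)) -> V y ->
  (forall n, u3 n - z = (u1 n - x) + (u2 n - y)) ->
  N (u1 n - x)%R @[n --> \oo] --> 0%E -> N (u2 n - y)%R @[n --> \oo] --> 0%E ->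
  N (u3 n - z)%R @[n --> \oo] --> 0%E.
Proof.
move=> V1 Vx V2 Vy e c1 c2.
apply: (@cvge0_le _ _ (fun n => N (u1 n - x)%R + N (u2 n - y)%R)%E) => [n|n|].
- exact: (snN_ge0 SN).
- by rewrite e; apply: (snN_D SN); exact: (snB SN).
- by rewrite -[X in _ --> X]adde0; apply: cvgeD.
Qed.

Lemma is_multiplierD m f g v w : V f -> V g ->
  is_multiplier m f v -> is_multiplier m g w -> is_multiplier m (f + g) (v + w).
Proof.
move=> Vf Vg [Vv fv] [Vw gw]; split; first exact: (snD SN).
apply: (dist_le (fun n => VP m f n) Vv (fun n => VP m g n) Vw _ fv gw) => n.
rewrite addrACA -opprD -big_split/=; congr (_ - _); apply: eq_bigr => k _.
by rewrite (ipD IP)// mulrDr scalerDl.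
Qed.

(** Covers multiplication by a scalar of the symbol m as well as of the vector f. *)
Lemma is_multiplier_scale (c : R) m m' f g v : V f ->
  (forall k, m' k * ip g (phi k) = c * (m k * ip f (phi k))) ->
  is_multiplier m f v -> is_multiplier m' g (c *: v).
Proof.
move=> Vf mm [Vv fv]; split; first exact: (snZ SN).
rewrite (_ : (fun n => _) = (fun n => `|c|%:E *
    N (\sum_(k < n) (m k * ip f (phi k)) *: phi k - v)%R)%E).
  by rewrite -[X in _ --> X](mule0 `|c|%:E); apply: cvgeZl.
apply/funext => n; rewrite -(snN_Z SN); last exact: (snB SN (VP m f n) Vv).
rewrite scalerBr scaler_sumr; congr (N (_ - _)); apply: eq_bigr => k _.
by rewrite mm scalerA.
Qed.

Lemma is_multiplierB m m' f v w : V f -> is_multiplier m f v -> is_multiplier m' f w ->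
  is_multiplier (fun k => m k - m' k) f (v - w).
Proof.
move=> Vf [Vv fv] /(is_multiplier_scale (c := -1) Vf (m' := fun k => - m' k) (g := f)) h.
have [k|Vw fw] := h _; first by rewrite mulN1r mulNr.
rewrite -scaleN1r; split; first exact: (snD SN).
apply: (dist_le (fun n => VP m f n) Vv (fun n => VP (fun k => - m' k) f n) Vw _ fv fw) => n.
rewrite addrACA -opprD -big_split/=; congr (_ - _); apply: eq_bigr => k _.
by rewrite mulrDl scalerDl.
Qed.

Hypothesis phi_basis : forall f, V f ->
  N (\sum_(k < n) ip f (phi k) *: phi k - f)%R @[n --> \oo] --> 0%E.

(** The bound holds between the partial sums of m f and of f, which converge in norm. *)
Lemma multiplier_le m f v (B : R) : 0 <= B -> (forall k, `|m k| <= B) ->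
  V f -> is_multiplier m f v -> (N v <= B%:E * N f)%E.
Proof.
move=> B0 mB Vf [Vv fv].
have V1 n : V (\sum_(k < n) ip f (phi k) *: phi k).
  by apply: (sn_sum SN) => i _; exact: (snZ SN).
have c1 : N (\sum_(k < n) (m k * ip f (phi k)) *: phi k)%R @[n --> \oo] --> N v.
  apply: (cvg_snN SN Vv (fun n => VP m f n)).
  by under eq_fun => n do rewrite (snN_subC SN Vv (VP m f n)).
have c2 : N (\sum_(k < n) ip f (phi k) *: phi k)%R @[n --> \oo] --> N f.
  apply: (cvg_snN SN Vf V1).
  by under eq_fun => n do rewrite (snN_subC SN Vf (V1 n)); exact: phi_basis.
have c3 : (B%:E * N (\sum_(k < n) ip f (phi k) *: phi k)%R)%E @[n --> \oo] --> (B%:E * N f)%E.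
  exact: cvgeZl.
rewrite -(cvg_lim _ c1)// -(cvg_lim _ c3)//; apply: lee_lim.
- by apply/cvg_ex; exists (N v).
- by apply/cvg_ex; exists (B%:E * N f)%E.
apply: nearW => n; rewrite -!(big_mkord xpredT (fun k => (m k * ip f (phi k)) *: phi k)).
rewrite -!(big_mkord xpredT (fun k => ip f (phi k) *: phi k)).
by apply: orthonormal_norm_le => // k; rewrite normrM ler_wpM2r.
Qed.

Lemma multiplier_unique m f v w : V f ->
  is_multiplier m f v -> is_multiplier m f w -> N (v - w)%R = 0%E.
Proof.
move=> Vf fv fw; apply/eqP; rewrite eq_le (snN_ge0 SN) andbT -(mul0e (N f)).
apply: (multiplier_le _ _ Vf (is_multiplierB Vf fv fw)) => // k.
by rewrite subrr normr0.
Qed.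

(** The partial sums are Cauchy because those of f are. *)
Lemma multiplier_exists m f (B : R) : seminorm_complete V N -> 0 <= B ->
  (forall k, `|m k| <= B) -> V f -> exists v, is_multiplier m f v.
Proof.
move=> VC B0 mB Vf.
have V1 n : V (\sum_(k < n) ip f (phi k) *: phi k).
  by apply: (sn_sum SN) => i _; exact: (snZ SN).
have B10 : 0 < B + 1 by rewrite ltr_wpDl.
have le i j : (i <= j)%N -> (N (\sum_(k < j) (m k * ip f (phi k)) *: phi k -
    \sum_(k < i) (m k * ip f (phi k)) *: phi k)%R <= (B + 1)%:E *
    N (\sum_(k < j) ip f (phi k) *: phi k - \sum_(k < i) ip f (phi k) *: phi k)%R)%E.
  move=> ij; rewrite -!(big_mkord xpredT (fun k => (m k * ip f (phi k)) *: phi k)).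
rewrite -!(big_mkord xpredT (fun k => ip f (phi k) *: phi k)).
  rewrite !(big_cat_nat (leq0n i) ij)/= !(addrC (\sum_(0 <= k < i) _)) !addrK.
  apply: orthonormal_norm_le => [|k]; first exact: (ltW B10).
  by rewrite normrM ler_wpM2r// (le_trans (mB k))// lerDl.
have [|e e0|v Vv vP] := VC (fun n => \sum_(k < n) (m k * ip f (phi k)) *: phi k).
- by [].
- have nn n : (0 <= N (\sum_(k < n) ip f (phi k) *: phi k - f)%R)%E by exact: (snN_ge0 SN).
  have d0 : 0 < e / (B + 1) / 2 by rewrite !divr_gt0.
  have /(cvge0P nn)/(_ _ d0)[n0 _ hn0] := phi_basis Vf.
  exists n0.
  have main i j : (n0 <= i)%N -> (i <= j)%N ->
      (N (\sum_(k < j) (m k * ip f (phi k)) *: phi k -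
          \sum_(k < i) (m k * ip f (phi k)) *: phi k)%R <= e%:E)%E.
    move=> n0i ij; apply: (le_trans (le i j ij)).
    have -> : e = (B + 1) * (e / (B + 1)) by rewrite mulrCA divff ?mulr1// gt_eqF.
    rewrite EFinM; apply: lee_wpmul2l; first by rewrite lee_fin (ltW B10).
    apply: (le_trans (snN_tri SN (V1 j) Vf (V1 i))).
    rewrite (splitr (e / _)) EFinD; apply: leeD.
      by apply: hn0; rewrite /= (leq_trans n0i).
    by rewrite (snN_subC SN)//; exact: hn0.
  move=> i j n0i n0j; have [ij|ji] := leqP i j; last exact: main (ltnW ji).
  by rewrite (snN_subC SN)//; exact: main.
- exists v; split => //.
  by under eq_fun => n do rewrite -(snN_subC SN Vv (VP m f n)).
Qed.

End multipliers.

(** * The Hilbert space L^2(D) *)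
Section real_class.
Context d (T : measurableType d) (R : realType) (mu : {measure set T -> \bar R}).

Definition abs_norm (x : R^o) : \bar R := `|x|%:E.

Lemma abs_seminormed : seminormed [set: R^o] abs_norm.
Proof.
split => //.
- by move=> x; rewrite lee_fin.
- by move=> x _; rewrite ltry.
- by move=> x y _ _; rewrite -EFinD lee_fin ler_normD.
- by move=> a x _; rewrite /abs_norm normrM.
Qed.

Lemma abs_complete : seminorm_complete [set: R^o] abs_norm.
Proof.
move=> u _ uC.
have cu : cvgn (u : nat -> R).
  apply/cauchy_cvgP/cauchy_exP => e e0; have e20 : 0 < e / 2 by rewrite divr_gt0.
  have [n0 hn0] := uC _ e20; exists (u n0); exists n0 => // n /= n0n.
  rewrite /ball/=; have := hn0 n0 n (leqnn _) n0n; rewrite lee_fin => /le_lt_trans; apply.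
  by rewrite ltr_pdivrMr// ltr_pMr// ltr1n.
exists (limn (u : nat -> R)) => //; apply/cvge0P => [n|e e0]; first by rewrite lee_fin.
by move/cvgrPdist_le : cu => /(_ _ e0); apply: filterS => n; rewrite lee_fin.
Qed.

(** The limit superior of the sequence is measurable and equals the limit almost
    everywhere. *)
Lemma real_measurability_class :
  measurability_class mu [set: R^o] abs_norm (measurable_fun [set: T] : set (T -> R^o)).
Proof.
split => //.
- exact: measurable_cst.
- by move=> X Y mX mY; exact: (measurable_funD (f := X : T -> R) (g := Y : T -> R)).
- move=> a X mX; exact: (measurable_funM (f := cst a : T -> R) (g := X : T -> R)).
- move=> X mX; exists (fun t => `|X t : R|); apply: represented_EFin.
    exact: (measurableT_comp (f := @Num.norm R R)).
  by move=> t; exact: normr_ge0.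
move=> X Y mX _ XY.
exists (fun t => fine (limn_esup (fun n => (X n t)%:E)) : R^o).
  apply: measurableT_comp => //; apply: measurable_fun_limn_esup => n.
  by apply/measurable_EFinP.
apply: filterS XY => t XY.
have c : (X n t)%:E @[n --> \oo] --> (Y t : R)%:E.
  apply: cvg_EFin; first exact: nearW.
  apply/cvgrPdist_le => e e0.
  have nn n : (0 <= abs_norm (Y t - X n t)%R)%E by rewrite lee_fin.
  by have /(cvge0P nn)/(_ e e0) := XY; apply: filterS => n; rewrite lee_fin.
have [_ ->] := cvg_limn_einf_sup c.
by rewrite /= subrr /abs_norm normr0.
Qed.

End real_class.

Section L2_hilbert.
Context {R : realType} {d : nat} {D : set 'rV[R]_d}.
Hypothesis mD : measurable D.
Local Notation mu := (lebesgue_row d : {measure set 'rV[R]_d -> \bar R}).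
Local Notation rV := 'rV[R]_d.
Implicit Types f g : rV -> R.

Let MC := @real_measurability_class _ rV R mu.
Let SN := @abs_seminormed R.

Let two1 : 1 <= 2 :> R. Proof. by rewrite ler1n. Qed.

Local Notation LN := (@Lp_norm _ rV R mu R^o (@abs_norm R) 2).
Local Notation LV := (@Lp_space _ rV R mu R^o (@abs_norm R) (measurable_fun setT) 2).

(* L^2(D) is pulled back from L^2 of the whole space by the restriction to D. *)
Let rest f : rV -> R^o := f \_ D.

Let restD f g : rest (f + g) = rest f + rest g.
Proof.
by apply/funext => t; rewrite /rest !fctE !patchE; case: ifPn => _ //; rewrite addr0.
Qed.

Let restZ (a : R) f : rest (a *: f) = a *: rest f.
Proof.
by apply/funext => t; rewrite /rest !fctE !patchE; case: ifPn => _ //; rewrite scaler0.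
Qed.

Let rest0 : rest 0 = 0.
Proof. by apply/funext => t; rewrite /rest !patchE; case: ifPn. Qed.

Lemma L2_normE f : L2_norm D f = LN (rest f).
Proof. by rewrite /L2_norm -Lnorm_abse. Qed.

Lemma L2E f : L2 D f <-> LV (rest f).
Proof.
rewrite /L2 /=; split.
- case/andP; rewrite !inE/= => mf ff; split => //.
  by rewrite -L2_normE.
- move=> [mf ff]; apply/andP; rewrite !inE/=; split => //.
  by rewrite /finite_norm; rewrite -L2_normE in ff.
Qed.

Let LSN := Lp_seminormed SN MC two1.

Lemma L2_seminormed : seminormed (L2 D) (L2_norm D).
Proof.
split.
- by apply/L2E; rewrite rest0; exact: (sn0 LSN).
- by move=> f g /L2E Lf /L2E Lg; apply/L2E; rewrite restD; exact: (snD LSN).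
- by move=> a f /L2E Lf; apply/L2E; rewrite restZ; exact: (snZ LSN).
- by move=> f; rewrite L2_normE; exact: (snN_ge0 LSN).
- by move=> f /L2E Lf; rewrite L2_normE; exact: (snN_lty LSN).
- by move=> f g /L2E Lf /L2E Lg; rewrite !L2_normE restD; exact: (snN_D LSN).
- by move=> a f /L2E Lf; rewrite !L2_normE restZ; exact: (snN_Z LSN).
Qed.

Let restB f g : rest (f - g) = rest f - rest g.
Proof. by rewrite -!(scaleN1r g) restD restZ scaleN1r. Qed.

Lemma L2_complete : seminorm_complete (L2 D) (L2_norm D).
Proof.
move=> u Lu uC.
have [|e e0|g Lg gc] := Lp_complete SN MC two1 (@abs_complete R) (u := fun n => rest (u n)).
- by move=> n; exact/L2E.
- have [n0 hn0] := uC e e0; exists n0 => m n n0m n0n.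
  by rewrite -restB -L2_normE; exact: hn0.
have mg : measurable_fun setT (rest g).
  by apply/(measurable_restrictT _ mD); apply: measurable_funTS; case: Lg.
have restK f : rest (rest f) = rest f.
  by apply/funext => t; rewrite /rest !patchE; case: (t \in D).
exists (rest g).
  apply/L2E; rewrite restK; split => //.
  apply: le_lt_trans (snN_lty LSN Lg); apply: (Lp_norm_ae_le SN MC two1); first by case: Lg.
  by apply: aeW => t; rewrite /rest patchE; case: ifPn => // _; rewrite lee_fin normr0.
apply: cvge0_le gc => n; first exact: (snN_ge0 L2_seminormed).
rewrite L2_normE restB restK.
apply: (Lp_norm_ae_le SN MC two1).
  have /L2E Lun := Lu n.
  by have [] := snB LSN Lg Lun.
apply: aeW => t; rewrite !fctE /rest !patchE; case: ifPn => // _.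
by rewrite subrr lee_fin normr0.
Qed.

Lemma L2_integrable f g : L2 D f -> L2 D g -> mu.-integrable D (EFin \o (f \* g)).
Proof.
move=> Lf Lg; have := Lfun2_mul_Lfun1 Lf Lg; move/Lfun1_integrable => h.
apply/(integrable_mkcond _ mD); move: h; congr (mu.-integrable setT).
apply/funext => t; rewrite /= !patchE; case: ifPn => // _; by rewrite /= mulr0.
Qed.

Lemma L2_inner_product : inner_product (L2 D) (L2_norm D) (inner D).
Proof.
split.
- by move=> f g _ _; apply: eq_Rintegral => t _; rewrite mulrC.
- move=> f g h Lf Lg Lh; rewrite /inner -RintegralD//; try exact: L2_integrable.
  by apply: eq_Rintegral => t _; rewrite fctE mulrDl.
- move=> a f g Lf Lg; rewrite /inner -RintegralZl//; last exact: L2_integrable.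
  by apply: eq_Rintegral => t _; rewrite !fctE -mulrA.
- move=> f Lf; rewrite /L2_norm unlock.
  have -> : (\int[mu]_t (`|(EFin \o f \_ D) t| `^ 2) = (inner D f f)%:E)%E.
    rewrite /inner /Rintegral fineK; last first.
      exact: (integrable_fin_num mD (L2_integrable Lf Lf)).
    rewrite [RHS]integral_mkcond; apply: eq_integral => t _.
    rewrite /= !patchE; case: ifPn => _ /=.
      by rewrite powR_mulrn// -normrX ger0_norm ?sqr_ge0// expr2.
    by rewrite normr0 powR0.
  by rewrite poweR_EFin powR12_sqrt// /inner; apply: Rintegral_ge0 => t _; exact: sqr_ge0.
Qed.

End L2_hilbert.

(** * The solution operator and the regularity estimate *)
Lemma measurable_convex_polygonal_domain (R : realType) d (D : set 'rV[R]_d) :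
  convex_polygonal_domain D -> measurable D.
Proof.
move=> [_ _ [m [a [b ->]]]].
rewrite (_ : (fun x => _) =
    \bigcap_(i : 'I_m) [set x : 'rV[R]_d | \sum_j a i ord0 j * x ord0 j < b i]); last first.
  by apply/seteqP; split => x /= h i; [move=> _; exact: h|exact: (h i I)].
apply: fin_bigcap_measurable => // i _.
pose f (x : 'rV[R]_d) := \sum_j a i ord0 j * x ord0 j.
have mf : measurable_fun setT f.
  apply: measurable_sum => j; apply: measurable_funM => //; exact: measurable_coor.
have := mf measurableT `]-oo, b i[%classic (measurable_itv _).
by rewrite setTI; congr measurable; apply/seteqP; split => x; rewrite /= in_itv.
Qed.

Section solution_operator.
Context {R : realType} {d : nat} {D : set 'rV[R]_d}.
Context {lam : nat -> R} {phi : nat -> 'rV[R]_d -> R} {alpha beta : R}.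
Hypothesis mD : measurable D.
Hypothesis phi_basis : orthonormal_basis D phi.
Hypothesis lam_gt0 : forall k, 0 < lam k.
Hypotheses (alpha0 : 0 < alpha) (alpha1 : alpha < 1).

Let SN := @L2_seminormed R d D.
Let VC := L2_complete mD.
Let IP := L2_inner_product mD.
Local Notation is_mult := (@is_multiplier R _ (L2 D) (L2_norm D) (inner D) phi).

Let Vphi k : L2 D (phi k). Proof. by have [h _ _] := phi_basis. Qed.
Let ortho j k : inner D (phi j) (phi k) = (j == k)%:R. Proof. by have [_ h _] := phi_basis. Qed.
Let basis f : L2 D f ->
  L2_norm D (\sum_(k < n) inner D f (phi k) *: phi k - f) @[n --> \oo] --> 0%E.
Proof. by have [_ _ h] := phi_basis; exact: h. Qed.

Let m r k := relax alpha (lam k `^ beta) r.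

Let l0 k : 0 < lam k `^ beta. Proof. exact: powR_gt0. Qed.

Let G0 : 0 < Gamma alpha. Proof. exact: Gamma_gt0. Qed.

(** The bound on the Mittag-Leffler function makes the series defining S_0 converge in
    L^2(D). *)
Lemma S0_multiplier r psi : 0 < r -> L2 D psi ->
  is_mult (m r) psi (S0 D lam phi alpha beta r psi).
Proof.
move=> r0 Lpsi.
pose ml k := mittag_leffler alpha alpha (- (lam k `^ beta * r `^ alpha)).
have mlB k : `|ml k| <= (Gamma alpha)^-1.
  have x0 : 0 < lam k `^ beta * r `^ alpha by rewrite mulr_gt0 ?powR_gt0.
  have /andP[h1 h2] := mittag_leffler_bounded alpha0 alpha1 x0.
  by rewrite ger0_norm.
have B0 : 0 <= (Gamma alpha)^-1 by rewrite invr_ge0 (ltW G0).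
have [v hv] := multiplier_exists SN IP Vphi ortho basis VC B0 mlB Lpsi.
have hs : is_mult ml psi (L2_series D (fun k => (ml k * inner D psi (phi k)) *: phi k)).
  by apply: xgetPex; exists v.
apply: (is_multiplier_scale SN Vphi (c := r `^ (alpha - 1)) Lpsi _ hs) => k.
by rewrite /m /relax mulrA.
Qed.

Let m_le r k : 0 < r -> `|m r k| <= 7 / Gamma alpha * r `^ (alpha - 1).
Proof.
move=> r0; apply: (le_trans (relax_le alpha0 alpha1 (l0 k) r0)).
apply: ler_wpM2r; first exact: powR_ge0.
by rewrite ler_peMl ?invr_ge0 ?(ltW G0)// ler1n.
Qed.

(** The difference S_0(r2) - S_0(r1) is the multiplier with symbol the difference of the
    symbols, to which [relax_holder] applies. *)
Lemma S0_singular_kernel :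
  singular_kernel (L2 D) (L2_norm D) alpha (7 / Gamma alpha) (S0 D lam phi alpha beta).
Proof.
have c0 r : 0 <= 7 / Gamma alpha * r `^ (alpha - 1).
  by rewrite mulr_ge0 ?powR_ge0// divr_ge0// (ltW G0).
split.
- by move=> r x r0 Lx; have [] := S0_multiplier r0 Lx.
- move=> r x y r0 Lx Ly; have Lxy := snD SN Lx Ly.
  apply: (multiplier_unique SN IP Vphi ortho basis Lxy (S0_multiplier r0 Lxy)).
  exact: (is_multiplierD SN IP Vphi Lx Ly (S0_multiplier r0 Lx) (S0_multiplier r0 Ly)).
- move=> r b x r0 Lx; have Lbx := snZ SN b Lx.
  apply: (multiplier_unique SN IP Vphi ortho basis Lbx (S0_multiplier r0 Lbx)).
  apply: (is_multiplier_scale SN Vphi Lx _ (S0_multiplier r0 Lx)) => k.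
  by rewrite (ipZ IP)// mulrCA.
- move=> r x r0 Lx.
  exact: (multiplier_le SN IP Vphi ortho basis (c0 r) (fun k => m_le k r0) Lx (S0_multiplier r0 Lx)).
- move=> r1 r2 th x r10 r12 th01 Lx; have r20 := lt_trans r10 r12.
  apply: (multiplier_le SN IP Vphi ortho basis _ _ Lx
    (is_multiplierB SN Vphi Lx (S0_multiplier r20 Lx) (S0_multiplier r10 Lx))).
    by rewrite !mulr_ge0 ?powR_ge0// invr_ge0 (ltW G0).
  by move=> k; exact: relax_holder.
Qed.

End solution_operator.

Theorem proposition2p1 (R : realType) (d : nat) (D : set 'rV[R]_d)
    (dO : measure_display) (Omega : measurableType dO) (P : probability Omega R)
    (lam : nat -> R) (phi : nat -> 'rV[R]_d -> R)
    (T alpha beta p : R) (G : R -> Omega -> 'rV[R]_d -> R)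
    (hT : 0 < T) (hP : measure_is_complete P)
    (hd : (1 <= d <= 3)%N) (hD : convex_polygonal_domain D)
    (hA : dirichlet_eigenbasis D lam phi)
    (halpha : 0 < alpha < 1) (hbeta : 0 < beta <= 1) (hp : 2 <= p)
    (Gmeas : strongly_measurable lebesgue_measure
       (LpH D P p) (LpH_norm D P p) `[0, T] G)
    (Gbnd : (ereal_sup [set LpH_norm D P p (G t) | t in (`[0%R, T]%classic : set R)] < +oo)%E) :
  let norm := LpH_norm D P p in
  let conv := S0_convolution D P lam phi alpha beta p in
  let Upsilon := conv G in
  let Phi := conv (fun=> G 0) in
  let Psi := conv (fun u => G u - G 0) in
  [/\ forall t, 0 <= t <= T -> norm (Upsilon t - (Phi t + Psi t)) = 0%E,
      exists2 C : R, 0 < C & forall s t, 0 < s -> s < t -> t <= T ->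
        (norm (Phi t - Phi s)%R <= (C * (t `^ alpha - s `^ alpha))%:E)%E
    & forall K mu nu : R, 0 < K -> mu < 1 -> - alpha < nu < 1 ->
        (forall u1 u2, 0 < u1 -> u1 < u2 -> u2 <= T ->
          (norm (G u2 - G u1)%R <= (K * u1 `^ (- mu) * (u2 - u1) `^ nu)%:E)%E) ->
        exists2 eps0 : R, 0 < eps0 & forall eps, 0 < eps < eps0 ->
          exists2 C : R, 0 < C & forall s t, 0 < s -> s < t -> t <= T ->
            let bound := C * (t `^ alpha - s `^ alpha)
              + C * s `^ (- mu) * (t - s) `^ (Num.min (alpha + nu - eps) 1) in
            (norm (Psi t - Psi s)%R <= bound%:E)%E /\
            (norm (Upsilon t - Upsilon s)%R <= bound%:E)%E].
Proof.
move=> norm conv Upsilon Phi Psi.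
have [a0 a1] := andP halpha.
have mD := measurable_convex_polygonal_domain hD.
have [l0 lmono phib _] := hA.
have lam0 k : 0 < lam k by apply: (lt_le_trans l0); exact: lmono.
have p1 : 1 <= p by apply: le_trans hp; rewrite ler1n.
have Poo : (P setT < +oo)%E by rewrite probability_setT ltry.
have SN2 := @L2_seminormed R d D.
have MC := strongly_measurable_measurability_class SN2 Poo.
have SN : seminormed (LpH D P p) norm := Lp_seminormed SN2 MC p1.
have VC : seminorm_complete (LpH D P p) norm := Lp_complete SN2 MC p1 (L2_complete mD).
pose C := 7 / Gamma alpha.
have C0 : 0 <= C by rewrite divr_ge0// (ltW (Gamma_gt0 a0)).
have SK2 : singular_kernel (L2 D) (L2_norm D) alpha C (S0 D lam phi alpha beta).
  exact: S0_singular_kernel.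
have SK : singular_kernel (LpH D P p) norm alpha C
    (fun r X w => S0 D lam phi alpha beta r (X w)) := Lp_singular_kernel SN2 SK2 C0 p1 Poo.
exact: (convolution_regularity SN SK C0 a0 a1 VC hT Gmeas Gbnd).
Qed.
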